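(* Let $r_*=61/20$ and $t_*=\left(5r_*/(6-r_* )\right)^{1/2}=(305/59)^{1/2}$. Then $$q_5(r_* )>\frac{51}{625},\qquad \frac{163}{2000}<q_6(r_* )<\frac{1631}{20000},$$ and hence $$q_5(r_* )-q_6(r_* )>\frac1{20000},\qquad q_6(r_* )<0.0832<\alpha_0.$$ Moreover, with $\varepsilon=10^{-14}$, $p=10^{-5}$ and the symmetric unimodal density $$f_{p,\varepsilon}(x)=\frac{p}{2\varepsilon}\mathbf 1_{\{|x|<\varepsilon\}}+\frac{1-p}{2}\mathbf 1_{\{|x|<1\}},$$ one has $$\mathbb P_{f_{p,\varepsilon}}\{|T_6|>t_*\}-\mathbb P_U\{|T_6|>t_*\}>\frac{1}{2\cdot10^9}.$$
   Context: For an integer $n\ge1$ and real $r$, let $U_1,\dots,U_n$ be i.i.d. uniform on $[-1,1]$ and put $$q_n(r)=\mathbb P\left\{\frac{(U_1+\cdots+U_n)^2}{U_1^2+\cdots+U_n^2}>r\right\}.$$ $\Phi$ is the standard normal distribution function and $\alpha_0=2\{1-\Phi(\sqrt3)\}$. Student's statistic for a sample $X_1,\dots,X_n$ from a law symmetric about $0$ is $$T_n=\frac{\sqrt n\,\bar X_n}{S_n},\qquad \bar X_n=\frac1n\sum_{i=1}^nX_i,\qquad S_n^2=\frac1{n-1}\sum_{i=1}^n(X_i-\bar X_n)^2.$$ $\mathbb P_f$ means the $X_i$ are i.i.d. with density $f$, and $\mathbb P_U$ means the $X_i$ are i.i.d. uniform on $[-1,1]$. *)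

(* Defs.v *)
From HB Require Import structures.
From mathcomp Require Import all_boot all_order all_algebra.
From mathcomp Require Import all_classical all_reals all_analysis.

Set Implicit Arguments.
Unset Strict Implicit.
Unset Printing Implicit Defensive.

Import Order.TTheory GRing.Theory Num.Theory.
Import numFieldNormedType.Exports.

Local Open Scope classical_set_scope.
Local Open Scope ring_scope.

Section iid.
Context {d : measure_display} {T : measurableType d} {R : realType}
  {P : probability T R} {n : nat}.
Implicit Types X : 'I_n -> {RV P >-> R}.

Definition mutually_independent X : Prop :=
  forall (J : {set 'I_n}) (A : 'I_n -> set R),
    (forall i, i \in J -> measurable (A i)) ->
    P (\bigcap_(i in [set i | i \in J]) (X i @^-1` A i)) =
    (\prod_(i in J) P (X i @^-1` A i))%E.

Definition iid X (mu : set R -> \bar R) : Prop :=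
  mutually_independent X /\
  forall i (A : set R), measurable A -> distribution P (X i) A = mu A.

End iid.

Section laws.
Context {R : realType}.
Implicit Types f : R -> R.

Definition density_law f : set R -> \bar R :=
  fun A => (\int[lebesgue_measure]_(x in A) (f x)%:E)%E.

Definition uniform_law : set R -> \bar R := uniform_prob (gtrN (@ltr01 R)).

Definition is_density f : Prop :=
  [/\ measurable_fun setT f, forall x, 0 <= f x & density_law f setT = 1%E].

Definition symmetric_about0 f : Prop := forall x, f (- x) = f x.

Definition unimodal f : Prop :=
  exists m : R,
    {in `]-oo, m] &, {homo f : x y / x <= y}} /\
    {in `[m, +oo[ &, {homo f : x y / x <= y >-> y <= x}}.

Definition spike_density (p eps : R) : R -> R := fun x =>
  p / (2 * eps) * \1_[set y : R | `|y| < eps] x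
  + (1 - p) / 2 * \1_[set y : R | `|y| < 1] x.

Definition Phi (x : R) : R := fine (normal_prob 0 1 `]-oo, x]).

Definition alpha0 : R := 2 * (1 - Phi (Num.sqrt 3)).

End laws.

(* Division by 0 yields 0, so that below the ratio is 0 when all x_i vanish,
   and T_n is 0 when S_n = 0; for laws with a density these are null events. *)
Section statistics.
Context {R : realType} {n : nat}.
Implicit Types x : 'I_n -> R.

Definition sum_sq_ratio x : R := (\sum_i x i) ^+ 2 / \sum_i x i ^+ 2.

Definition sample_mean x : R := n%:R^-1 * \sum_i x i.

Definition sample_sd x : R :=
  Num.sqrt ((n%:R - 1)^-1 * \sum_i (x i - sample_mean x) ^+ 2).

Definition student_t x : R := Num.sqrt n%:R * sample_mean x / sample_sd x.

End statistics.

Section tail_probabilities.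
Context {d : measure_display} {T : measurableType d} {R : realType}
  {P : probability T R} {n : nat}.
Implicit Types X : 'I_n -> {RV P >-> R}.

(* q X r is the number q_n(r) when X is an i.i.d. family of n variables
   uniform on [-1, 1]. *)
Definition q X (r : R) : R :=
  fine (P [set w | r < sum_sq_ratio (fun i => X i w)]).

Definition student_tail X (t : R) : R :=
  fine (P [set w | t < `|student_t (fun i => X i w)|]).

End tail_probabilities.

(* Main.v *)
(** By symmetry q_n(r) is twice the probability that 0 < S and r Q < S^2, where S is the sum
    and Q the sum of squares of the coordinates.  Conditioning repeatedly on the largest
    coordinate y leads, in dimension k, to the regions
      x_j < y,  0 < s + sum x_j,  r (c + sum x_j^2) < (s + sum x_j)^2,
    whose volume depends on A = (s + k y)^2 - r (c + k y^2) and B = s + k y - r y only.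
    Since dA/dy = 2 k B and dB/dy = k - r, with W = sqrt (B^2 + (r - 1) A) and t = (W - B) / W
    the function (W - B)^k Q_k(t) bounds that volume from below (above) as soon as a first
    order differential operator maps Q_k below (above) k Q_(k-1).  For explicit polynomials
    Q_k this is a polynomial inequality on an interval, decided by integer arithmetic.

    The law with density f_{p,eps} is a mixture of the uniform laws on [-eps, eps] and [-1, 1].
    Dropping the event of two or more spiked coordinates, the tail of T_6 is at least
    (1 - p)^6 q_6 + 6 p (1 - p)^5 q', where q' is the probability for five uniform coordinates
    and an arbitrary sixth one smaller than eps; q' is close to q_5, which exceeds q_6.

    The bound on alpha_0 comes from Laplace's continued fraction for Mills' ratio. *)

From Stdlib Require Import ZArith.
From HB Require Import structures.
Require Import Defs.
From mathcomp Require Import all_boot all_order all_algebra.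
From mathcomp Require Import all_classical all_reals all_analysis measurable_realfun.
From mathcomp Require Import zify ssrZ ring lra.

Set Implicit Arguments.
Unset Strict Implicit.
Unset Printing Implicit Defensive.

Import Order.TTheory GRing.Theory Num.Theory.
Import numFieldNormedType.Exports.

Local Open Scope classical_set_scope.
Local Open Scope ring_scope.

(** * Conditioning on one coordinate *)

Section freeze.
Context {d : measure_display} {T : measurableType d} {R : realType}
  {P : probability T R} {n : nat}.
Variable X : 'I_n -> {RV P >-> R}.

(** Two facts make A and B sufficient. Writing x_j = y - v_j turns the form (s + sum x_j)^2 - r (c +
    sum x_j^2) into A - 2 B sum v_j + (sum v_j)^2 - r sum v_j^2, so that the region seen from its
    corner (y, ..., y) involves nothing else. And the lower faces x_j = -1 of the cube are never
    met: the root y_0 of A below z satisfies y_0 >= -1. This is the obstacle that ties the method to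
    particular n and r; it rests on (n - 2)^2 <= r n, true for n = 5 and n = 6. Since the region is
    empty below y_0, the exact volume satisfies dV_k/dy = k V_(k-1) with V_k = 0 at y_0, and a
    one-sided differential inequality integrates from y_0 to a one-sided bound. The ansatz (W - B)^k
    Q_k(t) is the homogeneity of volume: W - B is a length and t is scale-free. The last
    integration, over the largest coordinate of all, is therefore that of a monomial, with t fixed
    at a single value; there a local enclosure of Q_k gives the numbers. The Q_k need many digits
    because q_5 and q_6 differ by less than 10^-4. *)

Definition cylinders (J : {set 'I_n}) : set (set T) :=
  [set \bigcap_(j in [set j | j \in J]) (X j @^-1` A j) |
    A in [set A : 'I_n -> set R | forall j, measurable (A j)]].

(* T with the sigma-algebra generated by the X j, j \in J. *)
Definition frozen J := g_sigma_algebraType (cylinders J).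

Lemma measurable_cylinders J : cylinders J `<=` measurable.
Proof.
move=> _ [A mA <-]; apply: fin_bigcap_measurable => // j _.
exact: measurable_funPTI.
Qed.

Lemma setI_closed_cylinders J : setI_closed (cylinders J).
Proof.
move=> _ _ [A mA <-] [B mB <-].
exists (fun j => A j `&` B j); first by move=> j; exact: measurableI.
by rewrite -bigcapI; apply: eq_bigcapr => j _; rewrite preimage_setI.
Qed.

Lemma cylindersT J : cylinders J setT.
Proof. by exists (fun=> setT) => //; apply/seteqP; split. Qed.

Lemma measurable_frozen J :
  (@measurable _ (frozen J) : set (set T)) `<=` @measurable _ T.
Proof.
apply: smallest_sub; first exact: sigma_algebra_measurable.
exact: measurable_cylinders.
Qed.

Lemma frozen_measurable_fun (J : {set 'I_n}) j : j \in J ->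
  measurable_fun [set: frozen J] (X j : frozen J -> R).
Proof.
move=> jJ _ A mA; rewrite setTI; apply: sub_sigma_algebra.
exists (fun i => if i == j then A else setT).
  by move=> i; case: ifP.
apply/seteqP; split => [w /(_ j jJ)/=|w /= XA i /= _]; first by rewrite eqxx.
by case: eqP => // ->.
Qed.

(** Both sides are finite measures in [B]. They agree on the cylinders, a pi-system containing the
    whole space, by independence over [i |: J] with [A] placed at index [i]; hence they agree on the
    generated sigma-algebra. *)
Lemma indep_frozen (i : 'I_n) (J : {set 'I_n}) (A : set R) (B : set T) :
  mutually_independent X -> i \notin J -> measurable A ->
  @measurable _ (frozen J) B ->
  P (X i @^-1` A `&` B) = (P (X i @^-1` A) * P B)%E.
Proof.
move=> iX iJ mA mB.
have mXA : measurable (X i @^-1` A) by exact: measurable_funPTI.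
have finA : P (X i @^-1` A) \is a fin_num by rewrite fin_num_measure.
pose c := NngNum (fine_ge0 (measure_ge0 P (X i @^-1` A))).
pose m1 : {measure set T -> \bar R} := mrestr P mXA.
pose m2 : {measure set T -> \bar R} := mscale c P.
suff -> : (P (X i @^-1` A) * P B = m2 B)%E.
  suff <- : m1 B = m2 B by rewrite /m1/= /mrestr setIC.
  apply: (@g_sigma_algebra_measure_unique _ _ _ (cylinders J) _ (fun=> setT)) => //.
  - exact: measurable_cylinders.
  - by move=> _; exact: cylindersT.
  - by apply/seteqP; split => // x _; exists 0%N.
  - exact: setI_closed_cylinders.
  - move=> _ [D mD <-]; rewrite /m1 /m2/= /mrestr /mscale/= fineK//.
    rewrite (iX J D (fun j _ => mD j)).
    have /(_ (i |: J)) := iX.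
    move=> /(_ (fun j => if j == i then A else D j)).
    rewrite big_setU1//= eqxx.
    under eq_bigr => j jJ.
      rewrite (_ : (j == i) = false); last first.
        by apply/eqP => ji; move: jJ iJ; rewrite ji => ->.
      over.
    move=> <- => [|j _]; last by case: ifP.
    congr (P _); apply/seteqP; split => [w /= [wD wA] j /=|w /= wAD].
      rewrite in_setU1 => /orP[/eqP ->|jJ]; first by rewrite eqxx.
      by case: eqP => [->//|_]; exact: wD.
    split => [j /= jJ|].
      have := wAD j; rewrite /= in_setU1 jJ orbT => /(_ isT).
      by case: eqP => // ji; move: jJ iJ; rewrite ji => ->.
    by have := wAD i; rewrite /= in_setU1 !eqxx => /(_ isT).
  - by move=> _; rewrite /m1/= /mrestr setTI ltey_eq fin_num_measure.
by rewrite /m2/= /mscale/= fineK.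
Qed.

(** Fubini without forming the vector of the remaining coordinates: the second component of the pair
    is the sample point itself, seen through the coarser sigma-algebra of [frozen J]. Independence
    makes the joint law a product, and the inner integral is a probability over the original
    space. *)
Lemma freeze (i : 'I_n) (J : {set 'I_n}) (C : set (R * frozen J)) :
  mutually_independent X -> i \notin J -> measurable C ->
  (P [set w | C (X i w, w)] =
   \int[distribution P (X i)]_x P [set w | C (x, w)])%E.
Proof.
move=> iX iJ mC.
have mid : measurable_fun [set: T] (idfun : T -> frozen J).
  by move=> _ A mA; rewrite setTI; move: mA; apply: measurable_frozen.
pose idm : {mfun T >-> frozen J} := HB.pack (idfun : T -> frozen J)
  (isMeasurableFun.Build _ _ _ _ _ mid).
have mp : measurable_fun [set: T] (fun w => (X i w, w : frozen J)).
  by apply: measurable_fun_pair => //.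
pose pm : {mfun T >-> (R * frozen J)%type} := HB.pack (fun w => (X i w, w : frozen J))
  (isMeasurableFun.Build _ _ _ _ _ mp).
transitivity (distribution P pm C) => //.
rewrite -(@product_measure_unique _ _ _ _ _ (distribution P (X i))
  (distribution P idm) (distribution P pm))//; last first.
  move=> A B mA mB; rewrite /distribution/= /pushforward/=.
  by rewrite -(indep_frozen iX iJ mA mB).
rewrite /product_measure1; apply: eq_integral => x _ /=.
rewrite /distribution/= /pushforward/=; congr (P _).
by rewrite /xsection/=; apply/seteqP; split => w /=; rewrite inE.
Qed.

Lemma measurable_slice (J : {set 'I_n}) (C : set (R * frozen J)) :
  measurable C -> measurable_fun [set: R] (fun x => P [set w | C (x, w)]).
Proof.
move=> mC.
have mid : measurable_fun [set: T] (idfun : T -> frozen J).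
  by move=> _ A mA; rewrite setTI; move: mA; apply: measurable_frozen.
pose idm : {mfun T >-> frozen J} := HB.pack (idfun : T -> frozen J)
  (isMeasurableFun.Build _ _ _ _ _ mid).
have := measurable_fun_xsection (distribution P idm) mC.
apply: eq_measurable_fun => x _ /=.
rewrite /distribution/= /pushforward/=; congr (P _).
by rewrite /xsection/=; apply/seteqP; split => w /=; rewrite inE.
Qed.

End freeze.

(** * Certified polynomial inequalities *)

Delimit Scope Z_scope with BZ.

Section zpoly.

Fixpoint zadd (p q : seq Z) : seq Z :=
  match p, q with
  | [::], _ => q
  | _, [::] => p
  | a :: p', b :: q' => (a + b)%BZ :: zadd p' q'
  end.

Definition zscale (a : Z) : seq Z -> seq Z := map (Z.mul a).

Fixpoint zmul (p q : seq Z) : seq Z :=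
  if p is a :: p' then zadd (zscale a q) (0%BZ :: zmul p' q) else [::].

Fixpoint zder (p : seq Z) : seq Z :=
  if p is _ :: p' then zadd p' (0%BZ :: zder p') else [::].

(* b^(size p - 1) p(a x / b) *)
Fixpoint zhom (a b : Z) (p : seq Z) : seq Z :=
  if p is c :: p' then
    (c * b ^ Z.of_nat (size p'))%BZ :: zscale a (zhom a b p')
  else [::].

Fixpoint zshift (a : Z) (p : seq Z) : seq Z :=
  if p is c :: p' then
    let s := zshift a p' in zadd [:: c] (zadd (0%BZ :: s) (zscale a s))
  else [::].

Definition zlow (p : seq Z) : Z :=
  if p is c :: p' then foldr (fun x s => Z.add (Z.min 0 x) s) c p' else 0%BZ.

(* Bisection of [0, 1]: the two halves are rescaled to [0, 1] by x / 2 and (x + 1) / 2. *)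
Fixpoint zpos (fuel : nat) (p : seq Z) : bool :=
  if (0 <=? zlow p)%BZ then true else
  if fuel is m.+1 then
    let h := zhom 1 2 p in if zpos m h then zpos m (zshift 1 h) else false
  else false.

Context {R : realType}.
Implicit Types (p q : seq Z) (x : R).

Definition zr (c : Z) : R := (int_of_Z c)%:~R.

Lemma zr0 : zr 0 = 0. Proof. by []. Qed.
Lemma zrD a b : zr (a + b)%BZ = zr a + zr b.
Proof. by rewrite /zr (rmorphD int_of_Z) rmorphD. Qed.
Lemma zrM a b : zr (a * b)%BZ = zr a * zr b.
Proof. by rewrite /zr (rmorphM int_of_Z) rmorphM. Qed.
Lemma zrX a n : zr (a ^ Z.of_nat n)%BZ = zr a ^+ n.
Proof.
elim: n => [//|n IH].
by rewrite Nat2Z.inj_succ Z.pow_succ_r; [rewrite zrM IH exprS|lia].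
Qed.
Lemma zr_ge0 c : (0 <=? c)%BZ -> 0 <= zr c.
Proof. by move=> /Z.leb_le c0; rewrite /zr ler0z; lia. Qed.

Fixpoint zeval p x : R := if p is c :: p' then zr c + x * zeval p' x else 0.

Lemma zevalD p q x : zeval (zadd p q) x = zeval p x + zeval q x.
Proof.
elim: p q => [|a p IH] [|b q] /=; rewrite ?add0r ?addr0//.
by rewrite IH zrD; ring.
Qed.

Lemma zevalZ a p x : zeval (zscale a p) x = zr a * zeval p x.
Proof. by elim: p => [|b p IH] /=; rewrite ?mulr0// IH zrM; ring. Qed.

Lemma zevalM p q x : zeval (zmul p q) x = zeval p x * zeval q x.
Proof.
by elim: p => [|a p IH] /=; rewrite ?mul0r// zevalD zevalZ /= IH zr0; ring.
Qed.

Lemma is_derive_zeval p x : is_derive x 1 (zeval p) (zeval (zder p) x).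
Proof.
elim: p => [|a p IH] /=; first exact: is_derive_cst.
have H : is_derive x 1 (fun y : R => zr a + y * zeval p y)
    (0 + (x *: zeval (zder p) x + zeval p x *: 1)).
  by apply: is_deriveD.
apply: (is_derive_eq H).
by rewrite add0r zevalD /= zr0 add0r /GRing.scale/= mulr1 addrC.
Qed.

Lemma zeval_hom a b p x : 0 < zr b ->
  zr b * zeval (zhom a b p) x = zr b ^+ (size p) * zeval p (zr a * x / zr b).
Proof.
move=> b0; elim: p => [|c p IH]; first by rewrite /= !mulr0.
have -> : size (c :: p) = (size p).+1 by [].
rewrite [zhom _ _ _]/= [zeval (_ :: _) _]/= [zeval (_ :: _) (_ / _)]/= zevalZ.
have -> : zr (c * b ^ Z.of_nat (size p))%BZ = zr c * zr b ^+ size p.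
  by rewrite zrM zrX.
rewrite mulrDr (_ : zr b * (x * (zr a * _)) = x * zr a * (zr b * zeval (zhom a b p) x));
  last by ring.
by rewrite IH exprS; field; exact: lt0r_neq0.
Qed.

Lemma zeval_shift a p x : zeval (zshift a p) x = zeval p (x + zr a).
Proof.
elim: p => [//|c p IH].
rewrite -[zshift _ _]/(zadd [:: c] (zadd (0%BZ :: zshift a p) (zscale a (zshift a p)))).
by rewrite !zevalD zevalZ /= IH zr0; ring.
Qed.

Lemma zlow_le p x : 0 <= x <= 1 -> zr (zlow p) <= zeval p x.
Proof.
case: p => [//|c p] /andP[x0 x1] /=.
(* [y] stands for the power of [x] reached so far. It stays in [0, 1], so a coefficient [a] times
   [y] is at least min(0, a). *)
have H q (y : R) : 0 <= y <= 1 ->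
    zr (foldr (fun a s => Z.add (Z.min 0 a) s) c q) <= zr c + y * zeval q x.
  elim: q y => [|a q IH] y /andP[y0 y1] /=; first by rewrite mulr0 addr0.
  have yx : 0 <= y * x <= 1 by rewrite mulr_ge0//= mulr_ile1.
  apply: (@le_trans _ _ (zr (Z.min 0 a) + (zr c + y * x * zeval q x))).
    by rewrite zrD lerD2l; exact: IH.
  suff : zr (Z.min 0 a) <= y * zr a by lra.
  have [a0|a0] := Z.min_spec 0 a; last first.
    have : zr a <= 0 by have := a0.1; rewrite /zr lerz0; lia.
    by rewrite a0.2; nra.
  have : 0 <= zr a by have := a0.1; rewrite /zr ler0z; lia.
  by rewrite a0.2 zr0; nra.
by apply: H; rewrite x0.
Qed.

Lemma zpos_ge0 f p x : zpos f p -> 0 <= x <= 1 -> 0 <= zeval p x.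
Proof.
elim: f p x => [|f IH] p x; rewrite [zpos _ _]/=.
  case: ifP => // /zr_ge0 lp _ x01; apply: le_trans lp _; exact: zlow_le.
case: ifP => [/zr_ge0 lp _ x01|_].
  by apply: le_trans lp _; exact: zlow_le.
case: ifP => // h1 h2 /andP[x0 x1].
have z2 : zr 2 = 2 by [].
have H y : 2 * zeval (zhom 1 2 p) y = 2 ^+ size p * zeval p (y / 2).
  by have := @zeval_hom 1 2 p y; rewrite z2 (_ : zr 1 = 1)// mul1r; apply.
suff : 0 <= 2 ^+ size p * zeval p x by rewrite pmulr_rge0// exprn_gt0.
have [x2|x2] := leP x (1 / 2).
  have := H (2 * x); rewrite (_ : 2 * x / 2 = x); last by field.
  move=> <-; rewrite mulr_ge0//; apply: (IH _ _ h1); lra.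
have := H (2 * x - 1 + 1); rewrite (_ : (2 * x - 1 + 1) / 2 = x); last by field.
move=> <-; rewrite mulr_ge0// -[1 in X in zeval _ X]/(zr 1) -zeval_shift; apply: (IH _ _ h2); lra.
Qed.

Lemma zpos_hom_ge0 f a b p x : (0 <? a)%BZ -> (0 <? b)%BZ ->
  zpos f (zhom a b p) -> 0 <= x <= zr a / zr b -> 0 <= zeval p x.
Proof.
move=> /Z.ltb_lt a0 /Z.ltb_lt b0 h /andP[x0 xab].
have za : 0 < zr a by rewrite /zr ltr0z; lia.
have zb : 0 < zr b by rewrite /zr ltr0z; lia.
have := @zeval_hom a b p (x * zr b / zr a) zb.
rewrite (_ : zr a * _ / zr b = x); last by field; rewrite !lt0r_neq0.
move=> E; suff : 0 <= zr b ^+ size p * zeval p x.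
  by rewrite pmulr_rge0// exprn_gt0.
rewrite -E mulr_ge0 ?(ltW zb)//; apply: (zpos_ge0 h).
apply/andP; split; first by rewrite divr_ge0 ?mulr_ge0 ?(ltW zb) ?(ltW za).
by rewrite ler_pdivrMr// mul1r -ler_pdivlMr.
Qed.

End zpoly.

(* The polynomials Q_k of the sub- and supersolutions, with coefficients multiplied by 10^16.
   They approximate the volume profile and were obtained by numerical collocation, with a
   safety margin that makes the inequalities of [zcheck] strict. *)
Definition Qlow (k : nat) : seq Z :=
  match k with
  | 0%N => [:: 10000000000000000]%BZ
  | 1%N => [:: 4878048775609756]%BZ
  | 2%N => [:: 1189767984827238; 590047204734276; 438951923831903; 303790711973342;
     195190151459151; 93623689744106; 100456239381039; (-106011402195952);
     152042495533176; (-124364330260998)]%BZ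
  | 3%N => [:: 193458184844093; 215865619169123; 257337634387071; 274354249627575;
     497593585008634; (-1526291972010226); 11731098543748861;
     (-46803733608867321); 131907413084020915; (-245756023347841298);
     296820230945154252; (-209237319937541823); 67258571552947300]%BZ
  | 4%N => [:: 23592062331613; 42218579929824; 56373780629975; 646990503455619;
     (-13693664551556986); 213208865859651962; (-2159440495363664014);
     15113899826265422444; (-75122140044234680330); 269217980435481929071;
     (-697867342727520118563); 1296657173632319617126;
     (-1683842459676729415089); 1451552079946679389824;
     (-746596307176985860708); 173520526037539248767]%BZ
  | 5%N => [:: 2301623200558; 5688005941195; 15704208513063; (-314013738501886);
     13794523058993464; (-340706976087051887); 5568721899052077710;
     (-63575699206635211282); 526334019548876160856;
     (-3237706257363448818989); 15022418595984071281447;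
     (-52963634372041739007395); 141931801172993534029524;
     (-286976386143846812153858); 430404043125698909011987;
     (-464044168342187687187828); 339952761954084044132460;
     (-151495824735100161437941); 30995636913912153521864]%BZ
  | _ => [::]
  end.

Definition Qup (k : nat) : seq Z :=
  match k with
  | 0%N => [:: 10000000000000000]%BZ
  | 1%N => [:: 4878048785365854]%BZ
  | 2%N => [:: 1189768008622598; 590047216535220; 438951932610941; 303790718049156;
     195190155362954; 93623691616580; 100456241390164; (-106011404316180);
     152042498574026; (-124364332748285)]%BZ
  | 3%N => [:: 193458262227382; 215865705515388; 257337737322146; 274354359369297;
     497593784046108; (-1526292582527137); 11731103236189217;
     (-46803752330364509); 131907465846996701; (-245756121650270297);
     296820349673270376; (-209237403632486537); 67258598456381302]%BZ
  | 4%N => [:: 23592581362693; 42219508748800; 56375020866792; 647004737403268;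
     (-13693965815491024); 213213556506297987; (-2159488003577152363);
     15114232335719204275; (-75123792749495411361); 269223903296202977605;
     (-697882695977945878689); 1296685700403934015916;
     (-1683879504618336660815); 1451584014443717684192;
     (-746612732476422048195); 173524343531104503849]%BZ
  | 5%N => [:: 2301807337779; 5688460999873; 15705464899999; (-314038860605851);
     13795626664982423; (-340734233735444787); 5569167414624624778;
     (-63580785466022117575); 526376127954776306955;
     (-3237965284225112361437); 15023620437545412460796;
     (-52967871632281911953433); 141943156171287305263095;
     (-286999345173099490005944); 430438476826496996848221;
     (-464081293360655800927352); 339979959262932724803217;
     (-151507944885885000844432); 30998116664055272218894]%BZ
  | _ => [::]
  end.

(** Coefficients of 20 times [op]: the factor 20 clears the denominator of [r0], and consing 0
    multiplies by t. *)
Definition zop (k : nat) (q : seq Z) : seq Z :=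
  let k' := Z.of_nat k in
  zadd (zmul [:: k' * (61 * (k' - 1) - (20 * k' - 61)); - (61 * k' * (k' - 1))]%BZ q)
       (zscale (- (1)) (0%BZ :: zmul [:: (20 * k' - 61) - 61 * (k' - 1);
                                    122 * (k' - 1); - (61 * (k' - 1))]%BZ (zder q))).

(* tnum k / 10^4 exceeds 1 - sqrt ((n - r) / (r (n - 1))), the largest value taken by t
   (see [tpar_bound]), for n = 6 if k = 5 and for n = 5 and n = 6 otherwise. *)
Definition tnum (k : nat) : Z := if k == 5%N then 5605%BZ else 6010%BZ.

(** The subsolution needs two inequalities; the second one makes its integrand nonnegative, as
    monotonicity of the integral requires. For the supersolution nonnegativity will follow from the
    probability that it dominates. *)
Definition zcheck (k : nat) : bool :=
  let pos p := zpos 9 (zhom (tnum k) 10000 p) in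
  let c := (20 * Z.of_nat k)%BZ in
  [&& pos (zadd (zscale c (Qlow k.-1)) (zscale (- (1)) (zop k (Qlow k)))),
      pos (zop k (Qlow k)) &
      pos (zadd (zop k (Qup k)) (zscale (- c) (Qup k.-1)))].

Lemma zcheckE : all zcheck (iota 1 5).
Proof. by vm_cast_no_check (erefl true). Qed.

Section op.
Context {R : realType}.

Definition r0 : R := 61 / 20.

(* The derivative of (W - B)^k q(t) along the flow dA/dy = 2 k B, dB/dy = k - r,
   divided by (W - B)^(k - 1) (see [is_derive_volfun]). *)
Definition op (k : nat) (q q' t : R) : R :=
  k%:R * ((k%:R - 1) * r0 * (1 - t) - (k%:R - r0)) * q
  - ((k%:R - r0) - r0 * (k%:R - 1) * (1 - t) ^+ 2) * t * q'.

Definition den : R := 10 ^+ 16.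

Definition qlow k t : R := zeval (Qlow k) t / den.
Definition qup k t : R := zeval (Qup k) t / den.
Definition qlow' k t : R := zeval (zder (Qlow k)) t / den.
Definition qup' k t : R := zeval (zder (Qup k)) t / den.
Definition tmax k : R := zr (tnum k) / zr 10000.

Lemma den_gt0 : 0 < den.
Proof. by rewrite exprn_gt0. Qed.

Lemma zrN a : zr (- a)%BZ = - zr a :> R.
Proof. by rewrite /zr (rmorphN int_of_Z) rmorphN. Qed.

Lemma zr_nat k : zr (Z.of_nat k) = k%:R :> R.
Proof. by rewrite /zr /intmul; case: k => //= k; rewrite SuccNat2Pos.id_succ. Qed.

Lemma zevalE a p (t : R) : zeval (a :: p) t = zr a + t * zeval p t.
Proof. by []. Qed.

Lemma zop_op k p t :
  zeval (zop k p) t = 20 * op k (zeval p t) (zeval (zder p) t) t :> R.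
Proof.
rewrite /zop zevalD zevalM zevalZ.
rewrite [in X in _ + X]zevalE zevalM !zevalE.
rewrite [zeval [::] t]/=.
rewrite /Z.sub !(zrM, zrD, zrN, zr_nat).
have -> : zr 1 = 1 :> R by [].
have -> : zr 0 = 0 :> R by [].
have -> : zr 20 = 20%:R :> R by [].
have -> : zr 61 = 61%:R :> R by [].
have -> : zr 122 = 122%:R :> R by [].
by rewrite /op /r0; field.
Qed.

Lemma zcheckP k : (0 < k <= 5)%N -> zcheck k.
Proof.
move=> k5; apply: (allP zcheckE).
by rewrite mem_iota ltnS.
Qed.

Lemma opZ k p t : op k (zeval p t / den) (zeval (zder p) t / den) t =
  op k (zeval p t) (zeval (zder p) t) t / den.
Proof. by move: den den_gt0 => D D0; rewrite /op; field; exact: lt0r_neq0. Qed.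

Lemma tmaxP k p t : zpos 9 (zhom (tnum k) 10000 p) -> 0 <= t <= tmax k ->
  0 <= zeval p t.
Proof. by apply: zpos_hom_ge0 => //; rewrite /tnum; case: ifP. Qed.

Lemma qlow_op k t : (0 < k <= 5)%N -> 0 <= t <= tmax k ->
  0 <= op k (qlow k t) (qlow' k t) t <= k%:R * qlow k.-1 t.
Proof.
move=> /zcheckP /and3P[c1 c2 _] tk.
have := tmaxP c2 tk; have := tmaxP c1 tk.
rewrite zevalD !zevalZ zop_op -!zevalZ /qlow /qlow' opZ => h1 h2.
rewrite divr_ge0 ?(ltW den_gt0)//=; last by lra.
rewrite mulrA ler_pM2r ?invr_gt0 ?den_gt0//.
move: h1; rewrite !zevalZ zrM zr_nat zrN.
have -> : zr 1 = 1 :> R by [].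
have -> : zr 20 = 20%:R :> R by [].
by lra.
Qed.

Lemma qup_op k t : (0 < k <= 5)%N -> 0 <= t <= tmax k ->
  k%:R * qup k.-1 t <= op k (qup k t) (qup' k t) t.
Proof.
move=> /zcheckP /and3P[_ _ c3] tk.
have := tmaxP c3 tk; rewrite zevalD !zevalZ zop_op /qup /qup' opZ => h.
rewrite mulrA ler_pM2r ?invr_gt0 ?den_gt0//.
move: h; rewrite zrN zrM zr_nat.
have -> : zr 20 = 20%:R :> R by [].
by lra.
Qed.

Lemma is_derive_qlow k (t : R) : is_derive t 1 (qlow k) (qlow' k t).
Proof.
have H := is_derive_zeval (Qlow k) t.
rewrite (_ : qlow' k t = zeval (Qlow k) t *: 0 + den^-1 *: zeval (zder (Qlow k)) t).
  exact: (@is_deriveM _ _ (zeval (Qlow k)) (cst den^-1)).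
by rewrite scaler0 add0r /GRing.scale/= mulrC.
Qed.

Lemma is_derive_qup k (t : R) : is_derive t 1 (qup k) (qup' k t).
Proof.
have H := is_derive_zeval (Qup k) t.
rewrite (_ : qup' k t = zeval (Qup k) t *: 0 + den^-1 *: zeval (zder (Qup k)) t).
  exact: (@is_deriveM _ _ (zeval (Qup k)) (cst den^-1)).
by rewrite scaler0 add0r /GRing.scale/= mulrC.
Qed.

Lemma qlow0 t : qlow 0 t = 1.
Proof.
rewrite /qlow [zeval _ _](_ : _ = den) ?divff ?lt0r_neq0 ?den_gt0//.
rewrite /= mulr0 addr0 -[10000000000000000%BZ]/(10 ^ Z.of_nat 16)%BZ zrX.
by congr (_ ^+ _).
Qed.

Lemma qup0 t : qup 0 t = 1.
Proof.
rewrite /qup [zeval _ _](_ : _ = den) ?divff ?lt0r_neq0 ?den_gt0//.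
rewrite /= mulr0 addr0 -[10000000000000000%BZ]/(10 ^ Z.of_nat 16)%BZ zrX.
by congr (_ ^+ _).
Qed.

End op.

(** * Variation of the volume along the conditioning variable *)

Section flow.
Context {R : realType}.
Implicit Types (s c y : R).

(** With n - k coordinates frozen (sum s, sum of squares c), [quadA] is the value of the quadratic
    form at the corner where the k free coordinates all equal y. [linB] gives its first-order part
    there: moving to y - v_j subtracts 2 B sum v_j. *)
Definition quadA k s c y : R := (s + k%:R * y) ^+ 2 - r0 * (c + k%:R * y ^+ 2).
Definition linB k s y : R := s + k%:R * y - r0 * y.
(** Along a coordinate axis from the corner the form is A - 2 B x - (r - 1) x^2, whose positive root
    is (W - B) / (r - 1). Thus W - B measures the size of the region. The exact profile is 1 / (r -
    1) = 20/41 for k = 1, and it tends to 1 / (k! (r - 1)^k), the volume of a simplex, as t tends to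
    0; this explains the leading coefficients of [Qlow] and [Qup]. *)
Definition disc (A B : R) := B ^+ 2 + (r0 - 1) * A.
Definition wroot (A B : R) := Num.sqrt (disc A B).
Definition tpar (A B : R) := (wroot A B - B) / wroot A B.
Definition volfun (q : R -> R) k (A B : R) : R :=
  (wroot A B - B) ^+ k * q (tpar A B).

Section derivative.
Variables (q q' : R -> R) (k : nat) (s c : R).
Hypothesis dq : forall t : R, is_derive t (1:R) q (q' t).
Hypothesis cq' : continuous q'.

Let A y := quadA k s c y.
Let B y := linB k s y.
Let D y := disc (A y) (B y).
Let W y := wroot (A y) (B y).

Definition dvolfun y : R :=
  (W y - B y) ^+ k.-1 * op k (q (tpar (A y) (B y))) (q' (tpar (A y) (B y))) (tpar (A y) (B y)).

Lemma is_derive_linB y : is_derive y (1:R) B (k%:R - r0).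
Proof.
rewrite /B /linB; apply: is_derive_eq.
by rewrite /GRing.scale/=; ring.
Qed.

Lemma is_derive_disc y : is_derive y (1:R) D (2 * r0 * (k%:R - 1) * B y).
Proof.
rewrite /D /disc /A /B /quadA /linB; apply: is_derive_eq.
by rewrite /GRing.scale/=; ring.
Qed.

Lemma is_derive_wroot y : 0 < D y ->
  is_derive y (1:R) W (r0 * (k%:R - 1) * B y / W y).
Proof.
move=> Dy.
have H1 := is_derive_disc y.
have H2 := is_derive1_sqrt Dy.
have := @is_derive1_comp _ Num.sqrt D y _ _ H2 H1.
have W0 : Num.sqrt (D y) != 0 by rewrite lt0r_neq0// sqrtr_gt0.
move=> /is_derive_eq; apply.
by rewrite /W /wroot -/(D y); field.
Qed.

Lemma is_derive_volfun y : (0 < k)%N -> 0 < D y ->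
  is_derive y (1:R) (fun y => volfun q k (A y) (B y)) (dvolfun y).
Proof.
move=> k0 Dy.
have W0 : W y != 0 by rewrite lt0r_neq0// sqrtr_gt0.
have HB := is_derive_linB y.
have HW := is_derive_wroot Dy.
have HV : is_derive y (1:R) (fun y => (W y)^-1)
    (- (W y) ^- 2 *: (r0 * (k%:R - 1) * B y / W y)).
  exact: is_deriveV.
have HWB : is_derive y (1:R) (fun y => W y - B y)
    (r0 * (k%:R - 1) * B y / W y - (k%:R - r0)) by exact: is_deriveB.
have HT : is_derive y (1:R) (fun y => (W y - B y) * (W y)^-1)
   ((W y - B y) *: (- (W y) ^- 2 *: (r0 * (k%:R - 1) * B y / W y)) +
     (W y)^-1 *: (r0 * (k%:R - 1) * B y / W y - (k%:R - r0))).
  exact: is_deriveM.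
have HQ := @is_derive1_comp _ q _ y _ _ (dq _) HT.
have HX : is_derive y (1:R) (fun y => (W y - B y) ^+ k)
   ((k%:R * (W y - B y) ^+ k.-1) *: (r0 * (k%:R - 1) * B y / W y - (k%:R - r0))).
  by have := is_deriveX k HWB; rewrite exprfctE.
apply: (is_derive_eq (is_deriveM HX HQ)).
rewrite /dvolfun /tpar -/(W y) /= -[in (_ ^+ k)](prednK k0) exprS /GRing.scale/= /op.
by field.
Qed.

Lemma continuous_dvolfun y : 0 < D y -> {for y, continuous dvolfun}.
Proof.
move=> Dy.
have W0 : W y != 0 by rewrite lt0r_neq0// sqrtr_gt0.
have cB : {for y, continuous B}.
  by apply: differentiable_continuous; apply/derivable1_diffP; have [] := is_derive_linB y.
have cW : {for y, continuous W}.
  by apply: differentiable_continuous; apply/derivable1_diffP; have [] := is_derive_wroot Dy.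
have cWB : {for y, continuous (fun y => W y - B y)} by exact: continuousB.
have cT : {for y, continuous (fun y => tpar (A y) (B y))}.
  by apply: continuousM => //; exact: continuousV.
have cq : continuous q.
  by move=> t; apply: differentiable_continuous; apply/derivable1_diffP; have [] := dq t.
have cQ : {for y, continuous (fun y => q (tpar (A y) (B y)))}.
  by apply: (@continuous_comp _ _ _ (fun y => tpar (A y) (B y)) q); [exact: cT|exact: cq].
have cQ' : {for y, continuous (fun y => q' (tpar (A y) (B y)))}.
  by apply: (@continuous_comp _ _ _ (fun y => tpar (A y) (B y)) q'); [exact: cT|exact: cq'].
have cst' (a : R) : {for y, continuous (fun=> a)} by exact: cst_continuous.
rewrite /dvolfun /op.
apply: continuousM; first by apply: (@continuous_comp _ _ _ (fun y => W y - B y) (fun x => x ^+ k.-1)); [exact: cWB|exact: exprn_continuous].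
have c1 : {for y, continuous (fun y => 1 - tpar (A y) (B y))} by exact: continuousB.
have c2 : {for y, continuous (fun y => (1 - tpar (A y) (B y)) ^+ 2)}.
  by apply: (@continuous_comp _ _ _ (fun y => 1 - tpar (A y) (B y)) (fun x => x ^+ 2)); [exact: c1|exact: exprn_continuous].
apply: continuousB.
  apply: continuousM => //; apply: continuousM => //; apply: continuousB => //.
  exact: continuousM.
apply: continuousM => //; apply: continuousM => //; apply: continuousB => //.
exact: continuousM.
Qed.

Lemma integral_dvolfun a b : (0 < k)%N -> a < b ->
  (forall y, a <= y <= b -> 0 < D y) ->
  (\int[lebesgue_measure]_(y in `[a, b]) (dvolfun y)%:E =
   (volfun q k (A b) (B b) - volfun q k (A a) (B a))%:E)%E.
Proof.
move=> k0 ab D0.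
rewrite (@continuous_FTC2 _ dvolfun (fun y => volfun q k (A y) (B y)))//.
- apply: continuous_in_subspaceT => y; rewrite inE/= in_itv/= => yab.
  by apply: continuous_dvolfun; exact: D0.
- have H y : a <= y <= b -> derivable (fun y => volfun q k (A y) (B y)) y 1.
    by move=> yab; have [] := is_derive_volfun k0 (D0 _ yab).
  have cL y : a <= y <= b -> {for y, continuous (fun y => volfun q k (A y) (B y))}.
    by move=> yab; apply: differentiable_continuous; apply/derivable1_diffP/H.
  split.
  + by move=> y; rewrite in_itv/= => /andP[ay yb]; apply: H; rewrite !ltW.
  + by apply: cvg_at_right_filter; apply: cL; rewrite lexx ltW.
  + by apply: cvg_at_left_filter; apply: cL; rewrite lexx ltW.
- move=> y; rewrite in_itv/= => /andP[ay yb].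
  rewrite derive1E; apply: derive_val.
  by apply: is_derive_volfun => //; apply: D0; rewrite !ltW.
Qed.

Lemma measurable_dvolfun a b : (forall y, a <= y <= b -> 0 < D y) ->
  measurable_fun `[a, b] dvolfun.
Proof.
move=> D0; apply: subspace_continuous_measurable_fun; first exact: measurable_itv.
apply: continuous_in_subspaceT => y; rewrite inE/= in_itv/= => yab.
by apply: continuous_dvolfun; exact: D0.
Qed.

End derivative.
End flow.

(** * Admissible states and the root of A *)

Section state.
Context {R : realType}.
Implicit Types (s c y z : R).

(* Consequences of: n - k coordinates, all in [z, 1], have sum s and sum of squares c. *)
Definition state (n k : nat) s c z :=
  [/\ (n%:R - k%:R) * z <= s, s <= n%:R - k%:R, s ^+ 2 <= (n%:R - k%:R) * c,
      z <= 1 & 0 < s + k%:R * z].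

Variables n k : nat.
Hypothesis n56 : (5 <= n <= 6)%N.
Hypothesis kn : (k < n)%N.

Local Notation N := (n%:R : R).
Local Notation K := (k%:R : R).
Local Notation r := (r0 : R).

Let rE : r = 61 / 20. Proof. by []. Qed.

Let facts : [/\ 1 < r, r < N, 5 <= N <= 6, 0 <= K & 1 <= N - K].
Proof.
have N5 : 5 <= N by rewrite (ler_nat _ 5); case/andP: n56.
have N6 : N <= 6 by rewrite (ler_nat _ _ 6); case/andP: n56.
split => //; rewrite ?rE ?N5 ?N6//; try lra.
by rewrite -natrB ?(ltnW kn)// (ler_nat _ 1) subn_gt0.
Qed.

Lemma quadA_shift s c z y : quadA k s c y =
  quadA k s c z - 2 * K * linB k s z * (z - y) + K * (K - r) * (z - y) ^+ 2.
Proof. by rewrite /quadA /linB; ring. Qed.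

(** The n coordinates of the corner are all at least z, hence N z <= s + K z. *)
Lemma linB_ge s c z : state n k s c z -> (N - r) * (s + K * z) <= N * linB k s z.
Proof.
have [r1 rN /andP[N5 N6] K0 KN] := facts.
move=> [h1 _ _ _ h5]; rewrite /linB.
have : r * (N * z) <= r * (s + K * z) by rewrite ler_pM2l; [lra|rewrite rE; lra].
by lra.
Qed.

Lemma linB_gt0 s c z : state n k s c z -> 0 < linB k s z.
Proof.
have [r1 rN /andP[N5 N6] K0 KN] := facts.
move=> st; have := linB_ge st; case: st => _ _ _ _ S0.
have : 0 < (N - r) * (s + K * z) by rewrite mulr_gt0// subr_gt0.
move=> h1 h2; have : 0 < N * linB k s z by exact: lt_le_trans h1 h2.
by rewrite pmulr_rgt0//; lra.
Qed.

Lemma state_c_gt0 s c z : state n k s c z -> 0 < c.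
Proof.
have [r1 rN /andP[N5 N6] K0 KN] := facts.
move=> [h1 _ h3 _ h5].
have M0 : 0 < N - K by lra.
have c0 : 0 <= c.
  by rewrite -(pmulr_rge0 _ M0); apply: le_trans h3; exact: sqr_ge0.
rewrite lt_neqAle c0 andbT; apply/eqP => c0'.
move: h3; rewrite -c0' mulr0 => h3.
have s0 : s = 0 by apply/eqP; rewrite -sqrf_eq0 eq_le h3 sqr_ge0.
move: h1 h5; rewrite s0 add0r pmulr_rle0// => z0.
by rewrite ltNge mulr_ge0_le0.
Qed.

(** Cauchy-Schwarz over all n coordinates of the corner gives N A <= (N - r) S^2, and [linB_ge]
    bounds S by B. Equality holds when the coordinates coincide, which is the configuration reached
    at the last integration. *)
Lemma quadA_le s c z : state n k s c z ->
  (N - r) * quadA k s c z <= N * linB k s z ^+ 2.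
Proof.
have [r1 rN /andP[N5 N6] K0 KN] := facts.
move=> st; have B1 := linB_ge st; have B0 := linB_gt0 st.
case: st => h1 h2 h3 h4 h5.
set S := s + K * z in B1 h5 *.
have M0 : 0 < N - K by lra.
have cs : S ^+ 2 <= N * (c + K * z ^+ 2).
  rewrite -subr_ge0 -(pmulr_rge0 _ M0).
  have -> : (N - K) * (N * (c + K * z ^+ 2) - S ^+ 2) =
    N * ((N - K) * c - s ^+ 2) + K * (s - (N - K) * z) ^+ 2 by rewrite /S; ring.
  by rewrite addr_ge0// mulr_ge0// ?sqr_ge0//; lra.
have NA : N * quadA k s c z <= (N - r) * S ^+ 2.
  have : r * S ^+ 2 <= r * (N * (c + K * z ^+ 2)) by rewrite ler_pM2l//; lra.
  by rewrite /quadA -/S; lra.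
have Br0 : 0 < N - r by lra.
have N0 : 0 < N by lra.
rewrite -(ler_pM2l N0).
apply: (@le_trans _ _ (((N - r) * S) ^+ 2)).
  have : (N - r) * (N * quadA k s c z) <= (N - r) * ((N - r) * S ^+ 2) by rewrite ler_pM2l.
  by lra.
have -> : N * (N * linB k s z ^+ 2) = (N * linB k s z) ^+ 2 by ring.
by rewrite ler_sqr// nnegrE; apply: mulr_ge0; lra.
Qed.

(** By [quadA_le], W^2 = B^2 + (r - 1) A <= B^2 r (N - 1) / (N - r), while 1 - t = B / W. This
    confines t to the interval on which the polynomials are certified. *)
Lemma tpar_bound s c z tau : state n k s c z -> 0 <= quadA k s c z ->
  0 < tau < 1 -> (1 - tau) ^+ 2 * (r * (N - 1)) <= N - r ->
  0 <= tpar (quadA k s c z) (linB k s z) <= tau.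
Proof.
have [r1 rN /andP[N5 N6] K0 KN] := facts.
move=> st A0 /andP[tau0 tau1] ht; have B0 := linB_gt0 st.
have AB := quadA_le st.
set A := quadA _ _ _ _ in A0 AB *; set B := linB _ _ _ in B0 AB *.
have D0 : 0 < disc A B.
  rewrite /disc; have : 0 < B ^+ 2 by rewrite exprn_gt0.
  have : 0 <= (r - 1) * A by rewrite mulr_ge0//; lra.
  by lra.
have W0 : 0 < wroot A B by rewrite sqrtr_gt0.
have WE : wroot A B ^+ 2 = disc A B by rewrite sqr_sqrtr// ltW.
have BW : B <= wroot A B.
  rewrite -ler_sqr ?nnegrE ?(ltW B0) ?(ltW W0)// WE /disc.
  have : 0 <= (r - 1) * A by rewrite mulr_ge0//; lra.
  by lra.
rewrite /tpar divr_ge0 ?subr_ge0 ?(ltW W0)//= ler_pdivrMr//.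
suff : (1 - tau) * wroot A B <= B by lra.
have T0 : 0 <= 1 - tau by lra.
rewrite -ler_sqr ?nnegrE ?(ltW B0) ?mulr_ge0 ?(ltW W0)// exprMn WE.
have Nr : 0 < N - r by lra.
rewrite -(ler_pM2l Nr) /disc.
have t2 : 0 <= (1 - tau) ^+ 2 by exact: sqr_ge0.
have B2 : 0 <= B ^+ 2 by exact: sqr_ge0.
have h1 : (1 - tau) ^+ 2 * ((r - 1) * ((N - r) * A)) <= (1 - tau) ^+ 2 * ((r - 1) * (N * B ^+ 2)).
  by rewrite ler_wpM2l// ler_wpM2l//; lra.
have h2 : ((1 - tau) ^+ 2 * (r * (N - 1))) * B ^+ 2 <= (N - r) * B ^+ 2.
  by rewrite ler_wpM2r.
by lra.
Qed.

(** If y_0 < -1, then A(y_0) = 0 gives r (c + K) < (s - K)^2. Here c + K >= N s^2 / (N - K)^2 by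
    Cauchy-Schwarz, and (N - K) (s - K) <= s (N - 2 K) because s <= N - K. Together they give r N <
    (N - 2 K)^2 <= (N - 2)^2, false for 5 <= N <= 6. *)
Lemma quadA_root_ge s c y0 : (0 < k)%N -> s <= N - K -> s ^+ 2 <= (N - K) * c ->
  quadA k s c y0 = 0 -> 0 <= s + K * y0 -> -1 <= y0.
Proof.
have [r1 rN /andP[N5 N6] K0 KN] := facts.
move=> k0 h2 h3 A00 S0; have K1 : 1 <= K by rewrite (ler_nat _ 1).
rewrite leNgt; apply/negP => y0l.
have y02 : 1 < y0 ^+ 2 by nra.
have M0 : 0 < N - K by lra.
have sK : K < s by nra.
have up : s + K * y0 <= s - K by nra.
move: A00; rewrite /quadA => /eqP; rewrite subr_eq0 => /eqP A00.
have lhs : (s + K * y0) ^+ 2 <= (s - K) ^+ 2 by rewrite ler_sqr ?nnegrE//; lra.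
have rhs : r * (c + K) < r * (c + K * y0 ^+ 2).
  by rewrite ltr_pM2l; [nra|lra].
have cK : s ^+ 2 <= (N - K) * c by [].
have h6 : (N - K) * (s - K) <= s * (N - 2 * K) by nra.
have h7 : ((N - K) * (s - K)) ^+ 2 <= (s * (N - 2 * K)) ^+ 2.
  have h6' : 0 <= (N - K) * (s - K) by apply: mulr_ge0; lra.
  by rewrite ler_sqr ?nnegrE//; exact: le_trans h6' h6.
have h8 : (N - 2 * K) ^+ 2 <= r * N.
  have NK : 0 <= N - 2 * K.
    have : 0 < s * (N - 2 * K) by apply: lt_le_trans h6; rewrite mulr_gt0//; lra.
    by rewrite pmulr_rgt0; lra.
  have : (N - 2 * K) ^+ 2 <= (N - 2) ^+ 2 by rewrite ler_sqr ?nnegrE//; lra.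
  rewrite rE; nra.
have h9 : s ^+ 2 * N <= (N - K) ^+ 2 * (c + K).
  have -> : (N - K) ^+ 2 * (c + K) = (N - K) * ((N - K) * c) + K * (N - K) ^+ 2 by ring.
  have : (N - K) * s ^+ 2 <= (N - K) * ((N - K) * c) by rewrite ler_pM2l.
  have : K * s ^+ 2 <= K * (N - K) ^+ 2.
    by rewrite ler_wpM2l// ler_sqr ?nnegrE//; lra.
  by lra.
have h10 : (N - K) ^+ 2 * (r * (c + K)) < (N - K) ^+ 2 * (s - K) ^+ 2.
  by rewrite ltr_pM2l ?exprn_gt0//; lra.
have h11 : s ^+ 2 * (N - 2 * K) ^+ 2 <= s ^+ 2 * (r * N) by rewrite ler_wpM2l ?sqr_ge0.
have h12 : r * (s ^+ 2 * N) <= r * ((N - K) ^+ 2 * (c + K)) by rewrite ler_pM2l//; lra.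
by move: h7; rewrite !exprMn; lra.
Qed.

Lemma quadA_root s c z : (0 < k)%N -> state n k s c z -> 0 < quadA k s c z ->
  exists y0, [/\ -1 <= y0, y0 < z, quadA k s c y0 = 0, 0 <= s + K * y0 &
    (forall y, y0 < y <= z -> 0 < quadA k s c y) /\
    (forall y, y0 <= y <= z -> 0 < linB k s y)].
Proof.
have [r1 rN /andP[N5 N6] K0 KN] := facts.
move=> k0 st A0; have B0 := linB_gt0 st; have c0 := state_c_gt0 st.
case: (st) => h1 h2 h3 h4 h5.
have K1 : 1 <= K by rewrite (ler_nat _ 1).
set A := quadA k s c z in A0 *; set B := linB k s z in B0 *.
(* K I is a quarter of the discriminant of A as a quadratic in z - y. By [IE] it does not depend on
   z, which settles its sign when K > r; when K <= r the definition itself does. *)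
pose I := (r - K) * A + K * B ^+ 2.
have IE : I = r * (s ^+ 2 + (K - r) * c) by rewrite /I /A /B /quadA /linB; ring.
have I0 : 0 < I.
  have [Kr|rK] := leP K r.
    have : 0 <= (r - K) * A by rewrite mulr_ge0//; lra.
    have : 0 < K * B ^+ 2 by rewrite mulr_gt0 ?exprn_gt0//; lra.
    by rewrite /I; lra.
  rewrite IE; apply: mulr_gt0; first by lra.
  have : 0 < (K - r) * c by rewrite mulr_gt0//; lra.
  have : 0 <= s ^+ 2 by exact: sqr_ge0.
  by lra.
have KI0 : 0 < K * I by rewrite mulr_gt0//; lra.
pose D := Num.sqrt (K * I).
have D0 : 0 < D by rewrite sqrtr_gt0.
have DE : D ^+ 2 = K * I by rewrite sqr_sqrtr// ltW.
have E0 : 0 < K * B + D.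
  have : 0 < K * B by rewrite mulr_gt0//; lra.
  by lra.
(* The first positive root, rationalized so that one formula serves both signs of K - r. *)
pose t0 := A / (K * B + D).
have t00 : 0 < t0 by rewrite divr_gt0.
have t0E : t0 * (K * B + D) = A by rewrite /t0; field; rewrite lt0r_neq0.
have AE t : A * (A - 2 * K * B * t + K * (K - r) * t ^+ 2) =
    (A - t * (K * B + D)) * (A - t * (K * B - D)).
  have -> : (A - t * (K * B + D)) * (A - t * (K * B - D)) =
    A ^+ 2 - 2 * A * K * B * t + t ^+ 2 * (K ^+ 2 * B ^+ 2 - D ^+ 2) by ring.
  by rewrite DE /I; ring.
have Apos y : z - t0 < y <= z -> 0 < quadA k s c y.
  move=> /andP[y1 y2]; rewrite (quadA_shift s c z) -/A -/B.
  rewrite -(pmulr_rgt0 _ A0) AE.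
  have tt : (z - y) * (K * B + D) < A by rewrite -t0E ltr_pM2r//; lra.
  apply: mulr_gt0; first by lra.
  have : 0 <= (z - y) * D by rewrite mulr_ge0//; lra.
  by lra.
have A00 : quadA k s c (z - t0) = 0.
  have zz : z - (z - t0) = t0 by ring.
  rewrite (quadA_shift s c z) -/A -/B zz; apply/eqP; have := AE t0.
  by rewrite t0E subrr mul0r => /eqP; rewrite mulf_eq0 (negPf (lt0r_neq0 A0)).
have Bpos y : z - t0 <= y <= z -> 0 < linB k s y.
  move=> /andP[y1 y2].
  have -> : linB k s y = B - (K - r) * (z - y) by rewrite /B /linB; ring.
  have [Kr|rK] := leP K r.
    have : 0 <= (r - K) * (z - y) by rewrite mulr_ge0//; lra.
    by lra.
  have : (K - r) * (z - y) <= (K - r) * t0 by rewrite ler_wpM2l//; lra.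
  suff : 0 < B - (K - r) * t0 by lra.
  rewrite -(pmulr_lgt0 _ E0).
  have -> : (B - (K - r) * t0) * (K * B + D) = B * (K * B + D) - (K - r) * (t0 * (K * B + D)) by ring.
  rewrite t0E.
  have -> : B * (K * B + D) - (K - r) * A = I + B * D by rewrite /I; ring.
  by rewrite addr_gt0// mulr_gt0.
(* Otherwise s + K y would vanish at some y between the root and z, where A is positive by [Apos]
   and yet equal to -r (c + K y^2). *)
have S0 : 0 <= s + K * (z - t0).
  rewrite leNgt; apply/negP => S0.
  pose y1 := - s / K.
  have y1E : K * y1 = - s by rewrite /y1; field; rewrite lt0r_neq0//; lra.
  have K0' : 0 < K by lra.
  have y1l : z - t0 < y1 by rewrite -(ltr_pM2l K0') y1E; lra.
  have y1r : y1 <= z by rewrite -(ler_pM2l K0') y1E; lra.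
  have := Apos y1; rewrite y1l y1r => /(_ isT); rewrite /quadA y1E subrr expr0n/= sub0r.
  apply/negP; rewrite -leNgt oppr_le0 mulr_ge0 ?(ltW c0)//; first by lra.
  by rewrite addr_ge0 ?(ltW c0)// mulr_ge0 ?sqr_ge0.
exists (z - t0); split => //; last by rewrite ltrBlDr ltrDl.
exact: (quadA_root_ge k0 h2 h3 A00 S0).
Qed.

End state.

(** Freezing a coordinate at the corner value does not move the corner, so A and B pass unchanged
    from dimension k + 1 to dimension k. This is what closes the recursion. *)
Lemma quadAS {R : realType} k (s c y : R) : quadA k.+1 s c y = quadA k (s + y) (c + y ^+ 2) y.
Proof. by rewrite /quadA -natr1; ring. Qed.

Lemma linBS {R : realType} k (s y : R) : linB k.+1 s y = linB k (s + y) y.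
Proof. by rewrite /linB -natr1; ring. Qed.

Lemma stateS {R : realType} n k (s c z y : R) : (k.+1 < n)%N -> state n k.+1 s c z ->
  y <= z -> 0 < s + k.+1%:R * y -> state n k (s + y) (c + y ^+ 2) y.
Proof.
move=> kn [h1 h2 h3 h4 h5] yz S0.
have M0 : 0 < n%:R - k.+1%:R :> R by rewrite subr_gt0 ltr_nat.
have my : (n%:R - k.+1%:R) * y <= (n%:R - k.+1%:R) * z by rewrite ler_pM2l.
move: M0 my h1 h2 h3 S0; rewrite -natr1 => M0 my h1 h2 h3 S0.
split; [lra|lra| |lra|lra].
rewrite -subr_ge0 -(pmulr_rge0 _ M0).
set m := n%:R - (k%:R + 1) in M0 my h1 h2 h3 *.
have -> : m * ((n%:R - k%:R) * (c + y ^+ 2) - (s + y) ^+ 2) =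
   (m + 1) * (m * c - s ^+ 2) + (s - m * y) ^+ 2 by rewrite /m; ring.
by rewrite addr_ge0 ?sqr_ge0// mulr_ge0//; lra.
Qed.

Lemma state_le {R : realType} n k (s c z y : R) : (k < n)%N -> state n k s c z ->
  y <= z -> 0 < s + k%:R * y -> state n k s c y.
Proof.
move=> kn [h1 h2 h3 h4 h5] yz S0.
have M0 : 0 < n%:R - k%:R :> R by rewrite subr_gt0 ltr_nat.
split => //; last by lra.
by apply: le_trans h1; rewrite ler_pM2l.
Qed.

(** * Recursion on the number of coordinates *)

Section region_measurable.
Context {d : measure_display} {T : measurableType d} {R : realType}.

Lemma measurable_set_lt (f g : T -> R) :
  measurable_fun setT f -> measurable_fun setT g ->
  measurable [set w | f w < g w].
Proof.
move=> mf mg; rewrite (_ : [set _ | _] = (fun w => g w - f w) @^-1` `]0, +oo[).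
  by rewrite -[X in measurable X]setTI; apply: (measurable_funB mg mf).
by apply/seteqP; split => w /=; rewrite in_itv/= andbT subr_gt0.
Qed.

Lemma measurable_set_le (f g : T -> R) :
  measurable_fun setT f -> measurable_fun setT g ->
  measurable [set w | f w <= g w].
Proof.
move=> mf mg; rewrite (_ : [set _ | _] = ~` [set w | g w < f w]).
  by apply: measurableC; exact: measurable_set_lt.
by apply/seteqP; split => w /=; rewrite leNgt; move/negP.
Qed.

Lemma measurable_sum_set m (J : {set 'I_m}) (f : 'I_m -> T -> R) :
  (forall j, j \in J -> measurable_fun setT (f j)) ->
  measurable_fun setT (fun w => \sum_(j in J) f j w).
Proof.
move=> mf; under eq_fun do rewrite big_mkcond.
apply: (@measurable_sum _ _ _ _ _ _ (fun j w => if j \in J then f j w else 0)) => j.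
by case: (boolP (j \in J)) => // jJ; exact: mf.
Qed.

(** The flag selects weak or strict bounds. With strict bounds the events that a given coordinate is
    the largest are disjoint (lower bounds); with weak ones they cover (upper bounds). Ties thus
    call for no separate argument. *)
Definition region (m : nat) (b : bool) (J : {set 'I_m}) (Y : 'I_m -> R) (z s c : R) : Prop :=
  [/\ (forall j, j \in J -> Y j < z ?<= if b),
      0 < s + \sum_(j in J) Y j &
      r0 * (c + \sum_(j in J) Y j ^+ 2) < (s + \sum_(j in J) Y j) ^+ 2].

Lemma measurable_region m b (J : {set 'I_m}) (Y : 'I_m -> T -> R) (z s c : T -> R) :
  (forall j, j \in J -> measurable_fun setT (Y j)) ->
  measurable_fun setT z -> measurable_fun setT s -> measurable_fun setT c ->
  measurable [set w | region b J (Y ^~ w) (z w) (s w) (c w)].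
Proof.
move=> mY mz ms mc.
have mS : measurable_fun setT (fun w => s w + \sum_(j in J) Y j w).
  by apply: measurable_funD => //; exact: measurable_sum_set.
have mQ : measurable_fun setT (fun w => c w + \sum_(j in J) Y j w ^+ 2).
  apply: measurable_funD => //; apply: measurable_sum_set => j jJ.
  by apply: measurable_funX; exact: mY.
rewrite (_ : [set _ | _] = (\bigcap_(j in [set j | j \in J]) [set w | Y j w < z w ?<= if b])
   `&` [set w | 0 < s w + \sum_(j in J) Y j w]
   `&` [set w | r0 * (c w + \sum_(j in J) Y j w ^+ 2) < (s w + \sum_(j in J) Y j w) ^+ 2]).
  apply: measurableI; [apply: measurableI|].
  - apply: fin_bigcap_measurable => // j /= jJ.
    case: b => /=; [apply: measurable_set_le|apply: measurable_set_lt] => //; exact: mY.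
  - exact: measurable_set_lt.
  - apply: measurable_set_lt; last exact: measurable_funX.
    by apply: measurable_funM.
by apply/seteqP; split => w /=; [case=> ? ? ?; split|case=> -[? ?] ?].
Qed.

End region_measurable.

Section region_empty.
Context {R : realType}.

Lemma sum_sqr_le (m : nat) (J : {set 'I_m}) (v : 'I_m -> R) :
  (\sum_(j in J) v j) ^+ 2 <= #|J|%:R * \sum_(j in J) v j ^+ 2.
Proof.
set s := \sum_(j in J) v j; set q := \sum_(j in J) v j ^+ 2.
have [J0|J0] := posnP #|J|.
  have s0 : s = 0 by rewrite /s big1// => j; rewrite (cards0_eq J0) inE.
  by rewrite s0 J0 expr0n/= mul0r.
have K0 : 0 < #|J|%:R :> R by rewrite ltr0n.
rewrite -subr_ge0 -(pmulr_rge0 _ K0).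
have <- : \sum_(j in J) (#|J|%:R * v j - s) ^+ 2 = #|J|%:R * (#|J|%:R * q - s ^+ 2).
  under eq_bigr => j _.
    rewrite (_ : _ ^+ 2 = #|J|%:R ^+ 2 * v j ^+ 2 + (- 2 * #|J|%:R * s) * v j + s ^+ 2); last by ring.
    over.
  by rewrite !big_split/= sumr_const -!mulr_sumr -/s -/q -mulr_natr; ring.
by apply: sumr_ge0 => j _; exact: sqr_ge0.
Qed.

(** Put v = y - u >= 0. For K > 0 and A <= 0, positivity of the form and Cauchy-Schwarz give (K - r)
    sum v > 2 K B, so K > r. Then sum v < B + r y yields (K + r) B < (K - r) r y, against B >= (N -
    r) y, because (K + r) (N - r) - (K - r) r = K (N - r) + r (N - K) >= 0. *)
Lemma region_empty n m (J : {set 'I_m}) (u : 'I_m -> R) s c y :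
  (5 <= n <= 6)%N -> (#|J| < n)%N -> state n #|J| s c y ->
  quadA #|J| s c y <= 0 -> ~ region true J u y s c.
Proof.
move=> n56 Jn st A0 [uy]; have B0 := linB_gt0 n56 Jn st; have NB := linB_ge n56 Jn st.
have [h1 _ _ _ _] := st.
have r3 : 3 < r0 :> R by rewrite /r0; lra.
have rN : r0 < n%:R :> R.
  have : 5 <= n%:R :> R by rewrite (ler_nat _ 5); case/andP: n56.
  by rewrite /r0; lra.
set K := #|J|%:R : R in h1 NB *.
have KN : K <= n%:R by rewrite ler_nat ltnW.
pose v j := y - u j.
pose sv := \sum_(j in J) v j; pose qv := \sum_(j in J) v j ^+ 2.
have sv0 : 0 <= sv by apply: sumr_ge0 => j jJ; rewrite subr_ge0; exact: uy.
have Su : \sum_(j in J) u j = K * y - sv.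
  rewrite /sv sumrB sumr_const -mulr_natl; ring.
have Qu : \sum_(j in J) u j ^+ 2 = qv + K * y ^+ 2 - 2 * y * sv.
  rewrite /qv /sv mulr_sumr -mulr_natl.
  rewrite (_ : K * y ^+ 2 = \sum_(j in J) y ^+ 2); last by rewrite sumr_const mulr_natl.
  by rewrite -big_split/= -sumrB; apply: eq_bigr => j _; rewrite /v; ring.
rewrite Su Qu => p1 p2.
have cs : sv ^+ 2 <= K * qv by exact: sum_sqr_le.
set A := quadA _ _ _ _ in A0; set B := linB _ _ _ in B0 NB.
have {p2}p2 : 0 < A - 2 * B * sv + sv ^+ 2 - r0 * qv.
  move: p2; rewrite -subr_gt0; congr (0 < _); rewrite /A /B /quadA /linB -/K; ring.
have {p1}p1 : sv < B + r0 * y by move: p1; rewrite /B /linB -/K; lra.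
have K0 : 0 <= K by [].
have [K00|K00] := eqVneq K 0.
  have qv0 : 0 <= qv by apply: sumr_ge0 => j _; exact: sqr_ge0.
  move: cs; rewrite K00 mul0r => sv2.
  have sv00 : sv = 0 by apply/eqP; rewrite -sqrf_eq0 eq_le sv2 sqr_ge0.
  move: p2; rewrite sv00 expr0n/= mulr0; have : 0 <= r0 * qv by rewrite mulr_ge0//; lra.
  by lra.
have {K0 K00}K0 : 0 < K by rewrite lt_neqAle eq_sym K00.
have p3 : 0 < sv * ((K - r0) * sv - 2 * K * B).
  have : 0 < K * (A - 2 * B * sv + sv ^+ 2 - r0 * qv) by rewrite mulr_gt0.
  have : r0 * sv ^+ 2 <= r0 * (K * qv) by rewrite ler_pM2l//; lra.
  have : K * A <= 0 by rewrite pmulr_rle0.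
  by lra.
have svp : 0 < sv.
  by rewrite lt_neqAle sv0 andbT; apply/eqP => sE; move: p3; rewrite -sE mul0r ltxx.
move: p3; rewrite pmulr_rgt0// => p3.
have KB : 0 < K * B by rewrite mulr_gt0.
have Kr : 0 < K - r0.
  rewrite ltNge; apply/negP => Kr; have : (K - r0) * sv <= 0 by rewrite mulr_le0_ge0.
  by lra.
have p4 : (K + r0) * B < (K - r0) * r0 * y.
  have : (K - r0) * sv < (K - r0) * (B + r0 * y) by rewrite ltr_pM2l.
  by lra.
have Kr0 : 0 < K + r0 by lra.
have y0 : 0 < y.
  rewrite ltNge; apply/negP => y0.
  have : 0 < (K + r0) * B by rewrite mulr_gt0.
  have : (K - r0) * r0 * y <= 0 by rewrite mulr_ge0_le0// mulr_ge0 ?(ltW Kr)//; lra.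
  by lra.
have N0 : 0 < n%:R :> R by lra.
have By : (n%:R - r0) * y <= B.
  rewrite -(ler_pM2l N0); apply: le_trans NB.
  have -> : n%:R * ((n%:R - r0) * y) = (n%:R - r0) * (n%:R * y) by ring.
  by rewrite ler_pM2l ?subr_gt0//; lra.
have : (K + r0) * ((n%:R - r0) * y) < (K - r0) * r0 * y.
  by apply: le_lt_trans p4; rewrite ler_pM2l.
rewrite mulrA ltr_pM2r//.
have : 0 <= K * (n%:R - r0) by rewrite mulr_ge0//; lra.
have : 0 <= r0 * (n%:R - K) by rewrite mulr_ge0//; lra.
by lra.
Qed.

End region_empty.

(** The law of a random variable and [uniform_prob] are measures for two structures on the same
    space of reals; pushing forward along the identity lets one replace the other under the
    integral. *)
Lemma integral_law {R : realType} (mu1 : {measure set R -> \bar R})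
    (mu2 : {measure set (measurableTypeR R) -> \bar R}) (f : R -> \bar R) :
  (forall A : set R, measurable A -> mu1 A = mu2 A) ->
  measurable_fun [set: R] f -> (forall x, (0 <= f x)%E) ->
  (\int[mu1]_x f x = \int[mu2]_x f x)%E.
Proof.
move=> mu12 mf f0.
have mid : measurable_fun [set: measurableTypeR R] (idfun : measurableTypeR R -> R).
  by move=> _ A mA; rewrite setTI.
rewrite -(@ge0_integral_pushforward _ _ (measurableTypeR R) R _ idfun mid mu2 setT f)//.
by apply: eq_measure_integral => A mA _; exact: mu12.
Qed.

Section slice.
Context {d : measure_display} {T : measurableType d} {R : realType}
  {P : probability T R} {m : nat}.
Variable X : 'I_m -> {RV P >-> R}.
Hypothesis iX : mutually_independent X.
Hypothesis uX : forall i (A : set R), measurable A ->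
  distribution P (X i) A = uniform_law A.

Definition prob_region b (J : {set 'I_m}) (z s c : R) : \bar R :=
  P [set w | region b J (X ^~ w) z s c].

Lemma measurable_prob_region b (J : {set 'I_m}) (z s c : R) :
  measurable [set w | region b J (X ^~ w) z s c].
Proof. by apply: measurable_region. Qed.

Lemma region_frozen b (J : {set 'I_m}) (z s c : R -> R) :
  measurable_fun setT z -> measurable_fun setT s -> measurable_fun setT c ->
  measurable [set p : R * frozen X J | region b J (X ^~ p.2) (z p.1) (s p.1) (c p.1)].
Proof.
move=> mz ms mc.
apply: (@measurable_region _ (R * frozen X J)%type _ _ _ _ (fun j p => X j p.2)
   (z \o fst) (s \o fst) (c \o fst)).
- by move=> j jJ; apply: measurableT_comp => //; exact: frozen_measurable_fun.
- by apply: measurableT_comp => //; exact: measurable_fst.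
- by apply: measurableT_comp => //; exact: measurable_fst.
- by apply: measurableT_comp => //; exact: measurable_fst.
Qed.

Definition slice b (J : {set 'I_m}) (s c x : R) : \bar R :=
  prob_region b J x (s + x) (c + x ^+ 2).

Lemma measurable_slice_region b (J : {set 'I_m}) s c :
  measurable_fun setT (slice b J s c).
Proof.
apply: (@measurable_slice _ _ _ _ _ X J
  [set p | region b J (X ^~ p.2) p.1 (s + p.1) (c + p.1 ^+ 2)]).
apply: (@region_frozen b J id (fun x => s + x) (fun x => c + x ^+ 2)) => //.
- exact: measurable_funD.
- by apply: measurable_funD => //; exact: measurable_funX.
Qed.

Lemma prob_slice b (J : {set 'I_m}) i (s c a z : R) : i \notin J ->
  -1 <= a -> a < z -> z <= 1 ->
  P [set w | (a < X i w /\ X i w < z ?<= if b) /\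
             region b J (X ^~ w) (X i w) (s + X i w) (c + X i w ^+ 2)] =
  (2^-1%:E * \int[lebesgue_measure]_(x in `]a, z[) slice b J s c x)%E.
Proof.
move=> iJ a1 az z1.
pose I : set R := [set` Interval (BRight a) (BSide (~~ b) z)].
have mI : measurable I by exact: measurable_itv.
have IE x : I x <-> (a < x /\ x < z ?<= if b).
  rewrite /I/= in_itv/=; split => [/andP[ax]|[ax xz]].
    by case: b {I mI} => /=.
  by rewrite ax; case: b {I mI} xz => /=.
pose C := [set p : R * frozen X J | I p.1] `&`
  [set p | region b J (X ^~ p.2) p.1 (s + p.1) (c + p.1 ^+ 2)].
have mC : measurable C.
  apply: measurableI.
    by rewrite -[X in measurable X]setTI; apply: measurable_fst.
  apply: (@region_frozen b J id (fun x => s + x) (fun x => c + x ^+ 2)) => //.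
  - exact: measurable_funD.
  - by apply: measurable_funD => //; exact: measurable_funX.
transitivity (P [set w | C (X i w, w)]).
  by congr (P _); apply/seteqP; split => w /= -[/IE ? ?].
rewrite freeze//.
transitivity (\int[distribution P (X i)]_x (slice b J s c \_ I) x)%E.
  apply: eq_integral => x _; rewrite /patch; case: ifPn => [/set_mem xI|xI].
    by congr (P _); apply/seteqP; split => w /= => [[]|].
  transitivity (P set0); last by rewrite measure0.
  congr (P _); apply/seteqP; split => w //= -[xI'].
  by move: xI; rewrite mem_set.
have mS : measurable_fun setT (slice b J s c \_ I).
  apply/(measurable_restrictT _ mI). apply: measurable_funTS. exact: measurable_slice_region.
have S0 x : (0 <= (slice b J s c \_ I) x)%E by rewrite /patch; case: ifP.
rewrite (integral_law (mu2 := uniform_prob (gtrN (@ltr01 R))))//; last first.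
  by move=> A mA; exact: uX.
rewrite integral_uniform//.
rewrite (_ : (1 - -1)^-1 = 2^-1); last by rewrite opprK.
congr (_ * _)%E; rewrite -integral_mkcondr.
rewrite (_ : `[-1, 1] `&` I = I); last first.
  apply/seteqP; split => [x []//|x xI]; split => //; have [ax xz] := (IE x).1 xI.
  rewrite /= in_itv/= (le_trans a1 (ltW ax))//=.
  exact: le_trans (lteifW xz) z1.
rewrite /I integral_itv_bndoo//.
apply: measurable_funTS; exact: measurable_slice_region.
Qed.

End slice.

(** * Sub- and supersolutions bound the probabilities *)

Section layers.
Context {R : realType}.

Lemma measure_bigsetU_le {d} {T : measurableType d} (mu : {measure set T -> \bar R})
    (I : Type) (s : seq I) (Q : pred I) (F : I -> set T) :
  (forall i, measurable (F i)) ->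
  (mu (\big[setU/set0]_(i <- s | Q i) F i) <= \sum_(i <- s | Q i) mu (F i))%E.
Proof.
move=> mF; elim: s => [|i s IH]; first by rewrite !big_nil measure0.
rewrite !big_cons; case: ifP => // _.
have mU : measurable (\big[setU/set0]_(i <- s | Q i) F i).
  by apply: bigsetU_measurable => j _; exact: mF.
by apply: le_trans (measureU2 _ (mF i) mU) _; exact: leeD2l.
Qed.

Lemma tmax_ok n k : (5 <= n <= 6)%N -> (0 < k < n)%N ->
  (1 - tmax k) ^+ 2 * (r0 * (n%:R - 1)) <= n%:R - r0 :> R.
Proof.
have zn m : zr (Z.of_nat m) = m%:R :> R by exact: zr_nat.
have E10 : zr 10000 = 10000%:R :> R by rewrite -(zn 10000%N); congr zr.
have E5 : zr 5605 = 5605%:R :> R by rewrite -(zn 5605%N); congr zr.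
have E6 : zr 6010 = 6010%:R :> R by rewrite -(zn 6010%N); congr zr.
move=> n56 kn; rewrite /tmax /tnum E10 /r0.
have [->|n6] := eqVneq n 6%N.
  by case: ifP => _; rewrite ?E5 ?E6; nra.
have -> : n = 5%N by move: n56 n6; lia.
case: ifP => [/eqP k5|_]; first by move: kn n56 n6; lia.
by rewrite E6; nra.
Qed.

Lemma tmax_bounds k : 0 < (tmax k : R) < 1.
Proof.
have zn m : zr (Z.of_nat m) = m%:R :> R by exact: zr_nat.
have E10 : zr 10000 = 10000%:R :> R by rewrite -(zn 10000%N); congr zr.
have E5 : zr 5605 = 5605%:R :> R by rewrite -(zn 5605%N); congr zr.
have E6 : zr 6010 = 6010%:R :> R by rewrite -(zn 6010%N); congr zr.
by rewrite /tmax /tnum E10; case: ifP => _; rewrite ?E5 ?E6; lra.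
Qed.

(** Collects what both inductions use on ]y0, z]. At y0 the quantity A vanishes but B does not, so
    [disc] stays positive on the closed interval and the fundamental theorem of calculus applies up
    to y0. *)
Lemma layer n k (s c z : R) : (5 <= n <= 6)%N -> (k.+1 < n)%N ->
  state n k.+1 s c z -> 0 < quadA k.+1 s c z ->
  exists y0, [/\ -1 <= y0, y0 < z,
    (forall y, y0 <= y <= z -> 0 < disc (quadA k.+1 s c y) (linB k.+1 s y)),
    (forall y, y0 < y <= z -> [/\ state n k (s + y) (c + y ^+ 2) y,
      0 < quadA k.+1 s c y &
      0 <= tpar (quadA k.+1 s c y) (linB k.+1 s y) <= tmax k.+1]) &
    [/\ quadA k.+1 s c y0 = 0, 0 < linB k.+1 s y0 & state n k.+1 s c y0]].
Proof.
move=> n56 kn st A0.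
have [y0 [y1 yz Ay0 S0 [Apos Bpos]]] := quadA_root n56 kn isT st A0.
have c0 := state_c_gt0 n56 kn st.
have r1 : 1 < r0 :> R by rewrite /r0; lra.
have K0 : 0 < k.+1%:R :> R by rewrite ltr0n.
(* If this sum were 0, A(y0) would be -r (c + (k + 1) y0^2), which is negative as c > 0. *)
have S0' : 0 < s + k.+1%:R * y0.
  rewrite lt_neqAle S0 andbT; apply/eqP => SE.
  move: Ay0; rewrite /quadA -SE expr0n/= sub0r => /eqP; rewrite oppr_eq0.
  apply/negP; rewrite lt0r_neq0// mulr_gt0//; first by lra.
  by rewrite ltr_wpDr// mulr_ge0// sqr_ge0.
have Spos y : y0 <= y -> 0 < s + k.+1%:R * y.
  move=> yy; apply: lt_le_trans S0' _; rewrite lerD2l.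
  by rewrite ler_pM2l.
have disc_pos y : y0 <= y <= z -> 0 <= quadA k.+1 s c y ->
    0 < disc (quadA k.+1 s c y) (linB k.+1 s y).
  move=> yyz A0'; rewrite /disc ltr_pwDl ?exprn_gt0 ?Bpos// mulr_ge0//; lra.
exists y0; split => //.
- move=> y /andP[]; rewrite le_eqVlt => /predU1P[<- yz'|yy yz'].
    by apply: disc_pos; rewrite ?Ay0// lexx.
  by apply: disc_pos; rewrite ?(ltW yy)// ltW// Apos// yy.
- move=> y /andP[yy yz'].
  have sty : state n k.+1 s c y by apply: state_le yz' _ => //; exact/Spos/ltW.
  have Ay : 0 < quadA k.+1 s c y by rewrite Apos// yy.
  split => //; first by apply: (stateS kn st yz'); exact/Spos/ltW.
  apply: (tpar_bound n56 kn sty (ltW Ay) (tmax_bounds _)).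
  by apply: tmax_ok.
- by split => //; [rewrite Bpos// lexx ltW|apply: state_le (ltW yz) _].
Qed.

Lemma volfun0 (q : R -> R) k (B : R) : 0 < B -> volfun q k.+1 0 B = 0.
Proof.
move=> B0; rewrite /volfun /wroot /disc mulr0 addr0 sqrtr_sqr gtr0_norm// subrr.
by rewrite expr0n/= mul0r.
Qed.

Lemma zeval_continuous p : continuous (zeval p : R -> R).
Proof.
move=> t; apply: differentiable_continuous; apply/derivable1_diffP.
by have [] := is_derive_zeval p t.
Qed.

Lemma continuous_qlow' k : continuous (qlow' k : R -> R).
Proof. by move=> t; apply: continuousM; [exact: zeval_continuous|exact: cst_continuous]. Qed.

Lemma continuous_qup' k : continuous (qup' k : R -> R).
Proof. by move=> t; apply: continuousM; [exact: zeval_continuous|exact: cst_continuous]. Qed.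

Lemma wroot_ge (A B : R) : 0 <= A -> 0 <= B -> 0 <= wroot A B - B.
Proof.
move=> A0 B0; rewrite subr_ge0 /wroot -{1}(ger0_norm B0) -sqrtr_sqr ler_wsqrtr//.
by rewrite /disc lerDl mulr_ge0// /r0; lra.
Qed.

Lemma integral_layer (q q' : R -> R) k (s c y0 z : R) :
  (forall t : R, is_derive t (1:R) q (q' t)) -> continuous q' -> y0 < z ->
  (forall y, y0 <= y <= z -> 0 < disc (quadA k.+1 s c y) (linB k.+1 s y)) ->
  quadA k.+1 s c y0 = 0 -> 0 < linB k.+1 s y0 ->
  measurable_fun `]y0, z[ (fun y => (dvolfun q q' k.+1 s c y)%:E) /\
  (\int[lebesgue_measure]_(y in `]y0, z[) (dvolfun q q' k.+1 s c y)%:E =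
   (volfun q k.+1 (quadA k.+1 s c z) (linB k.+1 s z))%:E)%E.
Proof.
move=> dq cq' yz D0 A0 B0.
have mL : measurable_fun `]y0, z[ (fun y => (dvolfun q q' k.+1 s c y)%:E).
  apply/measurable_EFinP; apply: (@measurable_funS _ _ _ _ `[y0, z]) => //.
    by apply: subset_itv; rewrite ?bnd_simp.
  exact: (measurable_dvolfun dq cq' D0).
split => //; rewrite -(integral_itv_bndoo true false)//.
by rewrite (integral_dvolfun dq cq' _ yz D0)// A0 volfun0// subr0.
Qed.

End layers.

Section claims.
Context {d : measure_display} {T : measurableType d} {R : realType}
  {P : probability T R} {m : nat}.
Variable X : 'I_m -> {RV P >-> R}.
Hypothesis iX : mutually_independent X.
Hypothesis uX : forall i (A : set R), measurable A ->
  distribution P (X i) A = uniform_law A.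

Definition topped b (J : {set 'I_m}) (s c a z : R) (i : 'I_m) : set T :=
  [set w | (a < X i w /\ X i w < z ?<= if b) /\
    region b (J :\ i) (X ^~ w) (X i w) (s + X i w) (c + X i w ^+ 2)].

Lemma measurable_topped b J s c a z i : measurable (topped b J s c a z i).
Proof.
apply: measurableI.
  apply: measurableI; first exact: measurable_set_lt.
  by case: b => /=; [exact: measurable_set_le|exact: measurable_set_lt].
apply: measurable_region => //.
- exact: measurable_funD.
- by apply: measurable_funD => //; exact: measurable_funX.
Qed.

Lemma topped_region (J : {set 'I_m}) s c a z i : i \in J ->
  topped false J s c a z i `<=` [set w | region false J (X ^~ w) z s c].
Proof.
move=> iJ w /= [[aX Xz] [h1 h2 h3]]; split.
- move=> j jJ; have [->//|ji] := eqVneq j i.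
  by apply: lt_trans Xz; apply: (h1 j); rewrite !inE ji.
- by rewrite (big_setD1 i iJ)/= addrA.
- by rewrite !(big_setD1 i iJ)/= !addrA.
Qed.

(** The maximal coordinate exceeds a: otherwise all coordinates lie below the root of A, where
    [region_empty] applies. *)
Lemma region_topped n (J : {set 'I_m}) s c a z : (5 <= n <= 6)%N -> (#|J| < n)%N ->
  (0 < #|J|)%N -> state n #|J| s c a -> quadA #|J| s c a = 0 ->
  [set w | region true J (X ^~ w) z s c] `<=`
    \big[setU/set0]_(i < m | i \in J) topped true J s c a z i.
Proof.
move=> n56 Jn /card_gt0P[i0 i0J] st A0 w /= rw.
case: (arg_maxP (fun i => X i w) i0J) => i iJ imax.
rewrite -(bigcup_pred (mem J)); exists i => //.
have Xa : a < X i w.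
  rewrite ltNge; apply/negP => Xa; apply: (@region_empty _ _ _ _ (X ^~ w) _ _ _ n56 Jn st).
    by rewrite A0.
  case: rw => _ h2 h3; split => // j jJ /=; exact: le_trans (imax j jJ) Xa.
case: rw => h1 h2 h3; split; first by split => //; exact: h1.
split; first by move=> j /setD1P[_ jJ]; exact: imax.
- by rewrite (big_setD1 i iJ)/= addrA in h2.
- by move: h3; rewrite !(big_setD1 i iJ)/= !addrA.
Qed.

Lemma trivIset_topped (J : {set 'I_m}) s c a z :
  trivIset [set i | i \in J] (topped false J s c a z).
Proof.
move=> i j /= iJ jJ [w [[_ [h _ _]] [_ [h' _ _]]]].
apply: contrapT => /eqP ij.
have := h j; rewrite !inE eq_sym ij jJ => /(_ isT) /= h1.
have := h' i; rewrite !inE ij iJ => /(_ isT) /= h2.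
by have := lt_trans h1 h2; rewrite ltxx.
Qed.

(** The event contains the disjoint events in which coordinate i is the largest. Each contributes
    half the integral over its value y of a probability bounded by induction, hence by the
    derivative of [volfun] over k + 1. The derivative integrates exactly from y0, where [volfun] is
    0, and the k + 1 choices of i cancel the denominator. *)
Theorem prob_region_ge n k (J : {set 'I_m}) (s c z : R) :
  (5 <= n <= 6)%N -> #|J| = k -> (k < n)%N -> state n k s c z ->
  0 < quadA k s c z ->
  ((2^-1 ^+ k * volfun (qlow k) k (quadA k s c z) (linB k s z))%:E
     <= prob_region X false J z s c)%E.
Proof.
move=> n56; elim: k J s c z => [|k IH] J s c z Jk kn st A0.
  rewrite expr0 mul1r /volfun expr0 mul1r qlow0.
  rewrite (_ : prob_region _ _ _ _ _ _ = 1%E)//.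
  rewrite -(@probability_setT _ _ _ P) /prob_region; congr (P _).
  apply/seteqP; split => // w _ /=; rewrite /region (cards0_eq Jk) !big_set0.
  rewrite !addr0; split => [j||]; first by rewrite inE.
    by case: st; rewrite mul0r addr0.
  by move: A0; rewrite /quadA !mul0r !addr0 subr_gt0.
have [y0 [y1 yz D0 Hy [Ay0 By0 sty0]]] := layer n56 kn st A0.
have z1 : z <= 1 by case: st.
pose dv y := dvolfun (qlow k.+1) (qlow' k.+1) k.+1 s c y.
have [mdv Idv] := integral_layer (@is_derive_qlow R k.+1) (@continuous_qlow' R k.+1) yz D0 Ay0 By0.
have oo y : [set` `]y0, z[] y -> y0 < y <= z.
  by rewrite /= in_itv/= => /andP[-> /ltW].
have k5 : (0 < k.+1 <= 5)%N by move: kn n56; lia.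
have dvb y : y0 < y <= z -> 0 <= dv y <=
    k.+1%:R * volfun (qlow k) k (quadA k (s + y) (c + y ^+ 2) y) (linB k (s + y) y).
  move=> yyz; have [sty Ay ty] := Hy y yyz.
  have := qlow_op k5 ty; rewrite -quadAS -linBS /dv /dvolfun /volfun /= => /andP[g1 g2].
  set W := wroot _ _ - _.
  have W0 : 0 <= W.
    apply: wroot_ge; first exact: ltW.
    by rewrite linBS ltW// (linB_gt0 n56 _ sty)// ltnW.
  rewrite mulr_ge0 ?exprn_ge0//= mulrCA ler_wpM2l ?exprn_ge0//.
have step i : i \in J ->
    ((k.+1%:R^-1 * (2^-1 ^+ k.+1 * volfun (qlow k.+1) k.+1 (quadA k.+1 s c z) (linB k.+1 s z)))%:E
      <= P (topped false J s c y0 z i))%E.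
  move=> iJ; rewrite /topped (prob_slice iX uX)//; last by rewrite !inE eqxx.
  have K0 : 0 <= k.+1%:R^-1 * 2^-1 ^+ k :> R by rewrite mulr_ge0// exprn_ge0.
  rewrite (_ : (_ * _)%:E = 2^-1%:E * ((k.+1%:R^-1 * 2^-1 ^+ k)%:E *
      (volfun (qlow k.+1) k.+1 (quadA k.+1 s c z) (linB k.+1 s z))%:E))%E; last first.
    by rewrite -!EFinM; congr EFin; rewrite exprS; ring.
  rewrite lee_pmul2l// -Idv -ge0_integralZl//; last first.
    by move=> y /oo yyz; rewrite lee_fin; have /andP[] := dvb y yyz.
  apply: ge0_le_integral => //.
  - move=> y /oo yyz; rewrite -EFinM lee_fin mulr_ge0//.
    by have /andP[] := dvb y yyz.
  - exact: measurable_funeM.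
  - apply: measurable_funTS; exact: measurable_slice_region.
  move=> y /oo yyz.
  have [sty Ay _] := Hy y yyz; rewrite quadAS in Ay.
  have Jik : #|J :\ i| = k by move: Jk; rewrite (cardsD1 i) iJ => -[].
  apply: le_trans (IH _ _ _ _ Jik (ltnW kn) sty Ay).
  rewrite -EFinM lee_fin; have /andP[_ g2] := dvb y yyz.
  rewrite mulrAC mulrC ler_wpM2l ?exprn_ge0// mulrC ler_pdivrMr// mulrC //.
apply: (@le_trans _ _ (P (\big[setU/set0]_(i < m | i \in J) topped false J s c y0 z i))).
  rewrite measure_bigsetU_ord_cond.
  - apply: le_trans (lee_sum _ step).
    by rewrite sumEFin lee_fin sumr_const Jk -[leRHS]mulr_natl mulVKf ?pnatr_eq0.
  - by move=> i _; exact: measurable_topped.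
  - exact: trivIset_topped.
apply: le_measure; rewrite ?inE.
- by apply: bigsetU_measurable => i _; exact: measurable_topped.
- exact: measurable_prob_region.
- rewrite -(bigcup_pred (mem J)) => w [i /= iJ]; exact: topped_region.
Qed.

Theorem prob_region_le n k (J : {set 'I_m}) (s c z : R) :
  (5 <= n <= 6)%N -> #|J| = k -> (k < n)%N -> state n k s c z ->
  0 < quadA k s c z ->
  (prob_region X true J z s c <=
   (2^-1 ^+ k * volfun (qup k) k (quadA k s c z) (linB k s z))%:E)%E.
Proof.
move=> n56; elim: k J s c z => [|k IH] J s c z Jk kn st A0.
  rewrite expr0 mul1r /volfun expr0 mul1r qup0.
  by rewrite probability_le1//; exact: measurable_prob_region.
have [y0 [y1 yz D0 Hy [Ay0 By0 sty0]]] := layer n56 kn st A0.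
have z1 : z <= 1 by case: st.
pose dv y := dvolfun (qup k.+1) (qup' k.+1) k.+1 s c y.
have [mdv Idv] := integral_layer (@is_derive_qup R k.+1) (@continuous_qup' R k.+1) yz D0 Ay0 By0.
have oo y : [set` `]y0, z[] y -> y0 < y <= z.
  by rewrite /= in_itv/= => /andP[-> /ltW].
have k5 : (0 < k.+1 <= 5)%N by move: kn n56; lia.
have dvb y : y0 < y <= z ->
    k.+1%:R * volfun (qup k) k (quadA k (s + y) (c + y ^+ 2) y) (linB k (s + y) y) <= dv y.
  move=> yyz; have [sty Ay ty] := Hy y yyz.
  have := qup_op k5 ty; rewrite -quadAS -linBS /dv /dvolfun /volfun /= => g2.
  set W := wroot _ _ - _.
  have W0 : 0 <= W.
    apply: wroot_ge; first exact: ltW.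
    by rewrite linBS ltW// (linB_gt0 n56 _ sty)// ltnW.
  by rewrite mulrCA ler_wpM2l ?exprn_ge0.
have sl i y : i \in J -> y0 < y <= z ->
    (slice X true (J :\ i) s c y <= (k.+1%:R^-1 * 2^-1 ^+ k)%:E * (dv y)%:E)%E.
  move=> iJ yyz; have [sty Ay _] := Hy y yyz; rewrite quadAS in Ay.
  have Jik : #|J :\ i| = k by move: Jk; rewrite (cardsD1 i) iJ => -[].
  apply: le_trans (IH _ _ _ _ Jik (ltnW kn) sty Ay) _.
  rewrite -EFinM lee_fin; have g2 := dvb y yyz.
  by rewrite [leRHS]mulrAC [leRHS]mulrC ler_wpM2l ?exprn_ge0// [leRHS]mulrC ler_pdivlMr// mulrC.
(* [dv] dominates a positive multiple of a probability, so its sign requires no polynomial check. *)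
have dv0 y : y0 < y <= z -> 0 <= dv y.
  move=> yyz; have /card_gt0P[i iJ] : (0 < #|J|)%N by rewrite Jk.
  have : (0 <= (k.+1%:R^-1 * 2^-1 ^+ k)%:E * (dv y)%:E)%E.
    by apply: le_trans (sl i y iJ yyz); exact: measure_ge0.
  by rewrite -EFinM lee_fin pmulr_rge0// mulr_gt0 ?invr_gt0// exprn_gt0.
have step i : i \in J -> (P (topped true J s c y0 z i) <=
    (k.+1%:R^-1 * (2^-1 ^+ k.+1 * volfun (qup k.+1) k.+1 (quadA k.+1 s c z) (linB k.+1 s z)))%:E)%E.
  move=> iJ; rewrite /topped (prob_slice iX uX)//; last by rewrite !inE eqxx.
  have K0 : 0 <= k.+1%:R^-1 * 2^-1 ^+ k :> R by rewrite mulr_ge0// exprn_ge0.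
  rewrite (_ : (_ * _)%:E = 2^-1%:E * ((k.+1%:R^-1 * 2^-1 ^+ k)%:E *
      (volfun (qup k.+1) k.+1 (quadA k.+1 s c z) (linB k.+1 s z))%:E))%E; last first.
    by rewrite -!EFinM; congr EFin; rewrite exprS; ring.
  rewrite lee_pmul2l// -Idv -ge0_integralZl//; last first.
    by move=> y /oo yyz; rewrite lee_fin dv0.
  apply: ge0_le_integral => //.
  - apply: measurable_funTS; exact: measurable_slice_region.
  - exact: measurable_funeM.
  - by move=> y /oo; exact: sl.
have Jn : (#|J| < n)%N by rewrite Jk.
have J0 : (0 < #|J|)%N by rewrite Jk.
rewrite -Jk in sty0 Ay0.
apply: (@le_trans _ _ (P (\big[setU/set0]_(i < m | i \in J) topped true J s c y0 z i))).
  apply: le_measure; rewrite ?inE.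
  - exact: measurable_prob_region.
  - by apply: bigsetU_measurable => i _; exact: measurable_topped.
  - exact: (region_topped n56 Jn J0 sty0 Ay0).
apply: le_trans (measure_bigsetU_le _ _ _ (measurable_topped _ _ _ _ _ _)) _.
apply: le_trans (lee_sum _ step) _.
by rewrite sumEFin lee_fin sumr_const Jk -[leLHS]mulr_natl mulVKf ?pnatr_eq0.
Qed.

End claims.

(** * Bounds for q_5 and q_6 *)

(** Certifies nonnegativity on [a/b, (a + 1)/b] by carrying that interval to [0, 1]. *)
Definition zlocal (a b : Z) (p : seq Z) : bool := zpos 9 (zshift a (zhom 1 b p)).

(** For n coinciding coordinates B/W = sqrt((n - r) / (r (n - 1))), so t is 0.60020... for n = 5 and
    0.5601788... for n = 6. These intervals enclose the two values. *)
Lemma zlocal_low5 :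
  zlocal 60020 (10 ^ 5) (zadd (zscale (10 ^ 6) (Qlow 4)) [:: - (17785 * 10 ^ 16)]%BZ).
Proof. by vm_cast_no_check (erefl true). Qed.

Lemma zlocal_low6 :
  zlocal 56017 (10 ^ 5) (zadd (zscale (10 ^ 7) (Qlow 5)) [:: - (34844 * 10 ^ 16)]%BZ).
Proof. by vm_cast_no_check (erefl true). Qed.

Lemma zlocal_up6 :
  zlocal 5601788 (10 ^ 7) (zadd (zscale (- 10 ^ 9) (Qup 5)) [:: 3485041 * 10 ^ 16]%BZ).
Proof. by vm_cast_no_check (erefl true). Qed.

Section local_bounds.
Context {R : realType}.

Lemma zlocal_ge0 a b p (t : R) : (0 <? b)%BZ -> zlocal a b p ->
  zr a / zr b <= t <= (zr a + 1) / zr b -> 0 <= zeval p t.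
Proof.
move=> /Z.ltb_lt b0 zl; have zb : 0 < zr b :> R by rewrite /zr ltr0z; lia.
rewrite ler_pdivrMr// ler_pdivlMr// => /andP[t1 t2].
suff : 0 <= zr b ^+ size p * zeval p t by rewrite pmulr_rge0// exprn_gt0.
have := @zeval_hom _ 1 b p (t * zr b) zb.
rewrite (_ : zr 1 * (t * zr b) / zr b = t); last first.
  by rewrite (_ : zr 1 = 1)//; field; rewrite lt0r_neq0.
move=> <-; rewrite mulr_ge0 ?(ltW zb)//.
have := zpos_ge0 zl (x := t * zr b - zr a); rewrite zeval_shift subrK; apply.
by apply/andP; split; lra.
Qed.

Lemma zr_pow10 n : zr (10 ^ Z.of_nat n) = 10 ^+ n :> R.
Proof. by rewrite zrX. Qed.

(** Decimal constants are split this way to keep the natural numbers under [%:R] small. *)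
Lemma zr_thousands a b : zr (Z.of_nat a * 1000 + Z.of_nat b)%BZ = a%:R * 1000 + b%:R :> R.
Proof. by rewrite zrD zrM !zr_nat. Qed.

Lemma zeval1 c (t : R) : zeval [:: c] t = zr c.
Proof. by rewrite /= mulr0 addr0. Qed.

Lemma zr_gt0 a : (0 <? a)%BZ -> 0 < zr a :> R.
Proof. by move=> /Z.ltb_lt a0; rewrite /zr ltr0z; lia. Qed.

Lemma zlocal_qlow k a b u s (t : R) : (0 <? b)%BZ -> (0 <? s)%BZ ->
  zlocal a b (zadd (zscale s (Qlow k)) [:: - (u * 10 ^ 16)]%BZ) ->
  zr a / zr b <= t <= (zr a + 1) / zr b -> zr u / zr s <= qlow k t.
Proof.
move=> b0 s0 zl /(zlocal_ge0 b0 zl).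
rewrite zevalD zevalZ zeval1 zrN zrM -[(10 ^ 16)%BZ]/(10 ^ Z.of_nat 16)%BZ zr_pow10.
rewrite -/den /qlow ler_pdivlMr ?den_gt0// mulrAC ler_pdivrMr ?zr_gt0//; lra.
Qed.

Lemma zlocal_qup k a b u s (t : R) : (0 <? b)%BZ -> (0 <? s)%BZ ->
  zlocal a b (zadd (zscale (- s) (Qup k)) [:: u * 10 ^ 16]%BZ) ->
  zr a / zr b <= t <= (zr a + 1) / zr b -> qup k t <= zr u / zr s.
Proof.
move=> b0 s0 zl /(zlocal_ge0 b0 zl).
rewrite zevalD zevalZ zeval1 zrN zrM -[(10 ^ 16)%BZ]/(10 ^ Z.of_nat 16)%BZ zr_pow10.
rewrite -/den /qup ler_pdivrMr ?den_gt0// mulrAC ler_pdivlMr ?zr_gt0//; lra.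
Qed.

Lemma wroot_bounds (A B w1 w2 : R) : 0 <= w1 -> 0 <= w2 ->
  w1 ^+ 2 <= disc A B <= w2 ^+ 2 -> w1 <= wroot A B <= w2.
Proof.
move=> w10 w20 /andP[h1 h2]; rewrite /wroot.
by rewrite -{1}(ger0_norm w10) -(ger0_norm w20) -!sqrtr_sqr !ler_wsqrtr.
Qed.

Lemma tpar_bounds (A B w1 w2 a b : R) : 0 < w1 -> w1 <= wroot A B <= w2 ->
  a <= 1 -> b <= 1 -> B <= (1 - a) * w1 -> (1 - b) * w2 <= B -> a <= tpar A B <= b.
Proof.
move=> w10 /andP[h1 h2] a1 b1 Ba Bb.
have W0 : 0 < wroot A B by exact: lt_le_trans h1.
rewrite /tpar ler_pdivrMr// ler_pdivlMr//.
have : (1 - a) * w1 <= (1 - a) * wroot A B by rewrite ler_wpM2l// subr_ge0.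
have : (1 - b) * wroot A B <= (1 - b) * w2 by rewrite ler_wpM2l// subr_ge0.
by lra.
Qed.

Lemma volfun_ge (q : R -> R) k (A B w1 w2 a b v : R) : 0 < w1 -> 0 <= w2 ->
  w1 ^+ 2 <= disc A B <= w2 ^+ 2 -> a <= 1 -> b <= 1 ->
  B <= (1 - a) * w1 -> (1 - b) * w2 <= B -> B <= w1 -> 0 <= v ->
  (forall t, a <= t <= b -> v <= q t) -> (w1 - B) ^+ k * v <= volfun q k A B.
Proof.
move=> w10 w20 dAB a1 b1 Ba Bb Bw1 v0 qv.
have wb := wroot_bounds (ltW w10) w20 dAB.
have tb := tpar_bounds w10 wb a1 b1 Ba Bb.
case/andP: wb => wb _; apply: ler_pM => //; last exact: qv.
  by rewrite exprn_ge0// subr_ge0.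
by rewrite lerXn2r ?nnegrE ?lerD2r// subr_ge0//; exact: le_trans wb.
Qed.

Lemma volfun_le (q : R -> R) k (A B w1 w2 a b v : R) : 0 < w1 -> 0 <= w2 ->
  w1 ^+ 2 <= disc A B <= w2 ^+ 2 -> a <= 1 -> b <= 1 ->
  B <= (1 - a) * w1 -> (1 - b) * w2 <= B -> B <= w1 -> 0 <= v ->
  (forall t, a <= t <= b -> q t <= v) -> volfun q k A B <= (w2 - B) ^+ k * v.
Proof.
move=> w10 w20 dAB a1 b1 Ba Bb Bw1 v0 qv.
have wb := wroot_bounds (ltW w10) w20 dAB.
have tb := tpar_bounds w10 wb a1 b1 Ba Bb.
case/andP: wb => wb1 wb2.
have WB : 0 <= wroot A B - B by rewrite subr_ge0; exact: le_trans wb1.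
apply: (@le_trans _ _ ((wroot A B - B) ^+ k * v)).
  by rewrite ler_wpM2l ?exprn_ge0//; exact: qv.
rewrite ler_wpM2r// lerXn2r ?nnegrE ?lerD2r//.
by apply: le_trans WB _; rewrite lerD2r.
Qed.

Lemma zr_le a b : (a <=? b)%BZ -> zr a <= zr b :> R.
Proof. by move=> /Z.leb_le ab; rewrite /zr ler_int; lia. Qed.

Lemma zrB a b : zr (a - b)%BZ = zr a - zr b :> R.
Proof. by rewrite /Z.sub zrD zrN. Qed.

(** For B = b/d and A between A1/d^2 and A2/d^2, integer inequalities certify that W lies in
    [w1/d, w2/d] and t in [ta/te, (ta + 1)/te]. The coefficients 20 and 41 come from r - 1 =
    41/20. *)
Definition zbracket (d b w1 w2 ta te A1 A2 : Z) : bool :=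
  [&& (0 <? d)%BZ, (0 <? te)%BZ, (0 <? w1)%BZ, (0 <=? w2)%BZ,
     (20 * w1 ^ 2 <=? 20 * b ^ 2 + 41 * A1)%BZ,
     (20 * b ^ 2 + 41 * A2 <=? 20 * w2 ^ 2)%BZ,
     (ta + 1 <=? te)%BZ, (b * te <=? (te - ta) * w1)%BZ,
     ((te - ta - 1) * w2 <=? b * te)%BZ & (b <=? w1)%BZ].

Lemma zbracketP d b w1 w2 ta te A1 A2 (A : R) :
  zbracket d b w1 w2 ta te A1 A2 ->
  zr A1 / zr d ^+ 2 <= A <= zr A2 / zr d ^+ 2 ->
  [/\ 0 < zr w1 / zr d :> R, 0 <= zr w2 / zr d :> R,
     (zr w1 / zr d) ^+ 2 <= disc A (zr b / zr d) <= (zr w2 / zr d) ^+ 2 &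
     [/\ zr ta / zr te <= 1 :> R, (zr ta + 1) / zr te <= 1 :> R,
      zr b / zr d <= (1 - zr ta / zr te) * (zr w1 / zr d) :> R,
      (1 - (zr ta + 1) / zr te) * (zr w2 / zr d) <= zr b / zr d :> R &
      zr b / zr d <= zr w1 / zr d :> R]].
Proof.
case/and5P => /zr_gt0 d0 /zr_gt0 te0 /zr_gt0 w10 /zr_ge0 w20.
case/and5P => /zr_le h1 /zr_le h2 /zr_le h3 /zr_le h4.
case/andP => /zr_le h5 /zr_le h6.
have z20 : zr 20 = 20 :> R by [].
have z41 : zr 41 = 41 :> R by [].
have z1 : zr 1 = 1 :> R by [].
move: h1 h2 h3 h4 h5; rewrite !(zrB, zrD, zrM, zrX _ 2) z20 z41 z1.
move: (zr d : R) d0 => D D0; move: (zr te : R) te0 => E E0.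
move: (zr w1 : R) w10 h6 => a a0 h6; move: (zr w2 : R) (w20 R) => a' a'0.
move: (zr b : R) h6 => B h6; move: (zr ta : R) => s; move: (zr A1 : R) (zr A2 : R) => A1' A2'.
move=> h1 h2 h3 h4 h5; have D2 : 0 < D ^+ 2 by rewrite exprn_gt0.
rewrite ler_pdivrMr// ler_pdivlMr// => /andP[A1b A2b].
have dE : D ^+ 2 * disc A (B / D) = B ^+ 2 + 41 / 20 * (A * D ^+ 2).
  by rewrite /disc /r0; field; rewrite lt0r_neq0.
split; first by rewrite divr_gt0.
- by rewrite divr_ge0// ltW.
- rewrite !expr_div_n ler_pdivrMr// ler_pdivlMr// ![disc _ _ * _]mulrC dE.
  by apply/andP; split; lra.
have E00 : E != 0 by rewrite lt0r_neq0.
split.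
- by rewrite ler_pdivrMr//; lra.
- by rewrite ler_pdivrMr//; lra.
- rewrite mulrA ler_pM2r ?invr_gt0// -(ler_pM2r E0).
  by rewrite mulrAC mulrBl mul1r mulfVK.
- rewrite mulrA ler_pM2r ?invr_gt0// -(ler_pM2r E0).
  by rewrite mulrAC mulrBl mul1r mulfVK//; apply: le_trans h5; lra.
- by rewrite ler_pM2r ?invr_gt0.
Qed.

Lemma zvolfun_ge (q : R -> R) k d b w1 w2 ta te A1 A2 u s c e (A : R) :
  zbracket d b w1 w2 ta te A1 A2 ->
  zr A1 / zr d ^+ 2 <= A <= zr A2 / zr d ^+ 2 ->
  (0 <=? u)%BZ -> (0 <? s)%BZ -> (0 <? e)%BZ ->
  (c * (d ^ Z.of_nat k * s) <=? (w1 - b) ^ Z.of_nat k * u * e)%BZ ->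
  (forall t, zr ta / zr te <= t <= (zr ta + 1) / zr te -> zr u / zr s <= q t) ->
  zr c / zr e <= volfun q k A (zr b / zr d).
Proof.
move=> br Ab /zr_ge0 u0 /zr_gt0 s0 /zr_gt0 e0 /zr_le h qv.
have d0 : 0 < zr d :> R by case/and5P : br => /zr_gt0.
have [h1 h2 h3 [h4 h5 h6 h7 h8]] := zbracketP br Ab.
apply: le_trans (@volfun_ge q k A (zr b / zr d) _ _ _ _ (zr u / zr s) h1 h2 h3 h4 h5 h6 h7 h8 _ qv); last first.
  by rewrite divr_ge0 ?(ltW s0)//; exact: u0.
rewrite -mulrBl ler_pdivrMr// exprMn exprVn.
move: h; rewrite !(zrM, zrX, zrB) -ler_pdivlMr ?mulr_gt0 ?exprn_gt0//.
by move=> h; apply: (le_trans h); rewrite invfM; lra.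
Qed.

Lemma zvolfun_le (q : R -> R) k d b w1 w2 ta te A1 A2 u s c e (A : R) :
  zbracket d b w1 w2 ta te A1 A2 ->
  zr A1 / zr d ^+ 2 <= A <= zr A2 / zr d ^+ 2 ->
  (0 <=? u)%BZ -> (0 <? s)%BZ -> (0 <? e)%BZ ->
  ((w2 - b) ^ Z.of_nat k * u * e <=? c * (d ^ Z.of_nat k * s))%BZ ->
  (forall t, zr ta / zr te <= t <= (zr ta + 1) / zr te -> q t <= zr u / zr s) ->
  volfun q k A (zr b / zr d) <= zr c / zr e.
Proof.
move=> br Ab /zr_ge0 u0 /zr_gt0 s0 /zr_gt0 e0 /zr_le h qv.
have d0 : 0 < zr d :> R by case/and5P : br => /zr_gt0.
have [h1 h2 h3 [h4 h5 h6 h7 h8]] := zbracketP br Ab.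
apply: le_trans (@volfun_le q k A (zr b / zr d) _ _ _ _ (zr u / zr s) h1 h2 h3 h4 h5 h6 h7 h8 _ qv) _.
  by rewrite divr_ge0 ?(ltW s0)//; exact: u0.
rewrite -mulrBl ler_pdivlMr// exprMn exprVn.
move: h; rewrite !(zrM, zrX, zrB) -ler_pdivrMr ?mulr_gt0 ?exprn_gt0//.
by move=> h; apply: le_trans h; rewrite invfM; lra.
Qed.

Lemma zr_fracE x y m : (0 <? m)%BZ -> zr (x * m) / zr (y * m) = zr x / zr y :> R.
Proof.
move=> m0; have zm : zr m != 0 :> R by rewrite lt0r_neq0// zr_gt0.
by rewrite !zrM -mulf_div divff// mulr1.
Qed.

(** 39/4 and 39/20 are n (n - r) and n - r at n = 5. The interval for A leaves room 10^-8 for a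
    positive c in [half_event]. *)
Lemma volfun_low5 (A : R) : 39 / 4 - (100 * 10 ^+ 6)^-1 <= A <= 39 / 4 ->
  16 * ((8 * 1000 + 163) / 10 ^+ 5) <= volfun (qlow 4) 4 A (39 / 20).
Proof.
move=> Ab.
have Bt : zr 19500000 / zr (10 ^ 7) = 39 / 20 :> R by exact: (@zr_fracE 39 20 500000).
have -> : 16 * ((8 * 1000 + 163) / 10 ^+ 5) = zr (16 * 8163) / zr (10 ^ 5) :> R.
  by rewrite -[(10 ^ 5)%BZ]/(10 ^ Z.of_nat 5)%BZ zr_pow10 (zrM 16) -mulrA -(zr_thousands 8 163).
rewrite -Bt.
apply: (@zvolfun_ge _ 4 (10 ^ 7) 19500000 48774990 48775000 60020 (10 ^ 5)
  ((975 * 10 ^ 6 - 1) * 10 ^ 6) (975 * 10 ^ 12) 17785 (10 ^ 6)) => //; last first.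
  by move=> t; apply: zlocal_qlow => //; exact: zlocal_low5.
(* All powers are expressed through 10^6, which is then generalized so that [field] meets only small
   numerals. *)
have -> : (10 ^ 7)%BZ = (10 * 10 ^ 6)%BZ by [].
have -> : (975 * 10 ^ 12)%BZ = (975 * 10 ^ 6 * 10 ^ 6)%BZ by [].
have h0 : 0 < zr (10 ^ 6) :> R by exact: zr_gt0.
have z1 : zr (10 ^ 6) = 10 ^+ 6 :> R by rewrite -(zr_pow10 6).
rewrite -z1 in Ab; move: (10 ^ 6)%BZ h0 Ab {z1} => M h0 Ab.
rewrite !(zrM, zrB); move: (zr M : R) h0 Ab => h h0 Ab.
have z2 : zr 975 = 975 :> R by [].
have z3 : zr 10 = 10 :> R by [].
have z4 : zr 1 = 1 :> R by [].
rewrite z2 z3 z4.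
have -> : (975 * h - 1) * h / (10 * h) ^+ 2 = 39 / 4 - (100 * h)^-1.
  by field; rewrite lt0r_neq0.
have -> : 975 * h * h / (10 * h) ^+ 2 = 39 / 4.
  by field; rewrite lt0r_neq0.
exact: Ab.
Qed.

Lemma volfun_low6 (A : R) : 177 / 10 - (100 * 10 ^+ 6)^-1 <= A <= 177 / 10 ->
  32 * ((8 * 1000 + 152) / 10 ^+ 5) <= volfun (qlow 5) 5 A (59 / 20).
Proof.
move=> Ab.
have Bt : zr 29500000 / zr (10 ^ 7) = 59 / 20 :> R by exact: (@zr_fracE 59 20 500000).
have -> : 32 * ((8 * 1000 + 152) / 10 ^+ 5) = zr (32 * 8152) / zr (10 ^ 5) :> R.
  by rewrite -[(10 ^ 5)%BZ]/(10 ^ Z.of_nat 5)%BZ zr_pow10 (zrM 32) -mulrA -(zr_thousands 8 152).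
rewrite -Bt.
apply: (@zvolfun_ge _ 5 (10 ^ 7) 29500000 67072700 67072800 56017 (10 ^ 5)
  ((1770 * 10 ^ 6 - 1) * 10 ^ 6) (1770 * 10 ^ 12) 34844 (10 ^ 7)) => //; last first.
  by move=> t; apply: zlocal_qlow => //; exact: zlocal_low6.
have -> : (10 ^ 7)%BZ = (10 * 10 ^ 6)%BZ by [].
have -> : (1770 * 10 ^ 12)%BZ = (1770 * 10 ^ 6 * 10 ^ 6)%BZ by [].
have h0 : 0 < zr (10 ^ 6) :> R by exact: zr_gt0.
have z1 : zr (10 ^ 6) = 10 ^+ 6 :> R by rewrite -(zr_pow10 6).
rewrite -z1 in Ab; move: (10 ^ 6)%BZ h0 Ab {z1} => M h0 Ab.
rewrite !(zrM, zrB); move: (zr M : R) h0 Ab => h h0 Ab.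
have z2 : zr 1770 = 1770 :> R by [].
have z3 : zr 10 = 10 :> R by [].
have z4 : zr 1 = 1 :> R by [].
rewrite z2 z3 z4.
have -> : (1770 * h - 1) * h / (10 * h) ^+ 2 = 177 / 10 - (100 * h)^-1.
  by field; rewrite lt0r_neq0.
have -> : 1770 * h * h / (10 * h) ^+ 2 = 177 / 10.
  by field; rewrite lt0r_neq0.
exact: Ab.
Qed.

Lemma volfun_up6 :
  volfun (qup 5) 5 (177 / 10) (59 / 20) <= 32 * ((815 * 1000 + 497) / 10 ^+ 7) :> R.
Proof.
have Bt : zr 29500000 / zr (10 ^ 7) = 59 / 20 :> R by exact: (@zr_fracE 59 20 500000).
have -> : 32 * ((815 * 1000 + 497) / 10 ^+ 7) = zr (32 * 815497) / zr (10 ^ 7) :> R.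
  by rewrite -[(10 ^ 7)%BZ]/(10 ^ Z.of_nat 7)%BZ zr_pow10 (zrM 32) -mulrA -(zr_thousands 815 497).
rewrite -Bt.
apply: (@zvolfun_le _ 5 (10 ^ 7) 29500000 67072721 67072722 5601788 (10 ^ 7)
  (1770 * 10 ^ 12) (1770 * 10 ^ 12) 3485041 (10 ^ 9)) => //; last first.
  by move=> t; apply: zlocal_qup => //; exact: zlocal_up6.
have -> : (10 ^ 7)%BZ = (10 * 10 ^ 6)%BZ by [].
have -> : (1770 * 10 ^ 12)%BZ = (1770 * 10 ^ 6 * 10 ^ 6)%BZ by [].
have h0 : 0 < zr (10 ^ 6) :> R by exact: zr_gt0.
move: (10 ^ 6)%BZ h0 => M h0.
rewrite !(zrM, zrB); move: (zr M : R) h0 => h h0.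
have z2 : zr 1770 = 1770 :> R by [].
have z3 : zr 10 = 10 :> R by [].
rewrite z2 z3.
have -> : 1770 * h * h / (10 * h) ^+ 2 = 177 / 10.
  by field; rewrite lt0r_neq0.
by rewrite lexx.
Qed.

End local_bounds.

(** * Integration over the largest coordinate *)

Section top.
Context {R : realType}.

Lemma integral_monomial (a C : R) k : 0 <= a -> a < 1 ->
  (\int[lebesgue_measure]_(x in `]a, 1%R[) (C * x ^+ k)%:E =
   (C * (1 - a ^+ k.+1) / k.+1%:R)%:E)%E.
Proof.
move=> a0 a1.
have K0 : k.+1%:R != 0 :> R by rewrite pnatr_eq0.
have dF x : is_derive x (1:R) (fun y : R => C / k.+1%:R * y ^+ k.+1) (C * x ^+ k).
  have H : is_derive x (1:R) (fun y : R => y ^+ k.+1) ((k.+1%:R * x ^+ k) *: 1).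
    by have := is_deriveX k.+1 (is_derive_id x (1:R)); rewrite exprfctE.
  have := is_deriveZ (C / k.+1%:R) H.
  by move=> /is_derive_eq; apply; rewrite /GRing.scale/=; field.
have cf : continuous (fun x : R => C * x ^+ k).
  by move=> x; apply: cvgM; [exact: cvg_cst|exact: exprn_continuous].
have cF : continuous (fun x : R => C / k.+1%:R * x ^+ k.+1).
  by move=> x; apply: cvgM; [exact: cvg_cst|exact: exprn_continuous].
rewrite -(integral_itv_bndoo true false); last first.
  apply/measurable_EFinP; apply: measurable_funTS; exact: continuous_measurable_fun.
rewrite (@continuous_FTC2 _ (fun x => C * x ^+ k) (fun x => C / k.+1%:R * x ^+ k.+1))//.
- by rewrite -EFinB expr1n; congr EFin; field.
- exact: continuous_subspaceT.
- split.
  + by move=> x _; have [] := dF x.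
  + by apply: cvg_at_right_filter; exact: cF.
  + by apply: cvg_at_left_filter; exact: cF.
- by move=> x _; rewrite derive1E; exact: derive_val.
Qed.

(** A has degree 2, B and W degree 1, and t degree 0. With nothing frozen but the largest coordinate
    x, the bound becomes a constant times x^k. *)
Lemma volfun_scale (q : R -> R) k (A B x : R) : 0 < x ->
  volfun q k (x ^+ 2 * A) (x * B) = x ^+ k * volfun q k A B.
Proof.
move=> x0; have wE : wroot (x ^+ 2 * A) (x * B) = x * wroot A B.
  rewrite /wroot (_ : disc _ _ = x ^+ 2 * disc A B); last by rewrite /disc; ring.
  by rewrite sqrtrM ?sqr_ge0// sqrtr_sqr gtr0_norm.
rewrite /volfun /tpar wE -mulrBr exprMn mulrA; congr (_ * q _).
by rewrite -mulf_div divff ?mul1r// lt0r_neq0.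
Qed.

Lemma apex_quadA n (c x : R) : x != 0 ->
  quadA n (0 + x) (c + x ^+ 2) x =
  x ^+ 2 * (n.+1%:R * (n.+1%:R - r0) - r0 * c / x ^+ 2).
Proof. by move=> x0; rewrite /quadA -natr1; field. Qed.

Lemma apex_linB n (x : R) : linB n (0 + x) x = x * (n.+1%:R - r0).
Proof. by rewrite /linB -natr1; ring. Qed.

Lemma apex_state n (c x : R) : 0 <= c -> 0 < x -> x <= 1 ->
  state n.+1 n (0 + x) (c + x ^+ 2) x.
Proof.
move=> c0 x0 x1; rewrite /state -natr1; split => //; rewrite ?add0r; try lra.
by rewrite ltr_wpDr// mulr_ge0// ltW.
Qed.

End top.

Section half_event.
Context {d : measure_display} {T : measurableType d} {R : realType}
  {P : probability T R} {m : nat}.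
Variable X : 'I_m -> {RV P >-> R}.

(* A positive c leaves room for the perturbation of the cone by a very small coordinate. *)
Definition half_event (J : {set 'I_m}) (c : R) : set T :=
  [set w | 0 < \sum_(j in J) X j w /\
           r0 * (c + \sum_(j in J) X j w ^+ 2) < (\sum_(j in J) X j w) ^+ 2].

Lemma measurable_half_event J c : measurable (half_event J c).
Proof.
apply: measurableI; apply: measurable_set_lt => //.
- exact: measurable_sum_set.
- apply: measurable_funM => //; apply: measurable_funD => //.
  by apply: measurable_sum_set => j _; exact: measurable_funX.
- by apply: measurable_funX; exact: measurable_sum_set.
Qed.

Hypothesis iX : mutually_independent X.
Hypothesis uX : forall i (A : set R), measurable A ->
  distribution P (X i) A = uniform_law A.

Lemma topped_half b (J : {set 'I_m}) c a z i : i \in J ->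
  topped X b J 0 c a z i `<=` half_event J c.
Proof.
move=> iJ w /= [_ [_ h2 h3]]; split; first by rewrite (big_setD1 i iJ)/= -[X in X + _]add0r.
by rewrite !(big_setD1 i iJ)/= addrA -[X in (X + _) ^+ 2]add0r.
Qed.

(** A positive c breaks the scaling, hence the cut at 1/100: for a largest coordinate x above it, c
    lowers A / x^2 by r c / x^2 <= 10^4 r c <= dl, within the range where V is a bound. The cut
    costs the factor 1 - 100^-(n + 1). *)
Lemma half_event_ge n (J : {set 'I_m}) (c V dl : R) : (4 <= n <= 5)%N -> #|J| = n.+1 ->
  0 <= c -> r0 * c * 10 ^+ 4 <= dl -> dl < 1 ->
  (forall A, n.+1%:R * (n.+1%:R - r0) - dl <= A <= n.+1%:R * (n.+1%:R - r0) ->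
     V <= volfun (qlow n) n A (n.+1%:R - r0)) ->
  0 <= V ->
  ((2^-1 ^+ n.+1 * V * (1 - 100^-1 ^+ n.+1))%:E <= P (half_event J c))%E.
Proof.
move=> n45 Jn c0 cdl dl1 hV V0.
have n56 : (5 <= n.+1 <= 6)%N by lia.
have r3 : r0 = 61 / 20 :> R by [].
have n5 : 5 <= n.+1%:R :> R by rewrite (ler_nat _ 5); case/andP: n56.
have a0 : 0 <= 100^-1 :> R by lra.
have a1 : 100^-1 < 1 :> R by lra.
have step i : i \in J ->
    ((n.+1%:R^-1 * (2^-1 ^+ n.+1 * V * (1 - 100^-1 ^+ n.+1)))%:E
      <= P (topped X false J 0 c 100^-1 1 i))%E.
  move=> iJ; rewrite /topped (prob_slice iX uX)//; [|by rewrite !inE eqxx|by lra].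
  rewrite (_ : (_ * _)%:E = 2^-1%:E *
      (2^-1 ^+ n * V * (1 - 100^-1 ^+ n.+1) / n.+1%:R)%:E)%E; last first.
    by rewrite -EFinM; congr EFin; rewrite exprS; ring.
  rewrite lee_pmul2l// -integral_monomial//.
  apply: ge0_le_integral => //.
  - move=> x /=; rewrite in_itv/= => /andP[x0 _]; rewrite lee_fin.
    by rewrite !mulr_ge0 ?exprn_ge0//; lra.
  - apply/measurable_EFinP; apply: measurable_funM => //; exact: measurable_funX.
  - apply: measurable_funTS; exact: measurable_slice_region.
  move=> x /=; rewrite in_itv/= => /andP[x100 x1].
  have x0 : 0 < x by lra.
  have Jin : #|J :\ i| = n by move: Jn; rewrite (cardsD1 i) iJ => -[].
  have rcx : 0 <= r0 * c / x ^+ 2 <= dl.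
    have r00 : 0 <= r0 :> R by lra.
    rewrite divr_ge0 ?sqr_ge0 ?mulr_ge0//=.
    rewrite ler_pdivrMr ?exprn_gt0//.
    have x2 : 1 <= x ^+ 2 * 10 ^+ 4.
      have : 1 <= (x * 100) ^+ 2 by rewrite exprn_ege1//; lra.
      by lra.
    have rc : 0 <= r0 * c by rewrite mulr_ge0//; lra.
    have dl0 : 0 <= dl by apply: le_trans cdl; rewrite mulr_ge0.
    have : (r0 * c * 10 ^+ 4) * x ^+ 2 <= dl * x ^+ 2 by rewrite ler_wpM2r ?sqr_ge0.
    have : r0 * c * 1 <= r0 * c * (x ^+ 2 * 10 ^+ 4) by rewrite ler_wpM2l.
    by lra.
  have nr : 9 < n.+1%:R * (n.+1%:R - r0) :> R.
    have : 5 * (n.+1%:R - r0) <= n.+1%:R * (n.+1%:R - r0) :> R by rewrite ler_wpM2r//; lra.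
    by lra.
  have A0 : 0 < quadA n (0 + x) (c + x ^+ 2) x.
    by rewrite apex_quadA ?lt0r_neq0// mulr_gt0 ?exprn_gt0//; lra.
  have := prob_region_ge iX uX n56 Jin (ltnSn n) (apex_state n c0 x0 (ltW x1)) A0.
  apply: le_trans; rewrite lee_fin -mulrA ler_wpM2l ?exprn_ge0//.
  rewrite apex_quadA ?lt0r_neq0// apex_linB volfun_scale// mulrC.
  by rewrite ler_wpM2l ?exprn_ge0 ?(ltW x0)// hV//; lra.
apply: (@le_trans _ _ (P (\big[setU/set0]_(i < m | i \in J) topped X false J 0 c 100^-1 1 i))).
  rewrite measure_bigsetU_ord_cond.
  - apply: le_trans (lee_sum _ step).
    by rewrite sumEFin lee_fin sumr_const Jn -[leRHS]mulr_natl mulVKf ?pnatr_eq0.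
  - by move=> i _; exact: measurable_topped.
  - exact: trivIset_topped.
apply: le_measure; rewrite ?inE.
- by apply: bigsetU_measurable => i _; exact: measurable_topped.
- exact: measurable_half_event.
- by rewrite -(bigcup_pred (mem J)) => w [i /= iJ]; exact: topped_half.
Qed.

Lemma prob_gt1 i : P [set w | 1 < X i w] = 0%E.
Proof.
transitivity (distribution P (X i) `]1, +oo[).
  congr (P _); apply/seteqP; split => w /=; rewrite in_itv/= andbT//.
rewrite uX// /uniform_law /uniform_prob.
apply: integral0_eq => x /=; rewrite in_itv/= andbT => x1.
by rewrite /uniform_pdf [_ <= 1]leNgt x1 andbF.
Qed.

Lemma half_event_le n (J : {set 'I_m}) (V : R) : (4 <= n <= 5)%N -> #|J| = n.+1 ->
  volfun (qup n) n (n.+1%:R * (n.+1%:R - r0)) (n.+1%:R - r0) <= V ->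
  0 <= V ->
  (P (half_event J 0%R) <= (2^-1 ^+ n.+1 * V)%:E)%E.
Proof.
move=> n45 Jn hV V0.
have n56 : (5 <= n.+1 <= 6)%N by lia.
have r3 : r0 = 61 / 20 :> R by [].
have n5 : 5 <= n.+1%:R :> R by rewrite (ler_nat _ 5); case/andP: n56.
have step i : i \in J -> (P (topped X true J 0 0 0 1 i) <= (n.+1%:R^-1 * (2^-1 ^+ n.+1 * V))%:E)%E.
  move=> iJ; rewrite /topped (prob_slice iX uX)//; last by rewrite !inE eqxx.
  rewrite (_ : (_ * _)%:E = 2^-1%:E *
      (2^-1 ^+ n * V * (1 - 0 ^+ n.+1) / n.+1%:R)%:E)%E; last first.
    by rewrite -EFinM; congr EFin; rewrite expr0n/= exprS; ring.
  rewrite lee_pmul2l// -integral_monomial//.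
  apply: ge0_le_integral => //.
  - apply: measurable_funTS; exact: measurable_slice_region.
  - apply/measurable_EFinP; apply: measurable_funM => //; exact: measurable_funX.
  move=> x /=; rewrite in_itv/= => /andP[x0 x1].
  have Jin : #|J :\ i| = n by move: Jn; rewrite (cardsD1 i) iJ => -[].
  have nr : 9 < n.+1%:R * (n.+1%:R - r0) :> R.
    have : 5 * (n.+1%:R - r0) <= n.+1%:R * (n.+1%:R - r0) :> R by rewrite ler_wpM2r//; lra.
    by lra.
  have A0 : 0 < quadA n (0 + x) (0 + x ^+ 2) x.
    by rewrite apex_quadA ?lt0r_neq0// mulr_gt0 ?exprn_gt0// mulr0 mul0r; lra.
  apply: le_trans (prob_region_le iX uX n56 Jin (ltnSn n) (apex_state n (lexx 0) x0 (ltW x1)) A0) _.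
  rewrite lee_fin -mulrA ler_wpM2l ?exprn_ge0//.
  rewrite apex_quadA ?lt0r_neq0// apex_linB volfun_scale// [leRHS]mulrC.
  by rewrite ler_wpM2l ?exprn_ge0 ?(ltW x0)// mulr0 mul0r subr0.
(* The largest coordinate is positive because the sum is; [U2] is the null event that some
   coordinate exceeds 1. *)
pose U1 := \big[setU/set0]_(i < m | i \in J) topped X true J 0 0 0 1 i.
pose U2 := \big[setU/set0]_(i < m) [set w | 1 < X i w].
have mU1 : measurable U1 by apply: bigsetU_measurable => i _; exact: measurable_topped.
have mX1 i : measurable [set w | 1 < X i w] by exact: measurable_set_lt.
have mU2 : measurable U2 by apply: bigsetU_measurable => i _.
apply: (@le_trans _ _ (P (U1 `|` U2))).
  apply: le_measure; rewrite ?inE.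
  - exact: measurable_half_event.
  - exact: measurableU.
  move=> w /= [h1 h2]; rewrite /U1 /U2 -(bigcup_pred (mem J)) -(bigcup_pred predT).
  have [[i Xi]|/forallNP X1] := pselect (exists i, 1 < X i w); [by right; exists i|left].
  have /card_gt0P[i0 i0J] : (0 < #|J|)%N by rewrite Jn.
  case: (arg_maxP (fun i => X i w) i0J) => i iJ imax; exists i => //.
  have Xi0 : 0 < X i w.
    rewrite ltNge; apply/negP => Xi0; move: h1; apply/negP; rewrite -leNgt.
    apply: sumr_le0 => j jJ; exact: le_trans (imax j jJ) Xi0.
  have Xi1 : X i w <= 1 by rewrite leNgt; apply/negP; exact: X1.
  split => //; split; first by move=> j /setD1P[_ jJ]; exact: imax.
  - by move: h1; rewrite (big_setD1 i iJ)/= add0r.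
  - by move: h2; rewrite !(big_setD1 i iJ)/= !add0r.
have U20 : P U2 = 0%E.
  apply/eqP; rewrite eq_le measure_ge0 andbT.
  apply: le_trans (measure_bigsetU_le _ _ _ mX1) _.
  by rewrite big1// => i _; exact: prob_gt1.
apply: (@le_trans _ _ (P U1)).
  by rewrite -[leRHS]adde0 -U20; exact: measureU2.
rewrite /U1; apply: le_trans (measure_bigsetU_le _ _ _ (measurable_topped X _ _ _ _ _ _)) _.
apply: le_trans (lee_sum _ step) _.
by rewrite sumEFin lee_fin sumr_const Jn -[leLHS]mulr_natl mulVKf ?pnatr_eq0.
Qed.

End half_event.

(** * Reflection and the two halves of the ratio event *)

Section negation.
Context {d : measure_display} {T : measurableType d} {R : realType}
  {P : probability T R}.

Lemma measurable_neg (X : {RV P >-> R}) : measurable_fun setT (fun w => - X w).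
Proof. exact: measurableT_comp. Qed.

Definition negRV (X : {RV P >-> R}) : {RV P >-> R} :=
  HB.pack (fun w => - X w) (isMeasurableFun.Build _ _ _ _ _ (measurable_neg X)).

Lemma measurable_oppr (A : set R) : measurable A -> measurable (-%R @^-1` A).
Proof.
move=> mA; rewrite -[X in measurable X]setTI.
by apply: (@oppr_measurable R setT).
Qed.

Lemma neg_independent m (X : 'I_m -> {RV P >-> R}) :
  mutually_independent X -> mutually_independent (fun i => negRV (X i)).
Proof.
move=> iX J A mA.
by rewrite -(iX J (fun i => -%R @^-1` A i))// => i /mA; exact: measurable_oppr.
Qed.

Lemma uniform_lawN (A : set R) : measurable A ->
  uniform_law (-%R @^-1` A) = uniform_law A.
Proof.
move=> mA; rewrite /uniform_law /uniform_prob.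
pose f (x : R) := (uniform_pdf (- 1) 1 x)%:E.
have fN x : f (- x) = f x.
  rewrite /f /uniform_pdf; congr (if _ then _ else _)%:E.
  by rewrite lerN2 lerNl andbC.
have mf : measurable_fun [set: R] f.
  by apply/measurable_EFinP; exact: measurable_uniform_pdf.
have mN : measurable_fun [set: measurableTypeR R] (-%R : measurableTypeR R -> measurableTypeR R).
  exact: oppr_measurable.
transitivity (\int[lebesgue_measure]_(x in -%R @^-1` A) (f \o -%R) x)%E.
  by apply: eq_integral => x _ /=; rewrite fN.
rewrite -(@ge0_integral_pushforward _ _ _ _ _ _ mN lebesgue_measure A f)//.
- by apply: eq_measure_integral => B mB _; exact: lebesgue_measureN.
- exact: measurable_funTS.
- by move=> x _; rewrite lee_fin; apply: uniform_pdf_ge0; rewrite gtrN.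
Qed.

Lemma neg_uniform m (X : 'I_m -> {RV P >-> R}) i (A : set R) :
  (forall i (A : set R), measurable A -> distribution P (X i) A = uniform_law A) ->
  measurable A -> distribution P (negRV (X i)) A = uniform_law A.
Proof.
move=> uX mA; rewrite -uniform_lawN// -(uX i)//; exact: measurable_oppr.
Qed.

Lemma sum_finset m (F : 'I_m -> R) : \sum_(j in finset xpredT) F j = \sum_j F j.
Proof. by apply: eq_bigl => j; rewrite inE. Qed.

Lemma ratio_gt m (x : 'I_m -> R) (r : R) : 0 < r ->
  (r < sum_sq_ratio x) = (r * \sum_i x i ^+ 2 < (\sum_i x i) ^+ 2).
Proof.
move=> r0; rewrite /sum_sq_ratio; set Q := \sum_i x i ^+ 2.
have Q0 : 0 <= Q by apply: sumr_ge0 => i _; exact: sqr_ge0.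
(* If Q = 0, all x_i vanish; the ratio is then 0 by default and both inequalities fail. *)
move: Q0; rewrite le_eqVlt => /predU1P[Q0|Q0]; last by rewrite ltr_pdivlMr.
have x0 i : x i = 0.
  apply/eqP; rewrite -sqrf_eq0; move/esym/eqP: Q0.
  rewrite psumr_eq0; last by move=> j _; exact: sqr_ge0.
  by move=> /allP/(_ i); rewrite mem_index_enum => /(_ isT).
rewrite -Q0 invr0 !mulr0 big1 ?expr0n/= ?ltxx; last by move=> i _; exact: x0.
by apply/negbTE; rewrite -leNgt ltW.
Qed.

(** S^2 > r Q excludes S = 0, and S < 0 is the half event of -X. As -X is again i.i.d. uniform, the
    same bounds serve both halves. *)
Lemma ratio_event m (X : 'I_m -> {RV P >-> R}) :
  [set w | r0 < sum_sq_ratio (X ^~ w)] =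
  half_event X (finset xpredT) 0 `|` half_event (fun i => negRV (X i)) (finset xpredT) 0.
Proof.
have r00 : 0 < r0 :> R by rewrite /r0; lra.
apply/seteqP; split => w; rewrite /half_event /= !sum_finset !add0r ratio_gt//.
  move=> h; have : \sum_j X j w != 0.
    apply: contraTneq h => ->; rewrite expr0n/= -leNgt mulr_ge0 ?(ltW r00)//.
    by apply: sumr_ge0 => i _; exact: sqr_ge0.
  rewrite neq_lt => /orP[S0|S0]; [right|by left].
  rewrite sumrN oppr_gt0 S0 sqrrN; split => //.
  by under eq_bigr do rewrite sqrrN.
case=> -[_ //]; rewrite sumrN sqrrN.
by under eq_bigr do rewrite sqrrN.
Qed.

Lemma half_events_disjoint m (X : 'I_m -> {RV P >-> R}) J c :
  half_event X J c `&` half_event (fun i => negRV (X i)) J c = set0.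
Proof.
apply/seteqP; split => // w /= [[h _] [h' _]].
by move: h'; rewrite /= sumrN oppr_gt0 ltNge ltW.
Qed.

Lemma prob_ratio m (X : 'I_m -> {RV P >-> R}) :
  P [set w | r0 < sum_sq_ratio (X ^~ w)] =
  (P (half_event X (finset xpredT) 0%R) +
   P (half_event (fun i => negRV (X i)) (finset xpredT) 0%R))%E.
Proof.
rewrite ratio_event measureU//; [exact: measurable_half_event..|].
exact: half_events_disjoint.
Qed.

End negation.

Section q_bounds.
Context {d : measure_display} {T : measurableType d} {R : realType}
  {P : probability T R}.

(** The cut at 1/100 may be charged at 10^-4: this already lowers 8163 to no less than 8162, and
    8152 to no less than 8151. *)
Lemma pow_small k : 100^-1 ^+ (2 + k) <= 100^-1 ^+ 2 :> R.
Proof. by rewrite exprD ler_piMr ?exprn_ge0 ?exprn_ile1//; lra. Qed.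

Let n5r : 5%:R - r0 = 39 / 20 :> R. Proof. by rewrite /r0; lra. Qed.
Let n6r : 6%:R - r0 = 59 / 20 :> R. Proof. by rewrite /r0; lra. Qed.

Let c_small (c : R) : 0 <= c -> c <= 10 ^- 13 -> r0 * c * 10 ^+ 4 <= (100 * 10 ^+ 6)^-1.
Proof.
move=> c0 h; have -> : (100 * 10 ^+ 6)^-1 = 10 * 10 ^- 13 * 10 ^+ 4 :> R.
  rewrite (_ : 100 = 10 ^+ 2); last by lra.
  by rewrite -exprD (_ : 13 = 1 + (2 + 6) + 4)%N// 2!exprD !invfM; field.
by rewrite ler_wpM2r//; apply: ler_pM => //; rewrite /r0; lra.
Qed.

Lemma half_event_ge5 m (X : 'I_m -> {RV P >-> R}) (J : {set 'I_m}) (c : R) :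
  iid X uniform_law -> #|J| = 5%N -> 0 <= c -> c <= 10 ^- 13 ->
  (((8 * 1000 + 162) / 10 ^+ 5 / 2)%:E <= P (half_event X J c))%E.
Proof.
move=> [iX uX] J5 c0 c13.
apply: le_trans (@half_event_ge _ _ _ _ _ X iX uX 4 J c (16 * ((8 * 1000 + 163) / 10 ^+ 5)) _ isT J5 c0 (c_small c0 c13) _ _ _).
- have := pow_small 3; rewrite lee_fin; move: (100^-1 ^+ 5 : R) => e e1; lra.
- by rewrite invf_lt1; lra.
- move=> A; rewrite n5r => Ab; apply: volfun_low5.
  by move: Ab; rewrite (_ : 5%:R * (39 / 20) = 39 / 4 :> R)//; lra.
- lra.
Qed.

Lemma half_event_ge6 m (X : 'I_m -> {RV P >-> R}) (J : {set 'I_m}) :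
  iid X uniform_law -> #|J| = 6%N ->
  (((8 * 1000 + 151) / 10 ^+ 5 / 2)%:E <= P (half_event X J 0))%E.
Proof.
move=> [iX uX] J6.
have e13 : (0 : R) <= 10 ^- 13 by rewrite invr_ge0 exprn_ge0.
apply: le_trans (@half_event_ge _ _ _ _ _ X iX uX 5 J 0 (32 * ((8 * 1000 + 152) / 10 ^+ 5)) _ isT J6 (lexx 0) (c_small (lexx 0) e13) _ _ _).
- have := pow_small 4; rewrite lee_fin; move: (100^-1 ^+ 6 : R) => e e1; lra.
- by rewrite invf_lt1; lra.
- move=> A; rewrite n6r => Ab; apply: volfun_low6.
  by move: Ab; rewrite (_ : 6%:R * (59 / 20) = 177 / 10 :> R)//; lra.
- lra.
Qed.

Lemma half_event_le6 m (X : 'I_m -> {RV P >-> R}) (J : {set 'I_m}) :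
  iid X uniform_law -> #|J| = 6%N ->
  (P (half_event X J 0) <= ((815 * 1000 + 497) / 10 ^+ 7 / 2)%:E)%E.
Proof.
move=> [iX uX] J6.
apply: le_trans (@half_event_le _ _ _ _ _ X iX uX 5 J (32 * ((815 * 1000 + 497) / 10 ^+ 7)) isT J6 _ _) _.
- rewrite n6r (_ : 6%:R * (59 / 20) = 177 / 10 :> R); last by lra.
  exact: volfun_up6.
- lra.
- rewrite lee_fin; lra.
Qed.

Lemma iid_neg m (X : 'I_m -> {RV P >-> R}) :
  iid X uniform_law -> iid (fun i => negRV (X i)) uniform_law.
Proof.
move=> [iX uX]; split; first exact: neg_independent.
by move=> i A mA; exact: neg_uniform.
Qed.

Lemma card_finsetT m : #|finset (xpredT : pred 'I_m)| = m.
Proof. by rewrite cardsE card_ord. Qed.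

Lemma qE m (X : 'I_m -> {RV P >-> R}) :
  (q X r0)%:E = P [set w | r0 < sum_sq_ratio (X ^~ w)].
Proof.
rewrite /q fineK// fin_num_measure//.
by rewrite ratio_event; apply: measurableU; exact: measurable_half_event.
Qed.

Lemma q5_ge (X : 'I_5 -> {RV P >-> R}) : iid X uniform_law ->
  (8 * 1000 + 162) / 10 ^+ 5 <= q X r0.
Proof.
move=> hX; rewrite -lee_fin qE prob_ratio.
have e13 : (0 : R) <= 10 ^- 13 by rewrite invr_ge0 exprn_ge0.
have h1 := half_event_ge5 hX (card_finsetT 5) (lexx 0) e13.
have h2 := half_event_ge5 (iid_neg hX) (card_finsetT 5) (lexx 0) e13.
apply: le_trans (leeD h1 h2); rewrite -EFinD lee_fin; lra.
Qed.

Lemma q6_ge (X : 'I_6 -> {RV P >-> R}) : iid X uniform_law ->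
  (8 * 1000 + 151) / 10 ^+ 5 <= q X r0.
Proof.
move=> hX; rewrite -lee_fin qE prob_ratio.
have h1 := half_event_ge6 hX (card_finsetT 6).
have h2 := half_event_ge6 (iid_neg hX) (card_finsetT 6).
apply: le_trans (leeD h1 h2); rewrite -EFinD lee_fin; lra.
Qed.

Lemma q6_le (X : 'I_6 -> {RV P >-> R}) : iid X uniform_law ->
  q X r0 <= (815 * 1000 + 497) / 10 ^+ 7.
Proof.
move=> hX; rewrite -lee_fin qE prob_ratio.
have h1 := half_event_le6 hX (card_finsetT 6).
have h2 := half_event_le6 (iid_neg hX) (card_finsetT 6).
apply: le_trans (leeD h1 h2) _; rewrite -EFinD lee_fin; lra.
Qed.

End q_bounds.

(** * Mixture with a narrow spike *)

Section sums_event.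
Context {d : measure_display} {T : measurableType d} {R : realType}
  {P : probability T R} {m : nat}.
Variable X : 'I_m -> {RV P >-> R}.

Definition sums_event (G : set (R * R)) (J : {set 'I_m}) (s c : R) : set T :=
  [set w | G (s + \sum_(j in J) X j w, c + \sum_(j in J) X j w ^+ 2)].

Lemma measurable_sums_frozen (G : set (R * R)) (J : {set 'I_m}) (s c : R) : measurable G ->
  measurable [set p : R * frozen X J |
    G (s + p.1 + \sum_(j in J) X j p.2, c + p.1 ^+ 2 + \sum_(j in J) X j p.2 ^+ 2)].
Proof.
move=> mG.
have mX j : j \in J -> measurable_fun setT (fun p : R * frozen X J => X j p.2).
  move=> jJ; apply: (@measurableT_comp _ _ _ _ _ _ (X j : frozen X J -> R)) => //.
  exact: frozen_measurable_fun.
have m1 : measurable_fun setT (fun p : R * frozen X J => p.1) by exact: measurable_fst.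
rewrite -[X in measurable X]setTI.
apply: (@measurable_fun_pair _ _ _ (R * frozen X J)%type R R
  (fun p => s + p.1 + \sum_(j in J) X j p.2)
  (fun p => c + p.1 ^+ 2 + \sum_(j in J) X j p.2 ^+ 2)) => //.
- apply: measurable_funD; first exact: measurable_funD.
  by apply: (@measurable_sum_set _ (R * frozen X J)%type).
- apply: measurable_funD; first by apply: measurable_funD => //; exact: measurable_funX.
  apply: (@measurable_sum_set _ (R * frozen X J)%type) => j jJ.
  by apply: measurable_funX; exact: mX.
Qed.

Lemma measurable_sums_event G J s c : measurable G -> measurable (sums_event G J s c).
Proof.
move=> mG.
rewrite -[X in measurable X]setTI.
apply: (@measurable_fun_pair _ _ _ T R R
  (fun w => s + \sum_(j in J) X j w)
  (fun w => c + \sum_(j in J) X j w ^+ 2)) => //.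
- by apply: measurable_funD => //; exact: measurable_sum_set.
- apply: measurable_funD => //; apply: measurable_sum_set => j _.
  exact: measurable_funX.
Qed.

Definition sums_prob G (J : {set 'I_m}) (s c x : R) : \bar R :=
  P (sums_event G J (s + x) (c + x ^+ 2)).

Lemma measurable_sums_prob G J s c : measurable G ->
  measurable_fun setT (sums_prob G J s c).
Proof.
move=> mG; apply: (@measurable_slice _ _ _ _ _ X J
  [set p | G (s + p.1 + \sum_(j in J) X j p.2, c + p.1 ^+ 2 + \sum_(j in J) X j p.2 ^+ 2)]).
exact: measurable_sums_frozen.
Qed.

Lemma sums_prob_ge0 G J s c x : (0 <= sums_prob G J s c x)%E.
Proof. exact: measure_ge0. Qed.

Lemma sums_event_freeze G (J : {set 'I_m}) i s c : mutually_independent X ->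
  measurable G -> i \in J ->
  (P (sums_event G J s c) =
   \int[distribution P (X i)]_x sums_prob G (J :\ i) s c x)%E.
Proof.
move=> iX mG iJ.
have iJ' : i \notin J :\ i by rewrite !inE eqxx.
rewrite -(freeze iX iJ' (measurable_sums_frozen s c mG)).
by congr (P _); apply/seteqP; split => w; rewrite /sums_event /= !(big_setD1 i iJ)/= !addrA.
Qed.

End sums_event.

Section spike_law.
Context {R : realType}.
Local Notation mu := (@lebesgue_measure R).

Lemma uniform_prob_itv (a b : R) (ab : a < b) (A : set R) : measurable A ->
  uniform_prob ab A = ((b - a)^-1%:E * mu (A `&` `]a, b[))%E.
Proof.
move=> mA; transitivity (\int[uniform_prob ab]_x (EFin \o (\1_A : R -> R)) x)%E.
  by rewrite /comp integral_indic// setIT.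
have mI : measurable_fun [set: measurableTypeR R] (EFin \o (\1_A : R -> R)).
  by apply/measurable_EFinP; exact: measurable_indic.
rewrite integral_uniform//; last by move=> x; rewrite lee_fin.
by rewrite integral_itv_bndoo /comp ?integral_indic//; exact: measurable_funTS.
Qed.

Lemma lt_norm_itv (e : R) : [set y : R | `|y| < e] = [set` `]- e, e[].
Proof. by apply/seteqP; split => y; rewrite /= in_itv/= ltr_norml. Qed.

Lemma integral_cst_indic (k : R) (A B : set R) : 0 <= k -> measurable A -> measurable B ->
  (\int[mu]_(x in A) (k * \1_B x)%:E = k%:E * mu (B `&` A))%E.
Proof.
move=> k0 mA mB; under eq_integral do rewrite EFinM.
rewrite ge0_integralZl//.
- by rewrite integral_indic.
- by apply/measurable_EFinP; exact: measurable_indic.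
Qed.

Variables p e : R.
Hypothesis p01 : 0 <= p <= 1.
Hypothesis e0 : 0 < e.

Let k1 : 0 <= p / (2 * e).
Proof. by case/andP: p01 => p0 _; rewrite divr_ge0// mulr_ge0// ltW. Qed.

Let k2 : 0 <= (1 - p) / 2.
Proof. by case/andP: p01 => _ p1; rewrite divr_ge0// subr_ge0. Qed.

Let mB (a : R) : measurable [set y : R | `|y| < a].
Proof. by rewrite lt_norm_itv. Qed.

Lemma measurable_spike : measurable_fun setT (spike_density p e).
Proof. by apply: measurable_funD; apply: measurable_funM => //; apply: measurable_indic; exact: mB. Qed.

Lemma spike_ge0 x : 0 <= spike_density p e x.
Proof. by rewrite addr_ge0// mulr_ge0. Qed.

Lemma spike_law_lebesgue (A : set R) : measurable A ->
  density_law (spike_density p e) A =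
  ((p / (2 * e))%:E * mu (A `&` `](- e)%R, e[) + ((1 - p) / 2)%:E * mu (A `&` `](- 1)%R, 1%R[))%E.
Proof.
move=> mA; rewrite /density_law /spike_density.
under eq_integral do rewrite EFinD.
rewrite ge0_integralD//.
- by rewrite !integral_cst_indic// !lt_norm_itv ![_ `&` A]setIC.
- by move=> x _; rewrite lee_fin mulr_ge0.
- by apply/measurable_EFinP; apply: measurable_funM => //; apply: measurable_indic; exact: mB.
- by move=> x _; rewrite lee_fin mulr_ge0.
- by apply/measurable_EFinP; apply: measurable_funM => //; apply: measurable_indic; exact: mB.
Qed.

Lemma spike_law_mixture (eN : - e < e) (A : set R) : measurable A ->
  density_law (spike_density p e) A =
  (p%:E * uniform_prob eN A + (1 - p)%:E * uniform_law A)%E.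
Proof.
move=> mA; rewrite spike_law_lebesgue// /uniform_law !uniform_prob_itv// !muleA -!EFinM.
rewrite !opprK; congr (_%:E * _ + _)%E.
by rewrite (_ : e + e = 2 * e)//; ring.
Qed.

End spike_law.

Section spike_integral.
Context {R : realType}.
Variables p e : R.
Hypothesis p01 : 0 <= p <= 1.
Hypothesis e0 : 0 < e.

Lemma integral_spike (mu1 : {measure set R -> \bar R}) (f : R -> \bar R)
    (eN : - e < e) :
  (forall A : set R, measurable A -> mu1 A = density_law (spike_density p e) A) ->
  measurable_fun [set: R] f -> (forall x, (0 <= f x)%E) ->
  (\int[mu1]_x f x = p%:E * \int[uniform_prob eN]_x f x +
     (1 - p)%:E * \int[uniform_prob (gtrN (@ltr01 R))]_x f x)%E.
Proof.
move=> mu1E mf f0.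
have p0 : 0 <= p by case/andP: p01.
have p1 : 0 <= 1 - p by case/andP: p01; rewrite subr_ge0.
pose m1 : {measure set (measurableTypeR R) -> \bar R} := mscale (NngNum p0) (uniform_prob eN).
pose m2 : {measure set (measurableTypeR R) -> \bar R} :=
  mscale (NngNum p1) (uniform_prob (gtrN (@ltr01 R))).
rewrite (integral_law (mu2 := measure_add m1 m2))//; last first.
  move=> A mA; rewrite mu1E// [RHS]measure_addE /m1 /m2/= /mscale/=.
  by rewrite (spike_law_mixture p01 e0 eN).
rewrite ge0_integral_measure_add//.
by rewrite /m1 /m2 !ge0_integral_mscale.
Qed.

Lemma integral_uniform_ge (f : R -> \bar R) (eN : - e < e) (k : R) : 0 <= k ->
  measurable_fun [set: R] f -> (forall x, (0 <= f x)%E) ->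
  (forall x, `|x| < e -> (k%:E <= f x)%E) ->
  (k%:E <= \int[uniform_prob eN]_x f x)%E.
Proof.
move=> k0 mf f0 kf; rewrite integral_uniform//.
rewrite integral_itv_bndoo; last exact: measurable_funTS.
apply: (@le_trans _ _ ((e - - e)^-1%:E * \int[lebesgue_measure]_(x in `](- e)%R, e[) (cst k%:E) x)%E).
  rewrite integral_cst//= lebesgue_measure_itv/= lte_fin gtrN// -EFinB -!EFinM lee_fin.
  by rewrite le_eqVlt; apply/orP; left; apply/eqP; field; rewrite lt0r_neq0// opprK addr_gt0.
have c0 : 0 <= (e - - e)^-1 by rewrite invr_ge0 subr_ge0 ltW.
apply: lee_wpmul2l; first by rewrite lee_fin.
apply: ge0_le_integral => //.
- exact: measurable_funTS.
- by move=> x /=; rewrite in_itv/= -ltr_norml; exact: kf.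
Qed.

End spike_integral.

Section spike_induction.
Context {R : realType}.
Context {dU : measure_display} {TU : measurableType dU} {PU : probability TU R}
  {dX : measure_display} {TX : measurableType dX} {PX : probability TX R} {m : nat}.
Variables (U : 'I_m -> {RV PU >-> R}) (X : 'I_m -> {RV PX >-> R}) (p e : R).
Hypothesis p01 : 0 <= p <= 1.
Hypothesis e0 : 0 < e.
Hypothesis hU : iid U uniform_law.
Hypothesis hX : iid X (density_law (spike_density p e)).

Definition cone : set (R * R) := [set ab | r0 * ab.2 < ab.1 ^+ 2].

(* Pairs (s, c) for which (s + x, c + x^2) stays in the cone for all |x| < e. *)
Definition fat_cone : set (R * R) :=
  [set ab | r0 * ab.2 < ab.1 ^+ 2 - 2 * e * `|ab.1| - r0 * e ^+ 2].

Lemma measurable_cone : measurable cone.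
Proof.
apply: (@measurable_set_lt _ (R * R)%type).
  by apply: measurable_funM => //; exact: measurable_snd.
by apply: measurable_funX; exact: measurable_fst.
Qed.

Lemma measurable_fat_cone : measurable fat_cone.
Proof.
have m1 : measurable_fun setT (fun ab : R * R => ab.1) by exact: measurable_fst.
apply: (@measurable_set_lt _ (R * R)%type).
  by apply: measurable_funM => //; exact: measurable_snd.
apply: measurable_funB => //; apply: measurable_funB; first exact: measurable_funX.
apply: measurable_funM => //.
exact: (@measurableT_comp _ _ _ _ _ _ (Num.norm : R -> R)).
Qed.

Lemma fat_cone_shift s c x : `|x| < e -> fat_cone (s, c) -> cone (s + x, c + x ^+ 2).
Proof.
rewrite /fat_cone /cone /= => xe h.
have r00 : 0 < r0 :> R by rewrite /r0; lra.
have x2 : x ^+ 2 <= e ^+ 2.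
  by rewrite -real_normK ?num_real// ler_sqr ?nnegrE ?(ltW xe)// ltW.
have sx : - (`|s| * e) <= s * x.
  have : `|s * x| <= `|s| * e by rewrite normrM ler_wpM2l// ltW.
  by rewrite ler_norml => /andP[].
have : r0 * x ^+ 2 <= r0 * e ^+ 2 by rewrite ler_pM2l.
have : 0 <= x ^+ 2 by exact: sqr_ge0.
by lra.
Qed.

(** U and X live on unrelated probability spaces. Instead of a coupling, the law of one coordinate
    of X at a time is split into its two components, and the induction absorbs that coordinate into
    s and c. *)
Theorem prob_spike_ge (J : {set 'I_m}) (s c : R) :
  (((1 - p) ^+ #|J|)%:E * PU (sums_event U cone J s c) +
   (p * (1 - p) ^+ #|J|.-1)%:E * \sum_(i in J) PU (sums_event U fat_cone (J :\ i) s c) <=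
   PX (sums_event X cone J s c))%E.
Proof.
have [iU uU] := hU; have [iX lX] := hX.
have mC := measurable_cone; have mF := measurable_fat_cone.
have p0 : 0 <= p by case/andP: p01.
have p1 : 0 <= 1 - p by case/andP: p01; rewrite subr_ge0.
have eN : - e < e by rewrite gtrN.
have [k] := ubnP #|J|; elim: k J s c => [//|k IH] J s c; rewrite ltnS => Jk.
have [/eqP|] := posnP #|J|.
  rewrite cards_eq0 => /eqP ->; rewrite big_set0 mule0 adde0 cards0 expr0 mul1e.
  have E0 d (T : measurableType d) (P : probability T R) (Y : 'I_m -> {RV P >-> R}) w :
      sums_event Y cone finset.set0 s c w = cone (s + 0, c + 0).
    by rewrite /sums_event /= !big_set0.
  have [h|h] := pselect (cone (s + 0, c + 0)).
    rewrite (_ : sums_event U _ _ _ _ = setT); last by apply/seteqP; split => w // _; rewrite E0.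
    rewrite (_ : sums_event X _ _ _ _ = setT); last by apply/seteqP; split => w // _; rewrite E0.
    by rewrite !probability_setT.
  rewrite (_ : sums_event U _ _ _ _ = set0) ?measure0//.
  by apply/seteqP; split => w //; rewrite E0.
move=> /card_gt0P[i iJ].
have Ji : #|J| = #|J :\ i|.+1 by rewrite (cardsD1 i) iJ.
have Jik : (#|J :\ i| < k)%N by rewrite -Ji.
set K := #|J :\ i| in Ji Jik.
pose g := sums_prob X cone (J :\ i) s c.
pose a := sums_prob U cone (J :\ i) s c.
pose b j := sums_prob U fat_cone (J :\ i :\ j) s c.
have mg : measurable_fun [set: R] g by exact: measurable_sums_prob.
have ma : measurable_fun [set: R] a by exact: measurable_sums_prob.
have mb j : measurable_fun [set: R] (b j) by exact: measurable_sums_prob.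
have g0 x : (0 <= g x)%E by exact: sums_prob_ge0.
have a0 x : (0 <= a x)%E by exact: sums_prob_ge0.
have b0 j x : (0 <= b j x)%E by exact: sums_prob_ge0.
pose al := (1 - p) ^+ K; pose be := p * (1 - p) ^+ K.-1.
have al0 : 0 <= al by rewrite exprn_ge0.
have be0 : 0 <= be by rewrite mulr_ge0// exprn_ge0.
have gab x : (al%:E * a x + be%:E * \sum_(j in J :\ i) b j x <= g x)%E by exact: IH.
pose u : {measure set (measurableTypeR R) -> \bar R} := uniform_prob (gtrN (@ltr01 R)).
have Ucone : PU (sums_event U cone J s c) = (\int[u]_x a x)%E.
  rewrite (sums_event_freeze s c iU mC iJ).
  by rewrite (integral_law (mu2 := u)) => // A mA; exact: uU.
have Ufat j : j \in J :\ i -> PU (sums_event U fat_cone (J :\ j) s c) = (\int[u]_x b j x)%E.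
  move=> jJ; have iJj : i \in J :\ j.
    by move: jJ; rewrite !inE eq_sym => /andP[-> _].
  rewrite (sums_event_freeze s c iU mF iJj) (integral_law (mu2 := u))//.
  - by apply: eq_integral => x _; rewrite /b !finset.setDDl finset.setUC.
  - by move=> A mA; exact: uU.
  - exact: (@measurable_sums_prob _ _ _ PU m U fat_cone _ s c mF).
pose S := \sum_(j in J :\ i) fine (PU (sums_event U fat_cone (J :\ j) s c)).
have SE : (S%:E = \sum_(j in J :\ i) PU (sums_event U fat_cone (J :\ j) s c))%E.
  rewrite -sumEFin; apply: eq_bigr => j _; rewrite fineK// fin_num_measure//.
  exact: measurable_sums_event.
have [w wE] : exists w, PU (sums_event U cone J s c) = w%:E.
  exists (fine (PU (sums_event U cone J s c))); rewrite fineK// fin_num_measure//.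
  exact: measurable_sums_event.
have [v vE] : exists v, PU (sums_event U fat_cone (J :\ i) s c) = v%:E.
  exists (fine (PU (sums_event U fat_cone (J :\ i) s c))); rewrite fineK// fin_num_measure//.
  exact: measurable_sums_event.
have Iu : ((al * w + be * S)%:E <= \int[u]_x g x)%E.
  apply: (@le_trans _ _ (\int[u]_x (al%:E * a x + be%:E * \sum_(j in J :\ i) b j x)%E)%E).
    have msum : measurable_fun [set: R] (fun x => \sum_(j in J :\ i) b j x)%E.
      under eq_fun do rewrite big_mkcond.
      apply: emeasurable_sum => j.
      by case: (boolP (j \in J :\ i)) => _; [exact: mb|exact: measurable_cst].
    rewrite ge0_integralD//; last 4 first.
    - by move=> x _; rewrite mule_ge0 ?lee_fin.
    - exact: measurable_funeM.
    - by move=> x _; rewrite mule_ge0 ?lee_fin// sume_ge0.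
    - exact: measurable_funeM.
    rewrite !ge0_integralZl//; last by move=> x _; rewrite sume_ge0.
    rewrite -Ucone wE EFinD !EFinM SE leeD2l//.
    rewrite lee_wpmul2l ?lee_fin//.
    rewrite big_mkcond; under [X in (_ <= X)%E]eq_integral do rewrite big_mkcond.
    rewrite ge0_integral_sum//; last 2 first.
    - by move=> j; case: (boolP (j \in J :\ i)) => _; [exact: mb|exact: measurable_cst].
    - by move=> j x _; case: (j \in J :\ i).
    apply: lee_sum => j _; case: (boolP (j \in J :\ i)) => jJ; last by rewrite integral_ge0.
    by rewrite Ufat.
  apply: ge0_le_integral => //.
  - by move=> x _; rewrite adde_ge0// mule_ge0 ?lee_fin// sume_ge0.
  - apply: emeasurable_funD; apply: measurable_funeM => //.
    under eq_fun do rewrite big_mkcond.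
    apply: emeasurable_sum => j.
    by case: (boolP (j \in J :\ i)) => _; [exact: mb|exact: measurable_cst].
have v0 : 0 <= v by rewrite -lee_fin -vE.
(* A spiked coordinate moves a point of the fat cone only within the cone. Keeping just the
   all-uniform term of the induction hypothesis is what drops two or more spikes. *)
have Is : ((al * v)%:E <= \int[uniform_prob eN]_x g x)%E.
  apply: integral_uniform_ge => //; first by rewrite mulr_ge0.
  move=> x xe; apply: le_trans (gab x).
  apply: (@le_trans _ _ (al%:E * a x)%E); last first.
    by rewrite leeDl// mule_ge0 ?lee_fin// sume_ge0.
  rewrite EFinM lee_wpmul2l ?lee_fin// -vE; apply: le_measure; rewrite ?inE.
  - exact: measurable_sums_event.
  - exact: measurable_sums_event.
  move=> w' /(fat_cone_shift xe); rewrite /sums_event /=.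
  by rewrite addrAC [c + _ + _]addrAC.
have -> : (PX (sums_event X cone J s c) = p%:E * \int[uniform_prob eN]_x g x +
     (1 - p)%:E * \int[u]_x g x)%E.
  rewrite (sums_event_freeze s c iX mC iJ).
  by rewrite (integral_spike p01 e0 eN) => // A mA; exact: lX.
rewrite (big_setD1 i iJ)/= -SE wE vE Ji /= -/K.
apply: (@le_trans _ _ (p%:E * (al * v)%:E + (1 - p)%:E * (al * w + be * S)%:E)%E); last first.
  by apply: leeD; apply: lee_wpmul2l; rewrite ?lee_fin.
rewrite -!EFinM -!EFinD lee_fin -/al exprS -/al.
(* [be] has exponent K - 1, truncated to 0 at K = 0; the identity survives because S is then an
   empty sum. *)
have -> : (1 - p) * (al * w + be * S) = (1 - p) * al * w + p * al * S.
  rewrite mulrDr !mulrA; congr (_ + _); rewrite /be /al.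
  have [K0|K0] := posnP K; last by rewrite -{2}(prednK K0) exprS; ring.
  have -> : S = 0 by rewrite /S (cards0_eq K0) big_set0.
  by rewrite !mulr0.
by rewrite le_eqVlt; apply/orP; left; apply/eqP; ring.
Qed.

End spike_induction.

Section fat.
Context {d : measure_display} {T : measurableType d} {R : realType}
  {P : probability T R}.

Lemma bounded_full m (X : 'I_m -> {RV P >-> R}) (A : set T) : iid X uniform_law ->
  measurable A ->
  P (A `&` [set w | forall j, `|X j w| <= 1]) = P A.
Proof.
move=> hX mA; have [iX uX] := hX; have [_ uN] := iid_neg hX.
pose B j := [set w | 1 < X j w] `|` [set w | 1 < negRV (X j) w].
have mB j : measurable (B j).
  by apply: measurableU; apply: measurable_set_lt => //; exact: measurable_funPT.
have B0 j : P (B j) = 0%E.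
  have m1 : measurable [set w | 1 < X j w] by exact: measurable_set_lt.
  have m2 : measurable [set w | 1 < negRV (X j) w].
    by apply: measurable_set_lt => //; exact: measurable_funPT.
  apply/eqP; rewrite eq_le measure_ge0 andbT.
  apply: le_trans (measureU2 _ m1 m2) _.
  have e1 : (P [set w | (1 < X j w)%R] <= 0)%E by rewrite (prob_gt1 uX).
  have e2 : (P [set w | (1 < negRV (X j) w)%R] <= 0)%E by rewrite (prob_gt1 uN).
  by rewrite -[leRHS]adde0; exact: leeD e1 e2.
pose U := \big[setU/set0]_(j < m) B j.
have mU : measurable U by exact: bigsetU_measurable.
have U0 : P U = 0%E.
  apply/eqP; rewrite eq_le measure_ge0 andbT.
  apply: le_trans (measure_bigsetU_le _ _ _ mB) _.
  by rewrite big1// => j _; exact: B0.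
have -> : [set w | forall j, `|X j w| <= 1] = ~` U.
  rewrite /U -(bigcup_pred predT); apply/seteqP; split => w /=.
    move=> h [j _ []] /=; have := h j; rewrite ler_norml => /andP[h1 h2].
      by rewrite ltNge h2.
    by rewrite ltrNr ltNge h1.
  move=> h j; rewrite leNgt; apply/negP; rewrite ltNge ler_norml negb_and -!ltNge.
  by move=> /orP[h1|h1]; apply: h; exists j => //; [right; rewrite /= ltrNr|left].
have mAU : measurable (A `&` ~` U) by apply: measurableI => //; exact: measurableC.
apply/eqP; rewrite eq_le; apply/andP; split.
  by apply: le_measure; rewrite ?inE//; exact: subIsetl.
rewrite -[leRHS]adde0 -U0; apply: le_trans (measureU2 _ mAU mU).
apply: le_measure; rewrite ?inE//; first exact: measurableU.
by move=> w Aw; have [Uw|Uw] := pselect (U w); [right|left].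
Qed.

Lemma fat_prob_ge m (X : 'I_m -> {RV P >-> R}) (J : {set 'I_m}) :
  iid X uniform_law -> #|J| = 5%N ->
  (((8 * 1000 + 162) / 10 ^+ 5)%:E <= P (sums_event X (fat_cone (10 ^- 14)) J 0 0))%E.
Proof.
move=> hX J5.
have c0 : 0 <= 10 ^- 13 :> R by rewrite invr_ge0 exprn_ge0.
have h1 := half_event_ge5 hX J5 c0 (lexx _).
have h2 := half_event_ge5 (iid_neg hX) J5 c0 (lexx _).
pose H1 := half_event X J (10 ^- 13).
pose H2 := half_event (fun i => negRV (X i)) J (10 ^- 13).
have mH1 : measurable H1 by exact: measurable_half_event.
have mH2 : measurable H2 by exact: measurable_half_event.
apply: (@le_trans _ _ (P (H1 `|` H2))).
  rewrite measureU//; last exact: half_events_disjoint.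
  by apply: le_trans (leeD h1 h2); rewrite -EFinD lee_fin; lra.
rewrite -(bounded_full hX); last exact: measurableU.
apply: le_measure; rewrite ?inE.
- rewrite setIC; apply: measurableI; last exact: measurableU.
  rewrite (_ : [set _ | _] = \bigcap_(j in [set: 'I_m]) [set w | `|X j w| <= 1]); last first.
    by apply/seteqP; split => w /= h j; [move=> _; exact: h|exact: h].
  apply: fin_bigcap_measurable => // j _; apply: measurable_set_le => //.
  exact: measurableT_comp.
- by apply: measurable_sums_event; exact: measurable_fat_cone.
move=> w [HH wb]; rewrite /sums_event /fat_cone /= !add0r.
set S := \sum_(j in J) X j w; set Q := \sum_(j in J) X j w ^+ 2.
have S5 : `|S| <= 5.
  have -> : 5 = #|J|%:R :> R by rewrite J5.
  apply: le_trans (ler_norm_sum _ _ _) _; rewrite -sum1_card natr_sum.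
  by apply: ler_sum => j _; exact: wb.
have : r0 * (10 ^- 13 + Q) < S ^+ 2.
  case: HH => -[_]; rewrite -/S -/Q// sumrN sqrrN -/S.
  by under eq_bigr do rewrite sqrrN.
(* With e = 10^-14 and |S| <= 5 the fattening 2 e |S| + r e^2 is at most (10 + r) e, below the
   margin 10 r e = r 10^-13 carried by the half events. *)
have -> : 10 ^- 13 = 10 * 10 ^- 14 :> R.
  have D0 : 10 ^+ 13 != 0 :> R by rewrite expf_neq0.
  by rewrite (exprS (10 : R) 13); move: (10 ^+ 13 : R) D0 => D D0; field.
have e14 : 0 <= 10 ^- 14 :> R by rewrite invr_ge0 exprn_ge0.
have e1 : 10 ^- 14 <= 1 :> R by rewrite invf_le1 ?exprn_gt0// exprn_ege1// ler1n.
move: (10 ^- 14 : R) e14 e1 => e e14 e1 h.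
have : e * `|S| <= e * 5 by rewrite ler_wpM2l.
have : e ^+ 2 <= e by rewrite expr2 ler_piMr.
by move: h; rewrite /r0; lra.
Qed.

End fat.

(** * Student's statistic *)

Section student.
Context {R : realType}.

(** T^2 = 5 S^2 / (6 V) with 6 V = 6 Q - S^2, an increasing function of S^2 / Q that takes the value
    5 r / (6 - r) at r. *)
Lemma student_gt (x : 'I_6 -> R) :
  (Num.sqrt (5 * r0 / (6 - r0)) < `|student_t x|) <->
  (r0 * \sum_i x i ^+ 2 < (\sum_i x i) ^+ 2 /\ 0 < \sum_i (x i - sample_mean x) ^+ 2).
Proof.
set S := \sum_i x i; set Q := \sum_i x i ^+ 2; set V := \sum_i _.
have r00 : 0 < r0 :> R by rewrite /r0; lra.
have r06 : 0 < 6 - r0 :> R by rewrite /r0; lra.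
have VE : 6 * V = 6 * Q - S ^+ 2.
  rewrite /V; under eq_bigr => i _.
    rewrite (_ : _ ^+ 2 = x i ^+ 2 + (- 2 * sample_mean x) * x i + sample_mean x ^+ 2); last by ring.
    over.
  rewrite !big_split/= -mulr_sumr sumr_const card_ord -/Q -/S -mulr_natl /sample_mean -/S.
  by field.
have V0 : 0 <= V by apply: sumr_ge0 => i _; exact: sqr_ge0.
have t0 : 0 <= 5 * r0 / (6 - r0) :> R by apply: divr_ge0; [apply: mulr_ge0 => //; exact: ltW|exact: ltW].
have -> : student_t x = Num.sqrt 6 * (6^-1 * S) / Num.sqrt (5^-1 * V).
  by rewrite /student_t /sample_sd /sample_mean -/S (_ : 6%:R - 1 = 5 :> R)//; lra.
(* When V = 0 the default T = 0 refutes the left side, although S^2 = 6 Q may exceed r Q; this is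
   why the right side carries 0 < V. *)
move: V0; rewrite le_eqVlt => /predU1P[V0|V0].
  rewrite -V0 mulr0 sqrtr0 invr0 mulr0 normr0; split => [|[_]]; last by rewrite ltxx.
  by rewrite ltNge sqrtr_ge0.
have V5 : 0 < 5^-1 * V by rewrite mulr_gt0// invr_gt0.
have TE : `|Num.sqrt 6 * (6^-1 * S) / Num.sqrt (5^-1 * V)| ^+ 2 = 5 * S ^+ 2 / (6 * V).
  rewrite real_normK ?num_real// expr_div_n exprMn !sqr_sqrtr ?(ltW V5)//.
  by field; rewrite lt0r_neq0.
have -> : (Num.sqrt (5 * r0 / (6 - r0)) < `|Num.sqrt 6 * (6^-1 * S) / Num.sqrt (5^-1 * V)|) =
          (5 * r0 / (6 - r0) < 5 * S ^+ 2 / (6 * V)).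
  by rewrite -TE -{2}(sqr_sqrtr t0) ltr_sqr// nnegrE ?sqrtr_ge0.
have -> : (5 * r0 / (6 - r0) < 5 * S ^+ 2 / (6 * V)) = (r0 * Q < S ^+ 2).
  rewrite ltr_pdivlMr ?mulr_gt0// mulrAC ltr_pdivrMr// VE.
  by apply/idP/idP => h; lra.
by split => [->|[]].
Qed.

End student.

Section student_tail.
Context {d : measure_display} {T : measurableType d} {R : realType}
  {P : probability T R}.
Variable X : 'I_6 -> {RV P >-> R}.

Definition scatter (w : T) : R := \sum_i (X i w - sample_mean (X ^~ w)) ^+ 2.

Lemma measurable_scatter : measurable_fun setT scatter.
Proof.
apply: (@measurable_sum _ _ _ _ _ _ (fun i w => (X i w - sample_mean (X ^~ w)) ^+ 2)) => i.
apply: measurable_funX; apply: measurable_funB => //; apply: measurable_funM => //.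
exact: (@measurable_sum _ _ _ _ _ _ (fun i w => X i w)).
Qed.

Lemma student_event :
  [set w | Num.sqrt (5 * r0 / (6 - r0)) < `|student_t (X ^~ w)|] =
  sums_event X cone (finset xpredT) 0 0 `&` [set w | 0 < scatter w].
Proof.
apply/seteqP; split => w /=; rewrite /sums_event /cone /= !sum_finset !add0r.
  by move/student_gt.
by move=> h; apply/student_gt.
Qed.

Lemma measurable_student_event : measurable
  [set w | Num.sqrt (5 * r0 / (6 - r0)) < `|student_t (X ^~ w)|].
Proof.
rewrite student_event; apply: measurableI.
  by apply: measurable_sums_event; exact: measurable_cone.
by apply: measurable_set_lt => //; exact: measurable_scatter.
Qed.

Lemma prob_cone_q : (q X r0)%:E = P (sums_event X cone (finset xpredT) 0 0).
Proof.
rewrite qE; congr (P _); apply/seteqP.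
have r00 : 0 < r0 :> R by rewrite /r0; lra.
by split => w; rewrite /sums_event /cone /= !sum_finset !add0r ratio_gt.
Qed.

Lemma student_tail_le : student_tail X (Num.sqrt (5 * r0 / (6 - r0))) <= q X r0.
Proof.
rewrite -lee_fin prob_cone_q /student_tail fineK; last first.
  by rewrite fin_num_measure//; exact: measurable_student_event.
apply: le_measure; rewrite ?inE.
- exact: measurable_student_event.
- by apply: measurable_sums_event; exact: measurable_cone.
- by rewrite student_event; exact: subIsetl.
Qed.

Lemma scatter_eq0 w : scatter w = 0 -> X ord0 w = X ord_max w.
Proof.
move/eqP; rewrite psumr_eq0; last by move=> i _; exact: sqr_ge0.
move=> /allP h; have xE i : X i w = sample_mean (X ^~ w).
  by apply/eqP; rewrite -subr_eq0 -sqrf_eq0; apply: h; rewrite mem_index_enum.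
by rewrite !xE.
Qed.

Hypothesis iX : mutually_independent X.
Hypothesis X_atomless : forall i x, distribution P (X i) [set x] = 0%E.

Lemma prob_eq_pair (i j : 'I_6) : i != j -> P [set w | X i w = X j w] = 0%E.
Proof.
move=> ij; have ij' : i \notin [set j]%SET by rewrite inE.
pose C := [set pw : R * frozen X [set j]%SET | pw.1 - X j pw.2 = 0].
have mC : measurable C.
  have mf : measurable_fun setT (fun pw : R * frozen X [set j]%SET => pw.1 - X j pw.2).
    apply: measurable_funB; first exact: measurable_fst.
    apply: (@measurableT_comp _ _ _ _ _ _ (X j : frozen X [set j]%SET -> R)) => //.
    by apply: frozen_measurable_fun; rewrite inE.
  by rewrite -[X in measurable X]setTI; apply: (mf measurableT _ (measurable_set1 0)).
transitivity (P [set w | C (X i w, w)]).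
  congr (P _); apply/seteqP; split => w; rewrite /C /=; first by move=> ->; rewrite subrr.
  by move=> /eqP; rewrite subr_eq0 => /eqP.
rewrite (freeze iX ij' mC); apply: integral0_eq => x _.
transitivity (distribution P (X j) [set x]); last exact: X_atomless.
congr (P _); apply/seteqP; split => w; rewrite /C /=; last by move=> ->; rewrite subrr.
by move=> /eqP; rewrite subr_eq0 => /eqP ->.
Qed.

(** The cone event exceeds the tail event only where the scatter vanishes. There all coordinates
    coincide, in particular the first and the last, a null event for independent atomless
    variables. *)
Lemma student_tail_ge :
  (P (sums_event X cone (finset xpredT) 0 0) <=
   (student_tail X (Num.sqrt (5 * r0 / (6 - r0))))%:E)%E.
Proof.
rewrite /student_tail fineK; last first.
  by rewrite fin_num_measure//; exact: measurable_student_event.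
have m1 : measurable (sums_event X cone (finset xpredT) 0 0).
  by apply: measurable_sums_event; exact: measurable_cone.
have m2 : measurable [set w | scatter w <= 0].
  by apply: measurable_set_le => //; exact: measurable_scatter.
have N0 : P [set w | scatter w <= 0] = 0%E.
  apply/eqP; rewrite eq_le measure_ge0 andbT.
  rewrite -(@prob_eq_pair ord0 ord_max)//.
  apply: le_measure; rewrite ?inE//.
    rewrite (_ : [set _ | _] = [set w | X ord0 w <= X ord_max w] `&` [set w | X ord_max w <= X ord0 w]).
      by apply: measurableI; exact: measurable_set_le.
    by apply/seteqP; split => w /=; [move=> ->|case=> h1 h2; apply/eqP; rewrite eq_le h1].
  move=> w /= w0; apply: scatter_eq0; apply/eqP; rewrite eq_le w0/=.
  by apply: sumr_ge0 => i _; exact: sqr_ge0.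
rewrite -[leRHS]adde0 -N0; apply: le_trans (measureU2 _ measurable_student_event m2).
apply: le_measure; rewrite ?inE//.
  by apply: measurableU => //; exact: measurable_student_event.
rewrite student_event => w h; have [s0|s0] := leP (scatter w) 0; first by right.
by left.
Qed.

End student_tail.

Section spike_gap.
Context {R : realType}.

Lemma bernoulli_ineq (p : R) n : 0 <= p <= 1 -> 1 - n%:R * p <= (1 - p) ^+ n.
Proof.
move=> /andP[p0 p1]; elim: n => [|n IH]; first by rewrite mul0r subr0 expr0.
apply: (@le_trans _ _ ((1 - p) * (1 - n%:R * p))).
  have : 0 <= n%:R * p ^+ 2 by rewrite mulr_ge0// sqr_ge0.
  by rewrite -natr1; lra.
by rewrite exprS ler_wpM2l// subr_ge0.
Qed.

(** Bernoulli's inequality bounds the right side below by 6 p (g - x) + 5 p^2 x - 30 p^2 g, where g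
    - x >= 7/10^5 is the gap between the bounds for q_5 and q_6. For p <= 1/20000 the linear gain
    exceeds the quadratic loss plus 5 p^2, and 5 p^2 is the claimed gap at p = 10^-5. *)
Lemma spike_arith (p x : R) : 0 < p -> 20 * p <= 1 / 1000 -> 0 <= x ->
  x <= (815 * 1000 + 497) / 10 ^+ 7 ->
  5 * p ^+ 2 < (1 - p) ^+ 6 * x + p * (1 - p) ^+ 5 * (6%:R * ((8 * 1000 + 162) / 10 ^+ 5)) - x.
Proof.
move=> p0 p1 x0 x1; set g : R := (8 * 1000 + 162) / 10 ^+ 5.
have gx : 7 / (100 * 1000) <= g - x by rewrite /g; lra.
have g1 : 0 <= g <= 82 / 1000 by apply/andP; rewrite /g; split; lra.
have p01 : 0 <= p <= 1 by apply/andP; split; lra.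
have := bernoulli_ineq 5 p01; rewrite [(1 - p) ^+ 6]exprS; move: ((1 - p) ^+ 5) => u hu.
case/andP: g1; move: g gx => g gx g0 g1.
have in0 : 0 <= (1 - p) * x + p * (6 * g).
  by rewrite addr_ge0 ?mulr_ge0//; lra.
have : (1 - 5 * p) * ((1 - p) * x + p * (6 * g)) <= u * ((1 - p) * x + p * (6 * g)).
  by rewrite ler_wpM2r.
have : 0 <= 5 * p ^+ 2 * x by rewrite !mulr_ge0// ltW.
have : p * (7 / (100 * 1000)) <= p * (g - x) by rewrite ler_pM2l.
have : p * p <= p * (1 / (20 * 1000)) by rewrite ler_pM2l//; lra.
have : p ^+ 2 * g <= p ^+ 2 * (82 / 1000) by rewrite ler_wpM2l// sqr_ge0.
by rewrite expr2; lra.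
Qed.

Lemma tail_unit : 1 / (2 * 10 ^+ 9) = 5 * (10 ^- 5) ^+ 2 :> R.
Proof.
rewrite (_ : 10 ^+ 9 = 10 * (10 ^+ 4) ^+ 2 :> R); last by rewrite -exprM -exprS.
rewrite (_ : 10 ^+ 5 = 10 * 10 ^+ 4 :> R); last by rewrite -exprS.
have h4 : 10 ^+ 4 != 0 :> R by rewrite expf_neq0.
by move: (10 ^+ 4 : R) h4 => a a0; field.
Qed.

Lemma small_p : 20 * 10 ^- 5 <= 1 / 1000 :> R.
Proof. by lra. Qed.

Lemma spike_gap (dU : measure_display) (TU : measurableType dU) (PU : probability TU R)
  (U : 'I_6 -> {RV PU >-> R})
  (dX : measure_display) (TX : measurableType dX) (PX : probability TX R)
  (X : 'I_6 -> {RV PX >-> R}) :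
  iid U uniform_law -> iid X (density_law (spike_density (10 ^- 5) (10 ^- 14))) ->
  1 / (2 * 10 ^+ 9) < student_tail X (Num.sqrt (5 * r0 / (6 - r0))) -
                      student_tail U (Num.sqrt (5 * r0 / (6 - r0))).
Proof.
move=> hU hX.
have p0 : 0 <= 10 ^- 5 :> R by rewrite invr_ge0 exprn_ge0.
have p1 : 10 ^- 5 <= 1 :> R by rewrite invf_le1 ?exprn_gt0// exprn_ege1// ler1n.
have p01 : 0 <= (10 ^- 5 : R) <= 1 by rewrite p0.
have e0 : 0 < 10 ^- 14 :> R by rewrite invr_gt0 exprn_gt0.
have X0 i x : distribution PX (X i) [set x] = 0%E.
  have [_ lX] := hX; rewrite lX//; exact: integral_set1.
have tX := student_tail_ge hX.1 X0.
have tU := student_tail_le U.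
have qU := q6_le hU.
have := prob_spike_ge p01 e0 hU hX (finset xpredT) 0 0.
rewrite -prob_cone_q card_finsetT => /le_trans/(_ tX).
pose g : R := (8 * 1000 + 162) / 10 ^+ 5.
have hg : ((g *+ 6)%:E <= \sum_(i in finset xpredT)
    PU (sums_event U (fat_cone (10 ^- 14)) (finset xpredT :\ i) 0 0))%E.
  apply: (@le_trans _ _ (\sum_(i in finset (xpredT : pred 'I_6)) g%:E)%E).
    by rewrite sumEFin sumr_const card_finsetT.
  apply: lee_sum => i _; apply: fat_prob_ge => //.
  by have := card_finsetT 6; rewrite (cardsD1 i) inE => -[].
have al0 : (0 <= (10 ^- 5 * (1 - 10 ^- 5) ^+ 5)%:E :> \bar R)%E.
  by rewrite lee_fin mulr_ge0// exprn_ge0// subr_ge0.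
move=> h; have {h} := le_trans (leeD (lexx _) (lee_wpmul2l al0 hg)) h.
rewrite -!EFinM -EFinD lee_fin => h.
rewrite tail_unit; apply: lt_le_trans (spike_arith _ _ _ qU) _.
- by rewrite invr_gt0 exprn_gt0.
- exact: small_p.
- by rewrite fine_ge0.
by rewrite -[g *+ 6]mulr_natl in h; apply: lerB.
Qed.

End spike_gap.

Section spike_density_facts.
Context {R : realType}.
Variables p e : R.
Hypothesis p01 : 0 <= p <= 1.
Hypothesis e0 : 0 < e.

Lemma is_density_spike : is_density (spike_density p e).
Proof.
have eN : - e < e by rewrite gtrN.
split; [exact: measurable_spike | by move=> x; exact: spike_ge0 |].
rewrite (spike_law_mixture p01 e0 eN)// /uniform_law !probability_setT.
by rewrite !mule1 -EFinD addrC subrK.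
Qed.

Lemma symmetric_spike : symmetric_about0 (spike_density p e).
Proof.
have symI (a x : R) : \1_[set y : R | `|y| < a] (- x) = \1_[set y : R | `|y| < a] x :> R.
  rewrite !indicE; congr (_%:R : R); congr nat_of_bool.
  by apply/idP/idP => /set_mem h; apply: mem_set; move: h; rewrite /= normrN.
by move=> x; rewrite /spike_density !symI.
Qed.

Lemma unimodal_spike : unimodal (spike_density p e).
Proof.
have mono x y : `|x| <= `|y| -> spike_density p e y <= spike_density p e x.
  move=> xy; case/andP: p01 => p0 p1.
  have ind (a : R) : (\1_[set y : R | `|y| < a] y : R) <= \1_[set y : R | `|y| < a] x.
    rewrite !indicE ler_nat; case: (boolP (y \in _)) => // /set_mem/= ya.
    by rewrite mem_set//=; exact: le_lt_trans ya.
  apply: lerD; apply: ler_wpM2l; rewrite ?ind//.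
    by rewrite divr_ge0// mulr_ge0// ltW.
  by rewrite divr_ge0// subr_ge0.
exists 0; split => x y; rewrite !in_itv/= ?andbT => x0 y0 xy; apply: mono.
  by rewrite !ler0_norm// lerN2.
by rewrite !ger0_norm.
Qed.

End spike_density_facts.

(** * The normal tail *)

Section elementary_bounds.
Context {R : realType}.

Lemma le_of_derive_ge0 (F f : R -> R) a x : (forall y, is_derive y (1:R) F (f y)) ->
  (forall y, a <= y -> 0 <= f y) -> a <= x -> F a <= F x.
Proof.
move=> dF f0 ax.
have [|c] := MVT_segment ax (fun y _ => dF y).
  apply: continuous_subspaceT => y; apply: differentiable_continuous.
  by apply/derivable1_diffP; have [] := dF y.
rewrite in_itv/= => /andP[ac _] h.
by rewrite -subr_ge0 h mulr_ge0 ?subr_ge0// f0.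
Qed.

(** (1 - x/2) / (1 + x/2) is the [1/1] Padé approximant of exp(-x). The difference of the two sides
    vanishes at 0 and has derivative exp(-y) (exp y - 1 - y) / 2. *)
Lemma expRN_ge_pade (x : R) : 0 <= x -> (1 - x / 2) <= (1 + x / 2) * expR (- x).
Proof.
move=> x0.
pose F (y : R) := (1 + y / 2) * expR (- y) - (1 - y / 2).
pose f (y : R) := expR (- y) * (expR y - (1 + y)) / 2.
have dF y : is_derive y (1:R) F (f y).
  have d1 : is_derive y (1:R) (fun y : R => expR (- y)) (- expR (- y)).
    have := @is_derive1_comp _ expR (fun y : R => - y) y _ _ (is_derive_expR _) (is_deriveNid y 1).
    by move=> /is_derive_eq; apply; ring.
  rewrite /F; apply: is_derive_eq; rewrite /GRing.scale/= /f.
  have : expR y * expR (- y) = 1 by exact: expRxMexpNx_1.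
  by move=> h; lra.
have f0 y : 0 <= y -> 0 <= f y.
  by move=> _; rewrite /f !mulr_ge0 ?expR_ge0// subr_ge0 expR_ge1Dx.
have := le_of_derive_ge0 dF f0 x0.
by rewrite /F oppr0 expR0; lra.
Qed.

(* One step of the computation of exp(-3/2) as exp(-3/128)^64 by repeated squaring. *)
Lemma expRN_sqr_ge (a b x y : R) : a <= expR (- x) -> 0 <= a -> b <= a ^+ 2 -> y = 2 * x ->
  b <= expR (- y).
Proof.
move=> h a0 ba ->; apply: le_trans ba _.
rewrite (_ : - (2 * x) = 2%:R * - x); last by ring.
by rewrite expRM_natl lerXn2r// ?nnegrE// expR_ge0.
Qed.

Lemma expR_three_halves : 5577 / (25 * 1000) <= expR (- (3 / 2)) :> R.
Proof.
have h0 : 253 / 259 <= expR (- (3 / 128)) :> R.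
  have := @expRN_ge_pade (3 / 128) ltac:(by lra).
  by move: (expR _) => E; lra.
have {h0}h1 : (954 * 1000 + 204) / 10 ^+ 6 <= expR (- (3 / 64)) :> R by apply: (expRN_sqr_ge h0); lra.
have {h1}h2 : (910 * 1000 + 505) / 10 ^+ 6 <= expR (- (3 / 32)) :> R by apply: (expRN_sqr_ge h1); lra.
have {h2}h3 : (829 * 1000 + 19) / 10 ^+ 6 <= expR (- (3 / 16)) :> R by apply: (expRN_sqr_ge h2); lra.
have {h3}h4 : (687 * 1000 + 272) / 10 ^+ 6 <= expR (- (3 / 8)) :> R by apply: (expRN_sqr_ge h3); lra.
have {h4}h5 : (472 * 1000 + 342) / 10 ^+ 6 <= expR (- (3 / 4)) :> R by apply: (expRN_sqr_ge h4); lra.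
by apply: (expRN_sqr_ge h5); lra.
Qed.

(* The positive integral of y^4 (1 - y)^4 / (1 + y^2) over [0, 1] is 22 / 7 - pi. *)
Lemma pi_le_22_7 : pi <= 22 / 7 :> R.
Proof.
pose F (y : R) := y ^+ 7 / 7 - 2 / 3 * y ^+ 6 + y ^+ 5 - 4 / 3 * y ^+ 3 + 4 * y - 4 * atan y.
pose f (y : R) := y ^+ 4 * (1 - y) ^+ 4 / (1 + y ^+ 2).
have dF y : is_derive y (1:R) F (f y).
  rewrite /F; apply: is_derive_eq; rewrite /GRing.scale/= /f.
  have : 1 + y ^+ 2 != 0 by rewrite lt0r_neq0// ltr_wpDr// sqr_ge0.
  by move=> h; field.
have f0 y : 0 <= y -> 0 <= f y.
  move=> _; apply: divr_ge0; last by rewrite addr_ge0 ?sqr_ge0.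
  by apply: mulr_ge0; rewrite exprn_even_ge0.
have := le_of_derive_ge0 dF f0 ler01.
rewrite /F atan0 atan1 !expr0n !expr1n/=; lra.
Qed.
End elementary_bounds.

Ltac poly_ge0 :=
  repeat first [assumption | exact: ler0n | apply: mulr_ge0 | apply: addr_ge0].

(** * A lower bound for Mills' ratio *)

Section mills.
Context {R : realType}.

Definition mills_num (x : R) : R :=
  x * (2895 + x ^+ 2 * (2640 + x ^+ 2 * (588 + x ^+ 2 * (44 + x ^+ 2)))).
Definition mills_den (x : R) : R :=
  945 + x ^+ 2 * (4725 + x ^+ 2 * (3150 + x ^+ 2 * (630 + x ^+ 2 * (45 + x ^+ 2)))).

Let P := mills_num.
Let Q := mills_den.

Let P' (x : R) : R :=
  2895 + x ^+ 2 * (3 * 2640 + x ^+ 2 * (5 * 588 + x ^+ 2 * (7 * 44 + 9 * x ^+ 2))).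
Let Q' (x : R) : R :=
  x * (2 * 4725 + x ^+ 2 * (4 * 3150 + x ^+ 2 * (6 * 630 + x ^+ 2 * (8 * 45 + 10 * x ^+ 2)))).

Let dP x : is_derive x (1:R) P (P' x).
Proof. by rewrite /P /mills_num; apply: is_derive_eq; rewrite /GRing.scale/= /P'; ring. Qed.

Let dQ x : is_derive x (1:R) Q (Q' x).
Proof. by rewrite /Q /mills_den; apply: is_derive_eq; rewrite /GRing.scale/= /Q'; ring. Qed.

Let Q_gt0 x : 0 < Q x.
Proof.
rewrite /Q /mills_den; move: (x ^+ 2) (sqr_ge0 x) => y y0.
apply: ltr_wpDr; last by rewrite ltr0n.
by poly_ge0.
Qed.

(* 10! *)
Let c : R := (10 * 9 * 8 * 7) * (6 * 5 * 4 * 3 * 2).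

(** Divided by Q^2 it reads H' = x H - 1 + c / Q^2 for H = P / Q: the differential equation of
    Mills' ratio up to c / Q^2. Hence -g H is an antiderivative of g (1 - c / Q^2) <= g. *)
Let wronskian x : Q x ^+ 2 - x * P x * Q x + P' x * Q x - P x * Q' x = c.
Proof. by rewrite /P /Q /P' /Q' /mills_num /mills_den /c; ring. Qed.

Let H x := P x / Q x.
Let g (x : R) := expR (- (x ^+ 2 / 2)).
Let F x := - (g x * H x).
Let f x := g x * (1 - c / Q x ^+ 2).

Let dg x : is_derive x (1:R) g (- x * g x).
Proof.
have d1 : is_derive x (1:R) (fun y : R => - (y ^+ 2 / 2)) (- x).
  by apply: is_derive_eq; rewrite /GRing.scale/=; field.
have := @is_derive1_comp _ expR (fun y : R => - (y ^+ 2 / 2)) x _ _ (is_derive_expR _) d1.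
by move=> /is_derive_eq; apply; rewrite /g; ring.
Qed.

Let dF x : is_derive x (1:R) F (f x).
Proof.
have Q0 : Q x != 0 by rewrite lt0r_neq0.
have dV : is_derive x (1:R) (fun y => (Q y)^-1) (- (Q x) ^- 2 *: Q' x) by exact: is_deriveV.
have dH := is_deriveM (dP x) dV.
have dG := is_deriveN (is_deriveM (dg x) dH).
apply: (is_derive_eq dG); rewrite /GRing.scale/= /f -(wronskian x).
have -> : (P * (fun y => (Q y)^-1)) x = P x / Q x by [].
by move: (P x) (Q x) Q0 (P' x) (Q' x) (g x) => p q0 h p' q'' g0; field.
Qed.

Let f_ge0 x : 1 <= x -> 0 <= f x.
Proof.
move=> x1; rewrite /f mulr_ge0 ?expR_ge0// subr_ge0 ler_pdivrMr ?exprn_gt0// mul1r.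
have : 4725 <= Q x.
  rewrite /Q /mills_den; have : 1 <= x ^+ 2 by rewrite exprn_ege1.
  move: (x ^+ 2) => y y1.
  have y0 : 0 <= y by lra.
  apply: (@le_trans _ _ (y * 4725)); first by lra.
  apply: ler_wpDl; first exact: ler0n.
  by apply: ler_wpM2l => //; rewrite lerDl; poly_ge0.
move=> h; apply: (@le_trans _ _ (4725 ^+ 2)); first by rewrite /c; lra.
by apply: lerXn2r; [rewrite nnegrE; exact: ler0n | rewrite nnegrE; exact: ltW | exact: h].
Qed.

Let f_le x : f x <= g x.
Proof.
rewrite /f; apply: ler_piMr; first exact: expR_ge0.
by rewrite gerBl; apply: divr_ge0; [rewrite /c; poly_ge0 | exact: sqr_ge0].
Qed.

Let F_cvg : F x @[x --> +oo] --> 0.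
Proof.
apply/cvgrPdist_le => e e0; near=> x.
have x0 : 0 < x by near: x; exact: nbhs_pinfty_gt.
have P0 : 0 <= P x.
  rewrite /P /mills_num; move: (x ^+ 2) (sqr_ge0 x) => y y0.
  by have := ltW x0; move=> ?; poly_ge0.
have g0 : 0 <= g x <= 1.
  by rewrite expR_ge0/= -[leRHS]expR0 ler_expR oppr_le0 divr_ge0// sqr_ge0.
have H0 : 0 <= H x by rewrite divr_ge0// ltW.
rewrite sub0r opprK ger0_norm; last by rewrite mulr_ge0//; case/andP: g0.
apply: (@le_trans _ _ (H x)); first by rewrite ler_piMl//; case/andP: g0.
(* H <= 1/x because Q - x P is a polynomial in x^2 with nonnegative coefficients. *)
apply: (@le_trans _ _ x^-1).
  rewrite /H ler_pdivrMr// ler_pdivlMl//.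
  rewrite -subr_ge0 /P /Q /mills_num /mills_den.
  rewrite (_ : _ - _ = 945 + x ^+ 2 * (1830 + x ^+ 2 * (510 + x ^+ 2 * (42 + x ^+ 2)))); last by ring.
  by move: (x ^+ 2) (sqr_ge0 x) => y y0; poly_ge0.
by rewrite invf_ple ?posrE//; near: x; apply: nbhs_pinfty_ge; exact: num_real.
Unshelve. all: by end_near. Qed.

(* mills_num x / mills_den x is the tenth convergent of Laplace's continued fraction
   1/(x + 1/(x + 2/(x + 3/(x + ...)))) for Mills' ratio. *)
Lemma normal_tail_ge (a : R) : 1 <= a ->
  ((normal_peak 1 * (expR (- (a ^+ 2 / 2)) * (mills_num a / mills_den a)))%:E <=
    normal_prob 0 1 `]a, +oo[)%E.
Proof.
move=> a1.
have cF x : {for x, continuous F}.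
  by apply: differentiable_continuous; apply/derivable1_diffP; have [] := dF x.
have cQ x : {for x, continuous Q}.
  by apply: differentiable_continuous; apply/derivable1_diffP; have [] := dQ x.
have cg x : {for x, continuous g}.
  by apply: differentiable_continuous; apply/derivable1_diffP; have [] := dg x.
have cf x : {for x, continuous f}.
  apply: cvgM; first exact: cg.
  apply: cvgB; first exact: cvg_cst.
  apply: cvgM; first exact: cvg_cst.
  apply: cvgV; first by rewrite expf_neq0// lt0r_neq0.
  exact: (cvg_comp _ _ (cQ x) (@exprn_continuous _ 2 (Q x))).
have FTC : (\int[lebesgue_measure]_(x in `[a, +oo[) (f x)%:E = 0%:E - (F a)%:E)%E.
  apply: ge0_continuous_FTC2y.
  - by move=> x ax; apply: f_ge0; exact: le_trans ax.
  - exact: continuous_subspaceT.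
  - exact: F_cvg.
  - by move=> x _; have [] := dF x.
  - exact: cvg_at_right_filter (cF a).
  - by move=> x _; rewrite derive1E; apply: derive_val; exact: dF.
have mf : measurable_fun [set: R] f by exact: continuous_measurable_fun.
have k0 : 0 <= normal_peak 1 :> R by exact: normal_peak_ge0.
have f0 x : `]a, +oo[%classic x -> 0 <= f x.
  by rewrite /= in_itv/= andbT => ax; apply: f_ge0; exact: le_trans a1 (ltW ax).
rewrite EFinM (_ : expR _ * _ = 0 - F a); last by rewrite /F sub0r opprK.
rewrite EFinB -FTC -integral_itv_obnd_cbnd//; last first.
  by apply/measurable_EFinP; exact: measurable_funTS.
rewrite -ge0_integralZl//=.
- apply: ge0_le_integral => //=.
  + by move=> x ax; rewrite mule_ge0// lee_fin ?f0.
  + by apply/measurable_EFinP; apply: measurable_funM => //; exact: measurable_funTS.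
  + by apply/measurable_EFinP; apply: measurable_funTS; exact: measurable_normal_pdf.
  + move=> x ax; rewrite -EFinM lee_fin normal_pdfE ?oner_neq0// ler_wpM2l//.
    apply: le_trans (f_le x) _; rewrite /g /normal_fun subr0 expr1n.
    by rewrite mulNr.
- by apply/measurable_EFinP; exact: measurable_funTS.
Qed.

End mills.

Section alpha0.
Context {R : realType}.

Lemma alpha0_gt : 832 / 10 ^+ 4 < (alpha0 : R).
Proof.
pose a : R := Num.sqrt 3.
have a2 : a ^+ 2 = 3 by rewrite sqr_sqrtr.
have a1 : 1 <= a by rewrite -sqrtr1 ler_sqrt// ler1n.
have Ptail : (normal_prob 0 1 `]a, +oo[ : \bar R) = (1 - normal_prob 0 1 `]-oo, a])%E.
  rewrite -probability_setC//; congr (normal_prob _ _ _).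
  by rewrite setCitvl.
have fin : (normal_prob 0 1 `]-oo, a] : \bar R) \is a fin_num by exact: fin_num_measure.
have := normal_tail_ge a1; rewrite Ptail -(fineK fin) -EFinB lee_fin -/(Phi a) => h.
rewrite /alpha0 -/a; apply: lt_le_trans (ler_wpM2l _ h) => //.
have -> : mills_num a / mills_den a = a * (362 / 1341).
  by rewrite /mills_num /mills_den a2; field.
rewrite a2.
(* The square of the left factor is 3 / (2 pi) >= 21/44 by pi <= 22/7. Five digits are kept since
   the final product exceeds 0.0832 by less than 10^-5. *)
have peak : (69 * 1000 + 84) / 10 ^+ 5 <= normal_peak 1 * a :> R.
  have pi0 := @pi_gt0 R.
  have p2 : (normal_peak 1 * a) ^+ 2 = 3 / (2 * pi).
    rewrite exprMn a2 /normal_peak exprVn sqr_sqrtr; last by rewrite expr1n mul1r mulrn_wge0// ltW.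
    by rewrite expr1n mul1r -mulr_natl mulrC.
  have ka : 0 <= normal_peak 1 * a by rewrite mulr_ge0 ?normal_peak_ge0// sqrtr_ge0.
  have h21 : 21 / 44 <= (normal_peak 1 * a) ^+ 2.
    rewrite p2 ler_pdivlMr ?mulr_gt0//; have := @pi_le_22_7 R; lra.
  move: (normal_peak 1 * a) ka h21 => z z0 hz.
  rewrite leNgt; apply/negP => hlt.
  have : z ^+ 2 < ((69 * 1000 + 84) / 10 ^+ 5) ^+ 2 by apply: ltrXn2r.
  by move: hz; lra.
rewrite (_ : normal_peak 1 * (_ * _) = normal_peak 1 * a * expR (- (3 / 2)) * (362 / 1341)); last by ring.
have := @expR_three_halves R.
move: (normal_peak 1 * a) (expR _) peak => z e hz he.
have : (69 * 1000 + 84) / 10 ^+ 5 * (5577 / (25 * 1000)) <= z * e :> R.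
  by apply: ler_pM; [lra | lra | exact: hz | exact: he].
by move: (z * e) => u; lra.
Qed.

End alpha0.

Theorem mainTheorem8 (R : realType) :
  let r : R := 61 / 20 in
  let t : R := Num.sqrt (5 * r / (6 - r)) in
  let f : R -> R := spike_density (10 ^- 5) (10 ^- 14) in
  t = Num.sqrt (305 / 59) /\
  [/\ is_density f, symmetric_about0 f & unimodal f] /\
  forall (dU5 : measure_display) (TU5 : measurableType dU5)
    (PU5 : probability TU5 R) (U5 : 'I_5 -> {RV PU5 >-> R})
    (dU6 : measure_display) (TU6 : measurableType dU6)
    (PU6 : probability TU6 R) (U6 : 'I_6 -> {RV PU6 >-> R})
    (dX : measure_display) (TX : measurableType dX)
    (PX : probability TX R) (X : 'I_6 -> {RV PX >-> R}),
  iid U5 uniform_law ->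
  iid U6 uniform_law ->
  iid X (density_law f) ->
  [/\ 51 / 625 < q U5 r,
      163 / 2000 < q U6 r < 1631 / (2 * 10 ^+ 4),
      1 / (2 * 10 ^+ 4) < q U5 r - q U6 r,
      q U6 r < 832 / 10 ^+ 4 < (alpha0 : R) &
      1 / (2 * 10 ^+ 9) < student_tail X t - student_tail U6 t].
Proof.
move=> r t f; split.
  by rewrite /t /r (_ : 6 - 61 / 20 = 59 / 20 :> R); [congr Num.sqrt; field | lra].
have p01 : 0 <= (10 ^- 5 : R) <= 1.
  by rewrite invr_ge0 exprn_ge0//= invf_le1 ?exprn_gt0// exprn_ege1// ler1n.
have e0 : 0 < 10 ^- 14 :> R by rewrite invr_gt0 exprn_gt0.
split.
  exact: And3 (is_density_spike p01 e0) (symmetric_spike _ _) (unimodal_spike p01 e0).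
move=> dU5 TU5 PU5 U5 dU6 TU6 PU6 U6 dX TX PX X hU5 hU6 hX.
have er : r = r0 by [].
have h5 := q5_ge hU5; have g6 := q6_ge hU6; have l6 := q6_le hU6.
have gap := spike_gap hU6 hX; have al := @alpha0_gt R.
rewrite er; split; [| | | |exact: gap].
- by move: (q U5 r0) h5 => x; lra.
- by move: (q U6 r0) g6 l6 => x; move=> g6 l6; apply/andP; split; lra.
- by move: (q U5 r0) (q U6 r0) h5 l6 => x y; lra.
- by rewrite al andbT; move: (q U6 r0) l6 => x; lra.
Qed.
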